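(* Let $(X,d)$ be a geometrically doubling metric space equipped with an upper doubling measure $\mu$ with dominating function $\lambda$. Let $T$ be a Calderón-Zygmund operator that is bounded on $L^2(\mu)$. Then $T$ is bounded from $H^{1,\infty}_{at}(\mu)$ into $L^1(\mu)$. Consequently, $T$ is bounded on $L^p(\mu)$ for all $1<p<\infty$.
   Context: $B(x,r)=\{y: d(y,x)<r\}$. A ball $B$ has center $x_B$ and radius $r_B$, and $aB=B(x_B,ar_B)$. Geometrically doubling: there is $N\in\mathbb{N}$ such that every ball $B(x,r)$ can be covered by at most $N$ balls of radius $r/2$. Upper doubling: $\mu$ is a Borel measure and there is $\lambda:X\times(0,\infty)\to(0,\infty)$ such that $r\mapsto\lambda(x,r)$ is increasing for each $x$; $\lambda(x,2r)\le C_\lambda\lambda(x,r)$; $\mu(B(x,r))\le\lambda(x,r)$; and $\lambda(x,r)\approx\lambda(y,r)$ (uniform constants) whenever $d(x,y)\le r$. For balls $B\subset Q$, $K_{B,Q}=1+\int_{r_B\le d(x,x_B)\le r_Q}\frac{1}{\lambda(x_B,d(x,x_B))}\,d\mu(x)$. Atomic Hardy space: fix $\rho>1$. A function $b\in L^1_{\mathrm{loc}}(\mu)$ is an atomic block if: (i) $\operatorname{supp}b\subset B$ for some ball $B$; (ii) $\int b\,d\mu=0$; (iii) $b=\sum_{j=1}^\infty\lambda_ja_j$ with convergence in $L^1(\mu)$, where $\lambda_j\in\mathbb{R}$, $a_j$ is supported on a ball $B_j\subset B$, and $\|a_j\|_{L^\infty(\mu)}\le(\mu(\rho B_j)K_{B_j,B})^{-1}$.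 Put $|b|_{H^{1,\infty}_{at}(\mu)}=\sum_j|\lambda_j|$. Then $f\in H^{1,\infty}_{at}(\mu)$ if $f=\sum_ib_i$ with atomic blocks $b_i$ and $\sum_i|b_i|_{H^{1,\infty}_{at}(\mu)}<\infty$; $\|f\|_{H^{1,\infty}_{at}(\mu)}$ is the infimum of these sums over all such decompositions. The space does not depend on $\rho>1$. Calderón-Zygmund kernel: $K\in L^1_{\mathrm{loc}}(X\times X\setminus\{x=y\})$ such that for some constants $C,c>0$ and $0<\delta\le1$: (i) $|K(x,y)|\le C\min\{\frac1{\lambda(x,d(x,y))},\frac1{\lambda(y,d(x,y))}\}$; (ii) $|K(x,y)-K(x',y)|+|K(y,x)-K(y,x')|\le C\frac{d(x,x')^\delta}{d(x,y)^\delta\lambda(x,d(x,y))}$ if $d(x,x')\le c\,d(x,y)$. A linear operator $T$ is a Calderón-Zygmund operator with kernel $K$ if $Tf(x)=\int_XK(x,y)f(y)\,d\mu(y)$ for all $f\in L^\infty(\mu)$ with bounded support and $x\notin\operatorname{supp}f$. *)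

(* Defs.v *)
From HB Require Import structures.
From mathcomp Require Import all_boot all_order all_algebra.
From mathcomp Require Import all_classical all_reals all_analysis.

Set Implicit Arguments.
Unset Strict Implicit.
Unset Printing Implicit Defensive.

Import Order.TTheory GRing.Theory Num.Def Num.Theory.
Import numFieldNormedType.Exports.

Local Open Scope classical_set_scope.
Local Open Scope ring_scope.

(* Metric spaces equipped with their Borel sigma-algebra.  A measurableType is
   pointed, whence the auxiliary join. *)
#[short(type="pmetricType")]
HB.structure Definition PointedMetric (R : numDomainType) :=
  {X of Metric R X & Pointed X}.

HB.mixin Record isBorel (R : numDomainType) (d : measure_display) X
    & Metric R X & Measurable d X := {
  borel_measurableE : (@measurable d X) = <<s @open X >>
}.

#[short(type="metricBorelType")]
HB.structure Definition MetricBorel (R : numDomainType) (d : measure_display) :=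
  {X of Metric R X & Measurable d X & isBorel R d X}.

Section Spaces.
Context (R : realType) (d : measure_display) (X : metricBorelType R d).
Implicit Types (mu : {measure set X -> \bar R}) (lam : X -> R -> R).

Definition geometrically_doubling : Prop :=
  exists N : nat, forall (x : X) (r : R), 0 < r ->
    exists2 s : seq X, (size s <= N)%N &
      ball x r `<=` [set y | exists2 z, z \in s & ball z (r / 2) y].

(* A dominating function is defined on X x ]0, +oo[: the values of [lam x] at
   nonpositive radii are never used. *)
Definition upper_doubling mu lam : Prop :=
  [/\ forall x r, 0 < r -> 0 < lam x r,
      forall x r s, 0 < r -> r <= s -> lam x r <= lam x s,
      exists C : R, forall x r, 0 < r -> lam x (2 * r) <= C * lam x r,
      forall x r, 0 < r -> (mu (ball x r) <= (lam x r)%:E)%E &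
      exists C : R, forall x y r, 0 < r -> mdist x y <= r ->
        lam x r <= C * lam y r].

(* A ball is given by its center and its radius, since the underlying set
   determines neither. *)
Definition in_ball (B : X * R) : set X := ball B.1 B.2.

Definition dilate (a : R) (B : X * R) : X * R := (B.1, a * B.2).

Definition K_coef mu lam (B Q : X * R) : \bar R :=
  (1 + \int[mu]_(x in [set x | (B.2 <= mdist x B.1 <= Q.2)%R])
         ((lam B.1 (mdist x B.1))^-1)%:E)%E.

(* "f is supported in A", for f defined up to null sets. *)
Definition supported_in mu (f : X -> R) (A : set X) : Prop :=
  {ae mu, forall x, ~ A x -> f x = 0}.

(* The support of a class of functions: the complement of the largest open set
   on which f vanishes almost everywhere. *)
Definition supp mu (f : X -> R) : set X :=
  [set x | forall r, 0 < r -> ~ supported_in mu f (~` ball x r)].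

Definition bounded_support mu (f : X -> R) : Prop :=
  exists B : X * R, supported_in mu f (in_ball B).

Definition L1_loc mu (f : X -> R) : Prop :=
  measurable_fun setT f /\
  forall x, exists2 r : R, 0 < r & mu.-integrable (ball x r) (EFin \o f).

Definition sums_in_L1 mu (u : nat -> X -> R) (f : X -> R) : Prop :=
  'N[mu]_1 [(fun x => (f x - \sum_(j < n) u j x)%R%:E)]%E @[n --> \oo]
    --> 0%E.

End Spaces.

Section Hardy.
Context (R : realType) (d : measure_display) (X : metricBorelType R d).
Context (mu : {measure set X -> \bar R}) (lam : X -> R -> R) (rho : R).

Record atomic_block (b : X -> R) (B : X * R) (l : nat -> R)
    (a : nat -> X -> R) (Bj : nat -> X * R) : Prop := AtomicBlock {
  block_radius : 0 < B.2 ;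
  block_L1_loc : L1_loc mu b ;
  block_support : supported_in mu b (in_ball B) ;
  block_mean0 : (\int[mu]_x (b x)%:E = 0)%E ;
  block_sum : sums_in_L1 mu (fun j x => l j * a j x) b ;
  atom_radius : forall j, 0 < (Bj j).2 ;
  atom_ball : forall j, in_ball (Bj j) `<=` in_ball B ;
  atom_measurable : forall j, measurable_fun setT (a j) ;
  atom_support : forall j, supported_in mu (a j) (in_ball (Bj j)) ;
  atom_size : forall j,
    ('N[mu]_+oo [EFin \o a j] <=
     (mu (in_ball (dilate rho (Bj j))) * K_coef mu lam (Bj j) B)^-1)%E
}.

(* [t] is the value of |b| = \sum_j |l_j| for some representation of [b] as an
   atomic block. *)
Definition block_value (b : X -> R) (t : \bar R) : Prop :=
  exists B l a Bj, atomic_block b B l a Bj /\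
    t = (\sum_(0 <= j <oo) `|l j|%:E)%E.

Definition H1_decomposition (f : X -> R) (t : \bar R) : Prop :=
  exists (b : nat -> X -> R) (s : nat -> \bar R),
    [/\ forall i, block_value (b i) (s i), sums_in_L1 mu b f &
        t = (\sum_(0 <= i <oo) s i)%E].

Definition H1at : set (X -> R) :=
  [set f | f \in Lfun mu 1 /\
           exists2 t, H1_decomposition f t & (t < +oo)%E].

Definition H1at_norm (f : X -> R) : \bar R :=
  ereal_inf [set t | H1_decomposition f t].

End Hardy.

Section Operators.
Context (R : realType) (d : measure_display) (X : metricBorelType R d).
Context (mu : {measure set X -> \bar R}).

(* The kernel lives off the diagonal, and its values on the diagonal are never
   constrained. *)
Definition CZ_kernel (lam : X -> R -> R) (K : X -> X -> R) : Prop :=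
  [/\ measurable_fun [set z : X * X | z.1 <> z.2] (fun z => K z.1 z.2),
      forall x y, x <> y -> exists2 r : R, 0 < r &
        (mu \x mu)%E.-integrable (ball x r `*` ball y r)
          (fun z : X * X => (K z.1 z.2)%:E) &
      exists C c delta : R,
        [/\ 0 < C, 0 < c, 0 < delta <= 1,
            forall x y, x <> y ->
              `|K x y| <= C * Num.min (lam x (mdist x y))^-1
                                      (lam y (mdist x y))^-1 &
            forall x x' y, x <> y -> x' <> y ->
              mdist x x' <= c * mdist x y ->
              `|K x y - K x' y| + `|K y x - K y x'| <=
                C * (mdist x x' `^ delta /
                     (mdist x y `^ delta * lam x (mdist x y)))]].

(* Operators act on representatives; linearity is up to null sets. *)
Definition linear_on (E : set (X -> R)) (T : (X -> R) -> X -> R) : Prop :=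
  forall (a : R) (f g : X -> R), E f -> E g ->
    T (fun x => a * f x + g x) = (fun x => a * T f x + T g x) %[ae mu].

Definition Lp (p : \bar R) : set (X -> R) := [set f | f \in Lfun mu p].

Definition bounded_from (E : set (X -> R)) (NE : (X -> R) -> \bar R)
    (q : \bar R) (T : (X -> R) -> X -> R) : Prop :=
  exists C : R, forall f, E f ->
    Lp q (T f) /\ ('N[mu]_q [EFin \o T f] <= C%:E * NE f)%E.

Definition Lp_bounded (p : \bar R) : ((X -> R) -> X -> R) -> Prop :=
  bounded_from (Lp p) (fun f => 'N[mu]_p [EFin \o f])%E p.

(* The operator is given on L^2(mu), which contains the bounded functions with
   bounded support, balls having finite measure. *)
Definition CZ_operator (lam : X -> R -> R) (K : X -> X -> R)
    (T : (X -> R) -> X -> R) : Prop :=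
  [/\ CZ_kernel lam K, linear_on (Lp 2%:E) T &
      forall f, Lp +oo f -> bounded_support mu f ->
        {ae mu, forall x, ~ supp mu f x ->
          (T f x)%:E = (\int[mu]_y (K x y * f y)%:E)%E}].

(* [S] is the realization on [E] of an operator [T] given on L^2(mu): it is
   linear on [E] and coincides with [T] on the intersection of [E] with
   L^2(mu). *)
Definition extends_L2 (T : (X -> R) -> X -> R) (E : set (X -> R))
    (S : (X -> R) -> X -> R) : Prop :=
  linear_on E S /\ forall f, E f -> Lp 2%:E f -> S f = T f %[ae mu].

End Operators.

(* Main.v *)
(* Let T' be the adjoint of T on bounded functions with bounded support; it is a
   Calderon-Zygmund operator for the transposed kernel.  For such an h with
   |h| <= 1, the function T'h has bounded oscillation in the sense of RBMO: for
   balls B included in Q, the integral over B of |T'h - c_Q| is at most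
   D mu(rho B) K_{B,Q}, where c_Q is the integral defining T'h at the centre of
   Q, restricted to the complement of a dilate of Q.  As atomic blocks have mean
   zero, the pairing of an atomic block b with T'h is at most D |b|; hence
   f |-> <f, T'h> defines S f in L^1 by duality, through the Riesz
   representation (Radon-Nikodym) theorem.

   For L^p, let |f| <= 1.  Around almost every point where |Tf| is large there is
   a largest doubling ball on which the mean of |Tf|^2 is large.  The next
   doubling ball has a small mean, so that the oscillation estimate bounds the
   far part of Tf on the first ball, and Vitali's covering lemma gives by
   induction the exponential decay mu {|Tf| > 1 + nM} <= C 4^-n \int |f|^2.
   Decomposing f into dyadic pieces and using Young's inequality, one gets
   |<Tf, g>| <= A (\int |f|^p + \int |g|^q) for 2 < p and 1/p + 1/q = 1, then for
   p < 2 by exchanging T and T', and the extension to L^p follows by duality. *)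

Require Import Defs.
From HB Require Import structures.
From mathcomp Require Import all_boot all_order all_algebra.
From mathcomp Require Import all_classical all_reals all_analysis.
From mathcomp Require Import measurable_realfun ess_sup_inf ring lra.

Set Implicit Arguments.
Unset Strict Implicit.
Unset Printing Implicit Defensive.

Import Order.TTheory GRing.Theory Num.Def Num.Theory.
Import numFieldNormedType.Exports.

Local Open Scope classical_set_scope.
Local Open Scope ring_scope.

(** * Integrals of real functions *)

(** For [f] in the Hardy space the product of [f] and [T'h] need not be integrable, since [T'h] only
    has bounded oscillation. The pairing is therefore the limit of the integrals of [f] against
    [T'h] clipped at height [n]. Clipping is 1-Lipschitz, so it does not increase oscillation and
    every estimate on a block is uniform in [n]. The limit mentions no decomposition of [f], which
    makes [S] well defined, linear and equal to [T] on square-integrable functions without comparing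
    two decompositions. As [mu] need not be doubling, the stopping and differentiation arguments use
    radii in geometric progression of ratio 8 and balls with mu(8B) <= b mu(B). The factor 8 leaves
    room for the factor 3 of the covering lemma followed by the dilation by 2 that separates the
    near part of [h] from its far part. The condition [CZO] passes to the adjoint with the same
    constants, so each estimate is proved once, for a generic operator. *)

Lemma cvg_from (R : realType) (u : nat -> R) (l : R) (N : nat) :
  (forall n, (N <= n)%N -> u n = l) -> u n @[n --> \oo] --> l.
Proof.
move=> h; apply/cvgrPdist_le => e e0; near=> n.
rewrite h ?subrr ?normr0 ?ltW//; near: n; exact: nbhs_infty_ge.
Unshelve. all: by end_near.
Qed.

Lemma cvg0_le (R : realType) (u v : nat -> R) : (forall n, `|u n| <= v n) ->
  v n @[n --> \oo] --> (0 : R) -> u n @[n --> \oo] --> (0 : R).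
Proof.
move=> uv v0; apply/cvgrPdist_le => e e0.
have /cvgrPdist_le/(_ e e0) := v0; apply: filterS => n.
by rewrite !sub0r !normrN => h; rewrite (le_trans (uv n))// (le_trans (ler_norm _)).
Qed.

Lemma cvg_const_eq (R : realType) (u : nat -> R) (a b : R) :
  (forall n, u n = b) -> u n @[n --> \oo] --> a -> b = a.
Proof.
move=> ub; rewrite (_ : u = fun=> b); last exact/funext.
by move=> h; apply: cvg_unique h => //; exact: cvg_cst.
Qed.

Section RealIntegral.
Context d (T : measurableType d) (R : realType).
Variable mu : {measure set T -> \bar R}.
Implicit Types (f g : T -> R) (A : set T).

Definition ig f := mu.-integrable [set: T] (EFin \o f).
Definition J f := \int[mu]_x f x.

Lemma ig_meas f : ig f -> measurable_fun [set: T] f.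
Proof. by move=> /integrableP[/measurable_EFinP]. Qed.

Lemma igP f : ig f <->
  measurable_fun [set: T] f /\ (\int[mu]_x `|f x|%:E < +oo)%E.
Proof.
split; first by move=> /integrableP[/measurable_EFinP].
by move=> [mf fy]; apply/integrableP; split => //; exact/measurable_EFinP.
Qed.

Lemma ig_le f g : measurable_fun [set: T] f -> (forall x, `|f x| <= g x) ->
  ig g -> ig f.
Proof.
move=> mf fg; apply: le_integrable => //; first exact/measurable_EFinP.
by move=> x _; rewrite lee_fin (le_trans (fg x))// ler_norm.
Qed.

Lemma ig_le_ae f g : measurable_fun [set: T] f ->
  {ae mu, forall x, `|f x| <= g x} -> ig g -> ig f.
Proof.
move=> mf fg /igP[mg gy]; apply/igP; split => //.
apply: le_lt_trans gy; apply: ae_ge0_le_integral => //.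
- by apply/measurable_EFinP; exact: measurableT_comp.
- by apply/measurable_EFinP; exact: measurableT_comp.
- by apply: filterS fg => x fg _; rewrite lee_fin (le_trans fg)// ler_norm.
Qed.

Lemma eq_ig f g : f =1 g -> ig f -> ig g.
Proof. by move=> /funext ->. Qed.

Lemma eq_J f g : f =1 g -> J f = J g.
Proof. by move=> /funext ->. Qed.

Lemma igD f g : ig f -> ig g -> ig (fun x => f x + g x).
Proof. exact: integrableD. Qed.

Lemma igB f g : ig f -> ig g -> ig (fun x => f x - g x).
Proof. exact: integrableB. Qed.

Lemma igZ (a : R) f : ig f -> ig (fun x => a * f x).
Proof. exact: integrableZl. Qed.

Lemma ig0 : ig (fun=> 0).
Proof. exact: integrable0. Qed.

Lemma ig_abs f : ig f -> ig (fun x => `|f x|).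
Proof.
move=> /[dup] /ig_meas mf /integrable_norm; exact.
Qed.

Lemma ig_sum I (s : seq I) (P : pred I) (F : I -> T -> R) :
  (forall i, P i -> ig (F i)) -> ig (fun x => \sum_(i <- s | P i) F i x).
Proof.
move=> iF; elim: s => [|i s IH].
  by apply: eq_ig ig0 => x; rewrite big_nil.
have [Pi|Pi] := boolP (P i).
  by apply: eq_ig (igD (iF _ Pi) IH) => x; rewrite big_cons Pi.
by apply: eq_ig IH => x; rewrite big_cons (negbTE Pi).
Qed.

Lemma JD f g : ig f -> ig g -> J (fun x => f x + g x) = J f + J g.
Proof. exact: RintegralD. Qed.

Lemma JB f g : ig f -> ig g -> J (fun x => f x - g x) = J f - J g.
Proof. exact: RintegralB. Qed.

Lemma JZ (a : R) f : ig f -> J (fun x => a * f x) = a * J f.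
Proof. exact: RintegralZl. Qed.

Lemma J0 : J (fun=> 0) = 0.
Proof. by rewrite /J /Rintegral integral0. Qed.

Lemma J_sum I (s : seq I) (P : pred I) (F : I -> T -> R) :
  (forall i, P i -> ig (F i)) ->
  J (fun x => \sum_(i <- s | P i) F i x) = \sum_(i <- s | P i) J (F i).
Proof.
move=> iF; elim: s => [|i s IH].
  by rewrite big_nil -[RHS]J0; apply: eq_J => x; rewrite big_nil.
rewrite big_cons -IH; case: ifPn => Pi.
  rewrite -JD//; [|exact: iF|exact: ig_sum].
  by apply: eq_J => x; rewrite big_cons Pi.
by apply: eq_J => x; rewrite big_cons (negbTE Pi).
Qed.

Lemma J_ge0 f : (forall x, 0 <= f x) -> 0 <= J f.
Proof. by move=> f0; exact: Rintegral_ge0. Qed.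

Lemma J_le f g : ig f -> ig g -> (forall x, f x <= g x) -> J f <= J g.
Proof. by move=> fi gi fg; exact: le_Rintegral. Qed.

Lemma J_norm f : ig f -> `|J f| <= J (fun x => `|f x|).
Proof. exact: le_normr_Rintegral. Qed.

Lemma EFin_J f : ig f -> (J f)%:E = (\int[mu]_x (f x)%:E)%E.
Proof. by move=> fi; rewrite /J /Rintegral fineK//; exact: integrable_fin_num. Qed.

Lemma eq_J_ae f g : ig f -> ig g -> {ae mu, forall x, f x = g x} -> J f = J g.
Proof.
move=> fi gi fg; rewrite /J /Rintegral; congr fine.
apply: ae_eq_integral => //.
- exact: measurable_int fi.
- exact: measurable_int gi.
- by apply: filterS fg => x -> _.
Qed.

(** [min f g] is below [g] everywhere and equals [f] almost everywhere, which reduces the claim to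
    [J_le]. *)
Lemma J_le_ae f g : ig f -> ig g -> {ae mu, forall x, f x <= g x} -> J f <= J g.
Proof.
move=> fi gi fg; rewrite (@eq_J_ae f (fun x => Num.min (f x) (g x)))//.
- apply: J_le => //; last by move=> x; rewrite ge_min lexx orbT.
  apply: ig_le (igD (ig_abs fi) (ig_abs gi)).
    by apply: measurable_minr; exact: ig_meas.
  move=> x; rewrite /Num.min; case: ifP => _; first by rewrite lerDl.
  by rewrite lerDr.
- apply: ig_le (igD (ig_abs fi) (ig_abs gi)).
    by apply: measurable_minr; exact: ig_meas.
  move=> x; rewrite /Num.min; case: ifP => _; first by rewrite lerDl.
  by rewrite lerDr.
- by apply: filterS fg => x fg; rewrite (min_idPl fg).
Qed.

Lemma J_norm_le f g : ig f -> ig g -> (forall x, `|f x| <= g x) -> `|J f| <= J g.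
Proof.
by move=> fi gi fg; rewrite (le_trans (J_norm fi))// J_le//; exact: ig_abs.
Qed.

Lemma J_eq0_ae f : ig f -> (forall x, 0 <= f x) -> J f = 0 ->
  {ae mu, forall x, f x = 0}.
Proof.
move=> fi f0 J0.
have : (\int[mu]_x `|(f x)%:E| = 0)%E.
  rewrite -[RHS](congr1 EFin J0) EFin_J//; apply: eq_integral => x _.
  by rewrite gee0_abs ?lee_fin.
have mf := ig_meas fi.
move/(ae_eq_integral_abs mu measurableT); move=> /(_ _)/wrap[].
  exact/measurable_EFinP.
by apply: filterS => x /(_ Logic.I)[].
Qed.

Lemma J_dct (F : nat -> T -> R) f g : (forall n, measurable_fun [set: T] (F n)) ->
  measurable_fun [set: T] f -> ig g ->
  (forall n, {ae mu, forall x, `|F n x| <= g x}) ->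
  {ae mu, forall x, F ^~ x @ \oo --> f x} ->
  [/\ forall n, ig (F n), ig f & J (F n) @[n --> \oo] --> J f].
Proof.
move=> mF mf gi Fg Ff.
have [|||||fi _ cv] := @dominated_convergence _ _ _ mu setT measurableT
  (fun n => EFin \o F n) (EFin \o f) (EFin \o g).
- by move=> n; exact/measurable_EFinP.
- exact/measurable_EFinP.
- by apply: filterS Ff => x Ff _; apply: cvg_EFin => //; near=> n.
- exact: gi.
- have : {ae mu, forall x n, `|F n x| <= g x} by exact: ae_foralln.
  by apply: filterS => x Fgx n _; rewrite lee_fin.
- have Fi n : ig (F n) by exact: ig_le_ae (Fg n) gi.
  split => //; apply: fine_cvg; rewrite /= -/(J f).
  by rewrite fineK; [exact: cv|exact: integrable_fin_num].
Unshelve. all: by end_near.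
Qed.

(** Integrability of the limit is a conclusion here: membership in L^1, L^2 or L^p is obtained below
    from uniform bounds on truncations. *)
Lemma ig_fatou (F : nat -> T -> R) f (M : R) : (forall n, ig (F n)) ->
  (forall n x, 0 <= F n x) -> (forall n, J (F n) <= M) ->
  measurable_fun [set: T] f -> (forall x, F ^~ x @ \oo --> f x) ->
  ig f /\ J f <= M.
Proof.
move=> Fi F0 FM mf Ff.
have f0 x : 0 <= f x.
  rewrite -(cvg_lim (@Rhausdorff R) (Ff x)); apply: limr_ge.
    by apply/cvg_ex; exists (f x); exact: Ff.
  by apply: nearW => n; exact: F0.
have le : (\int[mu]_x (f x)%:E <= M%:E)%E.
  have := @fatou _ _ _ mu setT measurableT (fun n => EFin \o F n).
  move=> /(_ (fun n => (measurable_EFinP _ _).2 (ig_meas (Fi n)))).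
  move=> /(_ (fun n x _ => F0 n x)) h; apply: le_trans (le_trans h _).
    rewrite (@eq_integral _ _ _ mu setT (fun x => limn_einf (fun n => (F n x)%:E)))//.
    move=> x _; apply/esym; apply: (cvg_limn_einf_sup _).1.
    by apply: cvg_EFin; [near=> n|exact: Ff].
  rewrite limn_einf_lim; apply: lime_le; first exact: is_cvg_einfs.
  near=> n; apply: (@le_trans _ _ (\int[mu]_x (F n x)%:E)%E).
    by apply: ereal_inf_lbound; exists n => //=.
  by rewrite -EFin_J// lee_fin.
have fi : ig f.
  apply/igP; split => //; rewrite (le_lt_trans _ (ltry M))//.
  rewrite (le_trans _ le)//; under eq_integral do rewrite ger0_norm//.
  exact: lexx.
by split => //; rewrite -lee_fin EFin_J.
Unshelve. all: by end_near.
Qed.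

End RealIntegral.

(** * Geometrically doubling metric spaces *)

Section Indicator.
Context (R : realType) (T : Type).
Implicit Type A : set T.

Lemma indT A x : A x -> \1_A x = 1 :> R.
Proof. by move=> Ax; rewrite indicE mem_set. Qed.

Lemma indF A x : ~ A x -> \1_A x = 0 :> R.
Proof. by move=> Ax; rewrite indicE memNset. Qed.

Lemma ind_ge0 A x : 0 <= \1_A x :> R.
Proof. by rewrite indicE. Qed.

Lemma ind_le1 A x : \1_A x <= 1 :> R.
Proof. by rewrite indicE; case: (_ \in _). Qed.

Lemma ind_sub A B x : A `<=` B -> \1_A x <= \1_B x :> R.
Proof.
move=> AB; have [Ax|Ax] := pselect (A x); last by rewrite (indF Ax) ind_ge0.
by rewrite !indT//; exact: AB.
Qed.

Lemma indM A x : \1_A x * \1_A x = \1_A x :> R.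
Proof. by rewrite !indicE -natrM mulnb andbb. Qed.

Lemma indC A x : \1_(~` A) x = 1 - \1_A x :> R.
Proof.
have [Ax|Ax] := pselect (A x); last by rewrite (indF Ax) indT ?subr0.
by rewrite (indT Ax) indF ?subrr//= => /(_ Ax).
Qed.

End Indicator.
Arguments indT {R T A x}.
Arguments indF {R T A x}.
Arguments ind_ge0 {R T}.
Arguments ind_le1 {R T}.
Arguments ind_sub {R T A B}.

Section Geometry.
Context (R : realType) (d : measure_display) (X : metricBorelType R d).
Implicit Types (x y z : X) (r s : R).

Lemma in_ballE x y r : ball x r y = (mdist x y < r) :> Prop.
Proof. by rewrite ballEmdist. Qed.

Lemma mdist_lt x y z r s : mdist x y < r -> mdist y z < s -> mdist x z < r + s.
Proof. by move=> a b; rewrite (le_lt_trans (metric_triangle x y z))// ltrD. Qed.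

Lemma mdist_gt0' x y : x <> y -> 0 < mdist x y.
Proof. by move=> /eqP; rewrite mdist_gt0. Qed.

Lemma sub_ball x y r s : mdist x y + r <= s -> ball y r `<=` ball x s.
Proof.
move=> h z; rewrite !in_ballE => yz.
by have := metric_triangle x y z; lra.
Qed.

Lemma open_metric (A : set X) :
  (forall x, A x -> exists2 e, 0 < e & ball x e `<=` A) -> open A.
Proof.
move=> h; rewrite openE => x /h[e e0 xA]; rewrite /interior.
by apply/nbhs_ballP; exists e.
Qed.

Lemma openP_metric (A : set X) x : open A -> A x ->
  exists2 e, 0 < e & ball x e `<=` A.
Proof.
rewrite openE => oA /oA; rewrite /interior => /nbhs_ballP[e /= e0 h].
by exists e.
Qed.

Lemma ball_openm x r : open (ball x r).
Proof.
apply: open_metric => y; rewrite in_ballE => xy.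
by exists (r - mdist x y); [rewrite subr_gt0|apply: sub_ball; lra].
Qed.

Lemma open_borel (A : set X) : open A -> measurable A.
Proof. by move=> oA; rewrite borel_measurableE; exact: sub_sigma_algebra. Qed.

Lemma mball x r : measurable (ball x r).
Proof. by apply: open_borel; exact: ball_openm. Qed.

Lemma measurable_mdist z : measurable_fun [set: X] (mdist z).
Proof.
move=> mT; apply: (measurability _ (RGenInftyO.measurableE R)) => //.
move=> _ [_ [c ->] <-]; rewrite setTI.
have -> : mdist z @^-1` `]-oo, c[ = ball z c.
  by apply/seteqP; split => y; rewrite in_ballE /= in_itv.
exact: mball.
Qed.

Section Net.
Variable N : nat.
Hypothesis XN : forall (x : X) (r : R), 0 < r ->
  exists2 s : seq X, (size s <= N)%N &
    ball x r `<=` [set y | exists2 z, z \in s & ball z (r / 2) y].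

Lemma net_exp (j : nat) x r : 0 < r ->
  exists2 s : seq X, (size s <= N ^ j)%N &
    ball x r `<=` [set y | exists2 z, z \in s & ball z (r / 2 ^+ j) y].
Proof.
move=> r0; elim: j => [|j [s sN sb]].
  by exists [:: x] => // y xy; exists x; rewrite ?mem_head//= expr0 divr1.
have r1 : 0 < r / 2 ^+ j by rewrite divr_gt0// exprn_gt0.
have /choice[g gP] : forall z : X, exists t : seq X, (size t <= N)%N /\
    ball z (r / 2 ^+ j) `<=` [set y | exists2 w, w \in t & ball w (r / 2 ^+ j / 2) y].
  by move=> z; have [t ? ?] := XN z r1; exists t.
exists (flatten (map g s)).
  rewrite size_flatten /shape -map_comp expnSr.
  apply: leq_trans (leq_mul sN (leqnn N)).
  elim: s {sN sb} => //= z s IH; rewrite mulSn leq_add//.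
  by have [] := gP z.
move=> y /sb[z zs /(gP z).2[w wt wy]]; exists w; last first.
  by rewrite exprSr invfM mulrA.
by apply/flattenP; exists (g z) => //; exact: map_f.
Qed.

End Net.

Hypothesis Xd : geometrically_doubling X.

Lemma net_eps x r e : 0 < e -> exists s : seq X,
  ball x r `<=` [set y | exists2 z, z \in s & ball z e y].
Proof.
move=> e0; have [N XN] := Xd.
pose r' := Num.max r 1; have r'0 : 0 < r' by rewrite lt_max ltr01 orbT.
have [j ej] : exists j, r' / 2 ^+ j <= e.
  have [j] : exists j : nat, r' / e <= j%:R.
    by exists (Num.truncn (r' / e)).+1; rewrite ltW// truncnS_gt.
  rewrite ler_pdivrMr// => h; exists j; rewrite ler_pdivrMr ?exprn_gt0//.
  rewrite (le_trans h)// mulrC ler_wpM2l ?ltW// -natrX ltr_nat.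
  by rewrite ltn_expl.
have [s _ sb] := net_exp XN j x r'0; exists s => y xy.
have [|z zs zy] := sb y.
  by apply: sub_ball xy; rewrite mdistxx add0r le_max lexx.
by exists z => //; apply: sub_ball zy; rewrite mdistxx add0r.
Qed.

(** The centres have to lie in [E], where the radii of the covering lemma are controlled. A net at
    scale [e / 2] is taken and each centre whose ball meets [E] is replaced by a point of [E] in
    that ball. *)
Lemma net_in (E : set X) x r e : 0 < e -> E `<=` ball x r ->
  exists s : seq X, (forall y, y \in s -> E y) /\
    E `<=` [set y | exists2 z, z \in s & ball z e y].
Proof.
move=> e0 Eb; have e2 : 0 < e / 2 by lra.
have [s sb] := net_eps x r e2.
have /choice[g gP] : forall z : X, exists t : seq X,
    (forall y, y \in t -> E y) /\
    E `&` ball z (e / 2) `<=` [set y | exists2 w, w \in t & ball w e y].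
  move=> z; have [[w [Ew zw]]|h] := pselect (exists w, E w /\ ball z (e / 2) w).
    exists [:: w]; split; first by move=> y; rewrite inE => /eqP ->.
    move=> y [_ zy]; exists w; rewrite ?mem_head//.
    rewrite !in_ballE in zw zy *; rewrite metric_sym in zw.
    by have := mdist_lt zw zy; rewrite -splitr.
  by exists [::]; split => // y [Ey zy]; exfalso; apply: h; exists y.
exists (flatten (map g s)); split.
  by move=> y /flattenP[_ /mapP[z _ ->]]; exact: (gP z).1.
move=> y Ey; have [z zs zy] := sb y (Eb y Ey).
have [w wt wy] := (gP z).2 y (conj Ey zy); exists w => //.
by apply/flattenP; exists (g z) => //; exact: map_f.
Qed.

(** Finite nets of scale 1/(n+1) in the ball of radius n, read as one sequence through a coding of
    pairs of naturals; numbers coding no pair give an arbitrary point. *)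
Lemma countable_dense : exists D : nat -> X, forall x e, 0 < e ->
  exists n, mdist (D n) x < e.
Proof.
have h n : exists s : seq X, ball point n%:R `<=`
    [set y | exists2 z, z \in s & ball z (n.+1%:R^-1) y].
  by apply: net_eps; rewrite invr_gt0.
have [g gP] := choice h.
exists (fun k => let p := odflt (0, 0)%N (unpickle k) in nth point (g p.1) p.2).
move=> x e e0.
pose n := (maxn (Num.truncn (mdist point x)) (Num.truncn e^-1)).+1.
have [|z zs zx] := gP n x.
  rewrite in_ballE (lt_le_trans (truncnS_gt _))// ler_nat ltnS.
  exact: leq_maxl.
exists (pickle (n, index z (g n))); rewrite pickleK /= nth_index//.
move: zx; rewrite in_ballE => /lt_le_trans; apply.
rewrite -[leRHS]invrK lef_pV2 ?posrE ?invr_gt0//.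
apply: (le_trans (ltW (truncnS_gt _))); rewrite ler_nat (@leq_trans n)//.
by rewrite ltnS leq_maxr.
Qed.

(** The product carries the product sigma-algebra, so openness of the set is not enough.
    Separability is used: two distinct points are separated by a ball from a countable family. *)
Lemma measurable_offdiag : measurable [set z : X * X | z.1 <> z.2].
Proof.
have [D DP] := countable_dense.
have -> : [set z : X * X | z.1 <> z.2] =
    \bigcup_n \bigcup_m (ball (D n) (m.+1%:R^-1) `*` ~` ball (D n) (m.+1%:R^-1)).
  apply/seteqP; split => [[x y] /= xy|[x y] /= [n _ [m _ [/= a b]]]]; last first.
    by move=> xy; apply: b; rewrite -xy.
  have xy0 := mdist_gt0' xy.
  pose m := Num.truncn (2 / mdist x y).
  have m1 : 2 * m.+1%:R^-1 < mdist x y :> R.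
    by rewrite ltr_pdivrMr// -ltr_pdivrMl// mulrC truncnS_gt.
  have m0 : 0 < m.+1%:R^-1 :> R by rewrite invr_gt0.
  have [n nx] := DP x _ m0.
  exists n => //; exists m => //; split; rewrite /= in_ballE// => ny.
  rewrite (metric_sym (D n) x) in nx.
  by have := lt_trans m1 (mdist_lt nx ny); rewrite mulr_natl mulr2n ltxx.
apply: bigcup_measurable => n _; apply: bigcup_measurable => m _.
by apply: measurableX; [exact: mball|apply: measurableC; exact: mball].
Qed.

End Geometry.

(** * Upper doubling measures *)

Section Dominating.
Context (R : realType) (d : measure_display) (X : metricBorelType R d).
Context (mu : {measure set X -> \bar R}) (lam : X -> R -> R).
Hypothesis mud : upper_doubling mu lam.
Implicit Types (x y z : X) (r s : R).

Let lam_gt0 x r : 0 < r -> 0 < lam x r.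
Proof. by case: mud => h _ _ _ _; exact: h. Qed.

Let lam_nd x r s : 0 < r -> r <= s -> lam x r <= lam x s.
Proof. by case: mud => _ h _ _ _; exact: h. Qed.

Lemma mu_ball_lam x r : 0 < r -> (mu (ball x r) <= (lam x r)%:E)%E.
Proof. by case: mud => _ _ _ h _; exact: h. Qed.

Lemma mu_ball_lty x r : (mu (ball x r) < +oo)%E.
Proof.
apply: le_lt_trans (ltry (lam x (Num.max r 1))).
apply: le_trans (mu_ball_lam x _); last by rewrite lt_max ltr01 orbT.
apply: le_measure; rewrite ?inE; [exact: mball|exact: mball|].
by apply: sub_ball; rewrite mdistxx add0r le_max lexx.
Qed.

Lemma lam_scale (M : R) : exists C : R, 0 < C /\
  forall x r, 0 < r -> 0 < M -> lam x (M * r) <= C * lam x r.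
Proof.
have [_ _ [C0 C0P] _ _] := mud.
pose C := Num.max C0 1; have C1 : 1 <= C by rewrite le_max lexx orbT.
have Cp : 0 < C by rewrite (lt_le_trans ltr01).
have CP x r : 0 < r -> lam x (2 * r) <= C * lam x r.
  move=> r0; rewrite (le_trans (C0P x r r0))// ler_wpM2r ?(ltW (lam_gt0 _ _))//.
  by rewrite le_max lexx.
have CPn (n : nat) x r : 0 < r -> lam x (2 ^+ n * r) <= C ^+ n * lam x r.
  move=> r0; elim: n => [|n IH]; first by rewrite !expr0 !mul1r.
  rewrite exprS -mulrA (le_trans (CP _ _ _)) ?mulr_gt0 ?exprn_gt0//.
  by rewrite exprS -mulrA ler_wpM2l// ltW.
pose n := (Num.truncn M).+1.
exists (C ^+ n); split; first by rewrite exprn_gt0.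
move=> x r r0 M0; rewrite (le_trans _ (CPn n x r r0))// lam_nd ?mulr_gt0//.
rewrite ler_wpM2r ?(ltW r0)// (le_trans (ltW (truncnS_gt M)))//.
by rewrite -natrX ler_nat ltnW// ltn_expl.
Qed.

Lemma lam_comp (M : R) : exists C : R, 0 < C /\
  forall x y r s, 0 < r -> 0 < s -> r <= M * s -> mdist x y <= M * s ->
    lam x r <= C * lam y s.
Proof.
have [_ _ _ _ [C0 C0P]] := mud.
pose C := Num.max C0 1; have C1 : 1 <= C by rewrite le_max lexx orbT.
have Cp : 0 < C by rewrite (lt_le_trans ltr01).
have [C2 [C2p C2P]] := lam_scale M.
exists (C * C2); split; first by rewrite mulr_gt0.
move=> x y r s r0 s0 rs xy.
have Ms0 : 0 < M * s by exact: lt_le_trans rs.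
have M0 : 0 < M by rewrite -(pmulr_lgt0 _ s0).
rewrite (le_trans (lam_nd _ r0 rs))// (le_trans (C0P x y _ Ms0 xy))//.
rewrite (@le_trans _ _ (C * lam y (M * s)))//.
  by rewrite ler_wpM2r ?(ltW (lam_gt0 _ _))// le_max lexx.
by rewrite -mulrA ler_wpM2l ?(ltW Cp)// C2P.
Qed.

Definition m (A : set X) : R := fine (mu A).

Lemma m_ge0 A : 0 <= m A.
Proof. exact: fine_ge0. Qed.

Lemma EFin_m A x r : measurable A -> A `<=` ball x r -> (m A)%:E = mu A.
Proof.
move=> mA Ab; rewrite /m fineK// ge0_fin_numE//.
apply: le_lt_trans (mu_ball_lty x r).
by apply: le_measure; rewrite ?inE//; exact: mball.
Qed.

Lemma ig_ind A x r : measurable A -> A `<=` ball x r -> ig mu (\1_A : X -> R).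
Proof.
move=> mA Ab; apply/igP; split; first exact: measurable_indic.
under eq_integral do rewrite ger0_norm ?ind_ge0//.
by rewrite integral_indic// setIT -(EFin_m mA Ab) ltry.
Qed.

Lemma ig_ind_ball x r : ig mu (\1_(ball x r) : X -> R).
Proof. by apply: (@ig_ind _ x r) => //; exact: mball. Qed.

Lemma J_ind A : measurable A -> J mu (\1_A : X -> R) = m A.
Proof. by move=> mA; rewrite /J /Rintegral integral_indic// setIT. Qed.

Lemma J_ind_ball x r : J mu (\1_(ball x r) : X -> R) = m (ball x r).
Proof. by rewrite J_ind//; exact: mball. Qed.

Lemma m_le A B x r : measurable A -> measurable B -> A `<=` B ->
  B `<=` ball x r -> m A <= m B.
Proof.
move=> mA mB AB Bb; rewrite -lee_fin (EFin_m mA (subset_trans AB Bb)).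
by rewrite (EFin_m mB Bb); apply: le_measure; rewrite ?inE.
Qed.

Lemma m_ball_le x y r s : ball x r `<=` ball y s -> m (ball x r) <= m (ball y s).
Proof. by move=> h; apply: (@m_le _ _ y s) => //; exact: mball. Qed.

Lemma m_ball_lam x r : 0 < r -> m (ball x r) <= lam x r.
Proof.
by move=> r0; rewrite -lee_fin (EFin_m (mball _ _) (@subset_refl _ _)) mu_ball_lam.
Qed.

(** Monotonicity in the radius is what makes [lam z] measurable; the maximum with [r] keeps the
    argument among the positive radii, where [lam] is constrained. *)
Lemma measurable_lam_inv z r : 0 < r ->
  measurable_fun [set: X] (fun y => (lam z (Num.max (mdist z y) r))^-1).
Proof.
move=> r0.
apply: (@measurableT_comp _ _ _ _ _ _ (fun t : R => (lam z (Num.max t r))^-1)).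
  apply: nonincreasing_measurable => // s t st.
  have p u : 0 < Num.max u r by rewrite lt_max r0 orbT.
  rewrite lef_pV2 ?posrE ?lam_gt0// lam_nd//.
  by rewrite ge_max !le_max st lexx !orbT.
exact: measurable_mdist.
Qed.

(* The integrand of the Hoelder tail of the kernel. *)
Definition tail delta z r y : R :=
  \1_(~` ball z r) y *
    (r `^ delta / (mdist z y `^ delta * lam z (mdist z y))).

Lemma measurable_tail delta z r : 0 < r ->
  measurable_fun [set: X] (tail delta z r).
Proof.
move=> r0.
have -> : tail delta z r = fun y => \1_(~` ball z r) y *
    (r `^ delta * ((Num.max (mdist z y) r `^ (- delta)) *
      (lam z (Num.max (mdist z y) r))^-1)).
  apply/funext => y; rewrite /tail.
  have [zy|zy] := pselect (ball z r y).
    by rewrite indF ?mul0r//= => /(_ zy).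
  have zr : r <= mdist z y by rewrite leNgt; apply/negP; rewrite -in_ballE.
  by rewrite (max_idPl zr) powRN invfM.
apply: measurable_funM.
  by apply: measurable_indic; apply: measurableC; exact: mball.
apply: measurable_funM => //; apply: measurable_funM; last first.
  exact: measurable_lam_inv.
apply: (measurableT_comp (measurable_powR _)).
by apply: measurable_maxr => //; exact: measurable_mdist.
Qed.

Lemma tail_ge0 delta z r y : 0 < r -> 0 <= tail delta z r y.
Proof.
move=> r0; rewrite /tail.
have [zy|zy] := pselect (ball z r y).
  by rewrite indF ?mul0r//= => /(_ zy).
have zr : r <= mdist z y by rewrite leNgt; apply/negP; rewrite -in_ballE.
rewrite mulr_ge0 ?ind_ge0// mulr_ge0 ?powR_ge0// invr_ge0 mulr_ge0 ?powR_ge0//.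
by rewrite ltW// lam_gt0// (lt_le_trans r0).
Qed.

(* Dyadic shells: the shell of radius 2^k r contributes at most 2^(-k delta)
   times a ratio of values of [lam] at consecutive scales. *)
Lemma tail_bound delta : 0 < delta -> exists C : R, 0 < C /\
  forall z r, 0 < r -> ig mu (tail delta z r) /\ J mu (tail delta z r) <= C.
Proof.
move=> d0; have [C2 [C2p C2P]] := lam_scale 2.
pose q : R := (2 `^ delta)^-1.
have q0 : 0 < q by rewrite invr_gt0 powR_gt0.
have q1 : q < 1.
  rewrite invf_lt1 ?powR_gt0//.
  rewrite -[ltLHS](powRr0 2) /powR pnatr_eq0/= ltr_expR mul0r mulr_gt0//.
  by rewrite ln_gt0// ltr1n.
have geom n : \sum_(k < n) q ^+ k <= (1 - q)^-1.
  rewrite -[leRHS]mul1r ler_pdivlMr ?subr_gt0// mulrC -opprB mulNr -subrX1.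
  by rewrite opprB gerBl exprn_ge0// ltW.
exists (C2 / (1 - q)); split; first by rewrite divr_gt0// subr_gt0.
move=> z r r0.
have r2 k : 0 < 2 ^+ k * r by rewrite mulr_gt0// exprn_gt0.
(* [F n] keeps the first [n] shells and [G n] is a sum of one indicator per shell; the limit is
   taken by Fatou's lemma at the end. *)
pose F n y := \1_(ball z (2 ^+ n * r)) y * tail delta z r y.
pose G n y := \sum_(k < n)
  (q ^+ k / lam z (2 ^+ k * r)) * \1_(ball z (2 ^+ k.+1 * r)) y.
have Gi n : ig mu (G n).
  apply: ig_sum => k _; apply: igZ; exact: ig_ind_ball.
have FG n y : F n y <= G n y.
  elim: n => [|n IH].
    rewrite /F /G big_ord0 expr0 mul1r /tail.
    have [zy|zy] := pselect (ball z r y); last by rewrite (indF zy) mul0r.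
    by rewrite (@indF _ _ (~` _) y) ?mul0r ?mulr0//= => /(_ zy).
  rewrite /G big_ord_recr /= -/(G n y).
  have [zy|zy] := pselect (ball z (2 ^+ n * r) y).
    rewrite (@le_trans _ _ (F n y))//.
      rewrite /F ler_wpM2r ?tail_ge0// (indT zy) ind_le1//.
    rewrite (le_trans IH)// lerDl mulr_ge0 ?ind_ge0// divr_ge0 ?exprn_ge0 ?(ltW q0)//.
    by rewrite ltW// lam_gt0.
  have G0 : 0 <= G n y.
    rewrite /G sumr_ge0// => k _; rewrite mulr_ge0 ?ind_ge0//.
    by rewrite divr_ge0 ?exprn_ge0 ?(ltW q0)// ltW// lam_gt0.
  have [zy1|zy1] := pselect (ball z (2 ^+ n.+1 * r) y); last first.
    rewrite /F (indF zy1) mul0r mulr0 addr0//.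
  rewrite /F (indT zy1) mul1r mulr1 ler_wpDl// /tail.
  have zn : 2 ^+ n * r <= mdist z y.
    by rewrite leNgt; apply/negP; rewrite -in_ballE.
  have zr : r <= mdist z y.
    by rewrite (le_trans _ zn)// ler_peMl ?(ltW r0)// exprn_ege1// ler1n.
  have zy0 : 0 < mdist z y by rewrite (lt_le_trans r0).
  rewrite indT ?mul1r; last by rewrite /setC /= in_ballE; apply/negP; rewrite -leNgt.
  rewrite invfM mulrA ler_pM//.
  - by rewrite mulr_ge0 ?powR_ge0// invr_ge0 powR_ge0.
  - by rewrite invr_ge0 ltW// lam_gt0.
  - rewrite ler_pdivrMr ?powR_gt0// -ler_pdivrMl ?exprn_gt0//.
    rewrite /q exprVn invrK.
    have -> : (2 `^ delta) ^+ n = (2 ^+ n) `^ delta :> R.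
      by rewrite -powR_mulrn ?powR_ge0// -powRrM mulrC powRrM powR_mulrn.
    rewrite -powRM ?exprn_ge0 ?(ltW r0)//.
    by rewrite ge0_ler_powR ?nnegrE ?(ltW d0) ?(ltW (r2 _)) ?(ltW zy0).
  - by rewrite lef_pV2 ?posrE ?lam_gt0// lam_nd.
have JG n : J mu (G n) <= C2 / (1 - q).
  rewrite /G J_sum; last by move=> k _; apply: igZ; exact: ig_ind_ball.
  apply: (@le_trans _ _ (C2 * \sum_(k < n) q ^+ k)); last first.
    by rewrite ler_wpM2l// ltW.
  rewrite mulr_sumr; apply: ler_sum => k _.
  rewrite JZ ?J_ind_ball; last exact: ig_ind_ball.
  rewrite mulrC mulrCA [leRHS]mulrC ler_wpM2l ?exprn_ge0 ?(ltW q0)//.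
  rewrite ler_pdivrMr ?lam_gt0//.
  rewrite (le_trans (m_ball_lam z (r2 k.+1)))//.
  by rewrite exprS -mulrA C2P.
have mt := measurable_tail delta z r0.
have mF n : measurable_fun setT (F n).
  apply: measurable_funM => //.
  by apply: measurable_indic; exact: mball.
have F0 n y : 0 <= F n y by rewrite mulr_ge0 ?ind_ge0 ?tail_ge0.
have Fi n : ig mu (F n).
  by apply: ig_le (Gi n) => // y; rewrite ger0_norm.
apply: (@ig_fatou _ _ _ mu F) => //.
  by move=> n; rewrite (le_trans _ (JG n))// J_le.
move=> y; apply: (@cvg_from _ _ _ (Num.truncn (mdist z y / r)).+1) => n hn.
rewrite /F indT ?mul1r// in_ballE -ltr_pdivrMr//.
rewrite (lt_trans (truncnS_gt _))// -natrX ltr_nat.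
by rewrite (leq_ltn_trans hn)// ltn_expl.
Qed.

End Dominating.

(** * Standard kernels *)

Section Kernel.
Context (R : realType) (d : measure_display) (X : metricBorelType R d).
Context (mu : {measure set X -> \bar R}) (lam : X -> R -> R).
Hypothesis mud : upper_doubling mu lam.
Implicit Types (x y z : X) (r s : R) (K : X -> X -> R) (f g h : X -> R).

Let lam_gt0 x r : 0 < r -> 0 < lam x r.
Proof. by case: mud => h _ _ _ _; exact: h. Qed.

Let lam_nd x r s : 0 < r -> r <= s -> lam x r <= lam x s.
Proof. by case: mud => _ h _ _ _; exact: h. Qed.

(* A standard kernel, made measurable on the whole of X * X by an arbitrary
   choice on the diagonal. *)
Record std_kernel K (C c delta : R) : Prop := StdKernel {
  sk_C : 0 < C ;
  sk_c : 0 < c ;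
  sk_delta : 0 < delta ;
  sk_meas : measurable_fun [set: X * X] (fun p : X * X => K p.1 p.2) ;
  sk_meas' : measurable_fun [set: X * X] (fun p : X * X => K p.2 p.1) ;
  sk_size : forall x y, x <> y -> `|K x y| <= C / lam x (mdist x y) ;
  sk_size' : forall x y, x <> y -> `|K y x| <= C / lam x (mdist x y) ;
  sk_reg : forall x x' y, x <> y -> x' <> y -> mdist x x' <= c * mdist x y ->
    `|K x y - K x' y| <=
      C * (mdist x x' `^ delta / (mdist x y `^ delta * lam x (mdist x y))) ;
  sk_reg' : forall x x' y, x <> y -> x' <> y -> mdist x x' <= c * mdist x y ->
    `|K y x - K y x'| <=
      C * (mdist x x' `^ delta / (mdist x y `^ delta * lam x (mdist x y)))
}.

Lemma std_kernel_tr K C c delta : std_kernel K C c delta ->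
  std_kernel (fun x y => K y x) C c delta.
Proof. by case=> *; split. Qed.

Lemma measurable_kernelr K C c delta x : std_kernel K C c delta ->
  measurable_fun [set: X] (K x).
Proof.
move=> sk.
exact: (@measurable_fun_pair2 _ _ _ _ _ _ (fun z : X * X => K z.1 z.2) x (sk_meas sk)).
Qed.

Lemma nball_neq z r y : 0 < r -> ~ ball z r y -> z <> y.
Proof. by move=> r0 h zy; apply: h; rewrite -zy in_ballE mdistxx. Qed.

Lemma nball_le z r y : ~ ball z r y -> r <= mdist z y.
Proof. by move=> h; rewrite leNgt; apply/negP; rewrite -in_ballE. Qed.

Lemma kernel_bound K C c delta z s y : std_kernel K C c delta -> 0 < s ->
  ~ ball z s y -> `|K z y| <= C / lam z s.
Proof.
move=> sk s0 zy; rewrite (le_trans (sk_size sk (nball_neq s0 zy)))//.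
rewrite ler_wpM2l ?(ltW (sk_C sk))// lef_pV2 ?posrE ?lam_gt0//.
  by rewrite lam_nd// nball_le.
by rewrite (lt_le_trans s0)// nball_le.
Qed.

(* Hoermander's condition, including the part of the annulus where only the
   size of the kernel is available. *)
Lemma hormander K C c delta (a : R) : std_kernel K C c delta -> 1 < a ->
  exists H : R, 0 < H /\ forall z r x, 0 < r -> ball z r x ->
    ig mu (fun y => \1_(~` ball z (a * r)) y * `|K x y - K z y|) /\
    J mu (fun y => \1_(~` ball z (a * r)) y * `|K x y - K z y|) <= H.
Proof.
move=> sk a1.
have C0 := sk_C sk; have c0 := sk_c sk.
have [T0 [T0p T0P]] := tail_bound mud (sk_delta sk).
(* Outside the ball of radius [M * r] the point [x] satisfies d(z,x) < r <= c d(z,y), so that the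
   regularity of the kernel applies. *)
pose M := Num.max a c^-1.
have M0 : 0 < M by rewrite lt_max invr_gt0 c0 orbT.
have [L1 [L1p L1P]] := lam_comp mud (Num.max 1 (a - 1)^-1).
have [L2 [L2p L2P]] := lam_scale mud M.
(* On the annulus between [a * r] and [M * r] the two terms bound [K z y] and [K x y]. The second
   needs lam(z,r) <= L1 lam(x,d(x,y)), which holds as d(x,y) >= (a-1) r. *)
pose D := C + C * L1.
have D0 : 0 < D by rewrite addr_gt0// mulr_gt0.
exists (C * T0 + D * L2); split; first by rewrite addr_gt0// mulr_gt0.
move=> z r x r0 zx.
pose G y := C * tail lam delta z r y +
  (D / lam z r) * \1_(ball z (M * r)) y.
have Mr : 0 < M * r by rewrite mulr_gt0.
have [ti tJ] := T0P z r r0.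
have ib := ig_ind_ball mud z (M * r).
have Gi : ig mu G by apply: igD; exact: igZ.
have JG : J mu G <= C * T0 + D * L2.
  rewrite /G JD ?JZ//; [|exact: igZ..].
  rewrite lerD ?ler_wpM2l ?(ltW C0)// (J_ind_ball mu) -mulrA ler_wpM2l ?(ltW D0)//.
  rewrite mulrC ler_pdivrMr ?lam_gt0//.
  by rewrite (le_trans (m_ball_lam mud z Mr))// L2P.
have FG y : \1_(~` ball z (a * r)) y * `|K x y - K z y| <= G y.
  have G0 : 0 <= G y.
    rewrite addr_ge0// mulr_ge0 ?ind_ge0 ?(tail_ge0 mud)// ?(ltW C0)//.
    by rewrite divr_ge0 ?(ltW D0)// ltW// lam_gt0.
  have [zy|zy] := pselect (ball z (a * r) y).
    by rewrite indF ?mul0r//= => /(_ zy).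
  rewrite indT// mul1r.
  have ar : r < a * r by rewrite ltr_pMl.
  have zyr : ~ ball z r y.
    by move=> h; apply: zy; rewrite in_ballE; rewrite in_ballE in h; exact: lt_trans ar.
  have zy' := nball_neq r0 zyr.
  have zx' : mdist z x < r by rewrite -in_ballE.
  have ray := nball_le zy.
  have rzy := nball_le zyr.
  have xy : (a - 1) * r <= mdist x y.
    have := metric_triangle z x y; rewrite mulrBl mul1r; lra.
  have a10 : 0 < (a - 1) * r by rewrite mulr_gt0// subr_gt0.
  have xy' : x <> y.
    by move=> e; move: xy; rewrite e mdistxx leNgt a10.
  have lz := lam_gt0 z r0.
  have [zyM|zyM] := pselect (ball z (M * r) y).
    rewrite /G (indT zyM) mulr1 ler_wpDl//.
      by rewrite mulr_ge0 ?(tail_ge0 mud)// ltW.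
    rewrite (le_trans (ler_normB _ _))// addrC mulrDl lerD//.
      exact: (kernel_bound sk).
    rewrite (le_trans (sk_size sk xy'))// -mulrA ler_wpM2l ?(ltW C0)//.
    have xy0 : 0 < mdist x y by exact: mdist_gt0'.
    rewrite -[leLHS]mul1r ler_pdivrMr ?lam_gt0// mulrAC ler_pdivlMr// mul1r.
    apply: L1P => //.
      rewrite (@le_trans _ _ ((a - 1)^-1 * mdist x y))//.
        by rewrite ler_pdivlMl// subr_gt0.
      by rewrite ler_wpM2r ?(ltW xy0)// le_max lexx orbT.
    rewrite (le_trans (ltW zx'))// (@le_trans _ _ ((a - 1)^-1 * mdist x y))//.
      by rewrite ler_pdivlMl// subr_gt0.
    by rewrite ler_wpM2r ?(ltW xy0)// le_max lexx orbT.
  rewrite /G (indF zyM) mulr0 addr0 /tail indT// mul1r distrC.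
  have Mzy := nball_le zyM.
  have zy0 := mdist_gt0' zy'.
  apply: le_trans (sk_reg sk zy' xy' _) _.
    rewrite (le_trans (ltW zx'))// -ler_pdivrMl// (le_trans _ Mzy)//.
    by rewrite ler_wpM2r ?(ltW r0)// le_max lexx orbT.
  rewrite ler_wpM2l ?(ltW C0)// ler_wpM2r//.
    by rewrite invr_ge0 mulr_ge0 ?powR_ge0// ltW// lam_gt0.
  by rewrite ge0_ler_powR ?nnegrE ?(ltW (sk_delta sk)) ?mdist_ge0 ?(ltW r0)// ltW.
have mK x' := measurable_kernelr x' sk.
have Fi : ig mu (fun y => \1_(~` ball z (a * r)) y * `|K x y - K z y|).
  apply: ig_le Gi => [|y].
    apply: measurable_funM.
      by apply: measurable_indic; apply: measurableC; exact: mball.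
    by apply: measurableT_comp => //; exact: measurable_funB.
  by rewrite ger0_norm ?FG// mulr_ge0// ind_ge0.
by split => //; rewrite (le_trans _ JG)// J_le.
Qed.

(* Bounded measurable functions with bounded support. *)
Definition bb (f : X -> R) := measurable_fun [set: X] f /\
  exists z r M, forall x, `|f x| <= M * \1_(ball z r) x.

Lemma bbP f : bb f -> exists r M, [/\ 0 < r, 0 < M &
  forall x, `|f x| <= M * \1_(ball point r) x].
Proof.
move=> [_ [z [r [M h]]]].
exists (Num.max 1 (mdist point z + r)), (Num.max 1 M).
split; rewrite ?lt_max ?ltr01// => x.
rewrite (le_trans (h x))//.
apply: (@le_trans _ _ (Num.max 1 M * \1_(ball z r) x)).
  by rewrite ler_wpM2r ?ind_ge0// le_max lexx orbT.
rewrite ler_wpM2l ?le_max ?ler01//; apply: ind_sub; apply: sub_ball.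
by rewrite le_max lexx orbT.
Qed.

Lemma bb_meas f : bb f -> measurable_fun [set: X] f.
Proof. by case. Qed.

Lemma bb_ig f : bb f -> ig mu f.
Proof.
move=> /[dup] [[mf _]] /bbP[r [M [_ _ h]]].
by apply: ig_le (igZ M (ig_ind_ball mud point r)).
Qed.

Lemma bbM f g : bb f -> measurable_fun [set: X] g ->
  (exists M : R, forall x, `|g x| <= M) -> bb (fun x => f x * g x).
Proof.
move=> [mf [z [r [M h]]]] mg [M' h']; split; first exact: measurable_funM.
exists z, r, (M * M') => x; rewrite normrM mulrAC ler_pM//.
Qed.

Lemma bbMl f g : bb g -> measurable_fun [set: X] f ->
  (exists M : R, forall x, `|f x| <= M) -> bb (fun x => f x * g x).
Proof.
move=> bg mf h; have := bbM bg mf h; congr bb.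
by apply/funext => x; rewrite mulrC.
Qed.

Lemma bb_ind f A : bb f -> measurable A -> bb (fun x => \1_A x * f x).
Proof.
move=> bf mA; apply: bbMl => //.
by exists 1 => x; rewrite ger0_norm ?ind_ge0 ?ind_le1.
Qed.

Lemma bb_mul f g : bb f -> bb g -> bb (fun x => f x * g x).
Proof.
move=> bf [mg [z [r [M h]]]]; apply: bbM => //.
exists `|M| => x; rewrite (le_trans (h x))//.
rewrite (@le_trans _ _ (`|M| * \1_(ball z r) x))//.
  by rewrite ler_wpM2r ?ind_ge0// ler_norm.
by rewrite -[leRHS]mulr1 ler_wpM2l ?ind_le1.
Qed.

Lemma bbD (a : R) f g : bb f -> bb g -> bb (fun x => a * f x + g x).
Proof.
move=> /[dup] [[mf _]] /bbP[r [M [_ M0 h]]] /[dup] [[mg _]] /bbP[r' [M' [_ M0' h']]].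
split.
  by apply: measurable_funD => //; apply: measurable_funM.
exists point, (Num.max r r'), (`|a| * M + M') => x.
rewrite (le_trans (ler_normD _ _))// mulrDl lerD//.
  rewrite normrM -mulrA ler_wpM2l// (le_trans (h x))// ler_wpM2l ?(ltW M0)//.
  by apply: ind_sub; apply: sub_ball; rewrite mdistxx add0r le_max lexx.
rewrite (le_trans (h' x))// ler_wpM2l ?(ltW M0')//.
by apply: ind_sub; apply: sub_ball; rewrite mdistxx add0r le_max lexx orbT.
Qed.

Lemma bbZ (a : R) f : bb f -> bb (fun x => a * f x).
Proof.
move=> bf; apply: bbMl => //.
by exists `|a|.
Qed.

Lemma bb_ball A z r : measurable A -> A `<=` ball z r -> bb (\1_A : X -> R).
Proof.
move=> mA Ab; split; first exact: measurable_indic.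
by exists z, r, 1 => x; rewrite mul1r ger0_norm ?ind_ge0 ?ind_sub.
Qed.

Lemma ig_kernel K C c delta x s h : std_kernel K C c delta -> 0 < s -> bb h ->
  (forall y, ball x s y -> h y = 0) -> ig mu (fun y => K x y * h y).
Proof.
move=> sk s0 bh h0.
have mK := measurable_kernelr x sk.
apply: ig_le (igZ (C / lam x s) (ig_abs (bb_ig bh))).
  exact: measurable_funM (bb_meas bh).
move=> y; rewrite normrM; have [xy|xy] := pselect (ball x s y).
  by rewrite h0// normr0 !mulr0.
by rewrite ler_wpM2r// (kernel_bound sk).
Qed.

End Kernel.

(** * Functionals on bounded functions with bounded support *)

Section Riesz.
Context (R : realType) (d : measure_display) (X : metricBorelType R d).
Context (mu : {measure set X -> \bar R}) (lam : X -> R -> R).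
Hypothesis mud : upper_doubling mu lam.
Implicit Types (x y z : X) (r s : R) (f g h : X -> R) (A B S : set X).

Lemma sigma_finite_mu : sigma_finite setT mu.
Proof.
exists (fun n => ball (point : X) n%:R).
  apply/seteqP; split => x // _; exists (Num.truncn (mdist point x)).+1 => //.
  by rewrite in_ballE truncnS_gt.
by move=> i; split; [exact: mball|exact: mu_ball_lty mud _ _].
Qed.

(** A copy of [mu] that carries the sigma-finite structure required by the theorems of Radon-Nikodym
    and Fubini. *)
Definition mus_fun (H : sigma_finite setT mu) : set X -> \bar R := mu.
HB.instance Definition _ H := Measure.copy (mus_fun H) mu.
HB.instance Definition _ H :=
  @Measure_isSigmaFinite.Build _ _ _ (mus_fun H) H.
Definition mus : {sigma_finite_measure set X -> \bar R} :=
  mus_fun sigma_finite_mu.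

Section Charge.
Variables (L : (X -> R) -> R) (S : set X) (z0 : X) (r0 : R).
Hypothesis mS : measurable S.
Hypothesis Sb : S `<=` ball z0 r0.
Hypothesis Llin : forall a f g, bb f -> bb g ->
  L (fun x => a * f x + g x) = a * L f + L g.
Hypothesis Lcont : forall z r (h_ : nat -> X -> R),
  (forall n, measurable_fun [set: X] (h_ n)) ->
  (forall n x, `|h_ n x| <= \1_(ball z r) x) ->
  {ae mu, forall x, h_ n x @[n --> \oo] --> (0 : R)} ->
  L (h_ n) @[n --> \oo] --> (0 : R).

Lemma bb0 : bb (fun _ : X => 0 : R).
Proof.
split => //; exists point, 0, 0 => x.
by rewrite normr0 mul0r.
Qed.

Lemma Llin0 : L (fun=> 0) = 0.
Proof.
have := Llin 1 bb0 bb0.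
have -> : (fun _ : X => 1 * 0 + 0 : R) = (fun=> 0) by apply/funext => x; lra.
lra.
Qed.

Lemma LlinD f g : bb f -> bb g -> L (fun x => f x + g x) = L f + L g.
Proof.
move=> bf bg; rewrite -[L f]mul1r -Llin//; congr L.
by apply/funext => x; rewrite mul1r.
Qed.

Definition nuS A : \bar R := (L (\1_(A `&` S)))%:E.

Let bbI A : measurable A -> bb (\1_(A `&` S) : X -> R).
Proof.
move=> mA; apply: (@bb_ball _ _ _ _ z0 r0); first exact: measurableI.
by move=> x [_ /Sb].
Qed.

Let nuS0 : nuS set0 = 0%E.
Proof.
rewrite /nuS set0I -[RHS](congr1 EFin Llin0); congr (L _)%:E.
by apply/funext => x; rewrite indic0.
Qed.

Let nuS_fin A : measurable A -> nuS A \is a fin_num.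
Proof. by []. Qed.

(** Finite additivity is linearity of [L]. The remainders [U n] decrease to the empty set, so their
    indicators tend to 0 pointwise and [Lcont] disposes of them. *)
Let nuS_sigma : semi_sigma_additive nuS.
Proof.
move=> F mF tF mU.
pose U n := \bigcup_i F i `\` \big[setU/set0]_(i < n) F i.
have mUn n : measurable (U n).
  by apply: measurableD => //; apply: bigsetU_measurable => i _; exact: mF.
have UE n : (\1_(U n `&` S) : X -> R) =
    fun x => \1_(F n `&` S) x + \1_(U n.+1 `&` S) x.
  apply/funext => x; have [Sx|Sx] := pselect (S x); last first.
    by rewrite !indF ?addr0// => -[].
  have [Fx|Fx] := pselect (F n x).
    rewrite (@indT _ _ (F n `&` S))// (@indF _ _ (U n.+1 `&` S)) ?addr0.
      rewrite indT//; split => //; split; first by exists n.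
      rewrite -bigcup_mkord => -[k /= kn Fkx].
      have := tF k n Logic.I Logic.I (ex_intro _ x (conj Fkx Fx)).
      by move=> kn'; rewrite kn' ltnn in kn.
    by move=> [[_ h] _]; apply: h; rewrite big_ord_recr /=; right.
  rewrite (@indF _ _ (F n `&` S)) ?add0r; last by case.
  rewrite !indicE; congr (_%:R); congr nat_of_bool; apply/idP/idP;
    rewrite !inE => -[[Ux h] _]; split => //; split => //.
    by rewrite big_ord_recr /= => -[|].
  by move=> h'; apply: h; rewrite big_ord_recr /=; left.
have LE n : L (\1_(\bigcup_i F i `&` S)) =
    \sum_(i < n) L (\1_(F i `&` S)) + L (\1_(U n `&` S)).
  elim: n => [|n ->]; first by rewrite /U !big_ord0 setD0 add0r.
  rewrite big_ord_recr /= -addrA; congr (_ + _).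
  by rewrite [in LHS]UE LlinD//; exact: bbI.
have LU : L (\1_(U n `&` S)) @[n --> \oo] --> (0 : R).
  apply: (@Lcont z0 r0) => //.
  - by move=> n; apply: measurable_indic; exact: measurableI.
  - by move=> n x; rewrite ger0_norm ?ind_ge0// ind_sub// => y [_ /Sb].
  - apply: aeW => x.
    have [[k _ Fkx]|h] := pselect ((\bigcup_i F i) x).
      apply: (@cvg_from _ _ _ k.+1) => n kn; rewrite indF// => -[[_ h] _].
      by apply: h; rewrite -bigcup_mkord; exists k.
    by apply: (@cvg_from _ _ _ 0) => n _; rewrite indF// => -[[]].
have -> : (fun n => \sum_(0 <= i < n) nuS (F i))%E =
    EFin \o (fun n => L (\1_(\bigcup_i F i `&` S)) - L (\1_(U n `&` S))).
  apply/funext => n; rewrite /= (LE n) addrK big_mkord /nuS sumEFin.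
  by [].
apply: cvg_EFin; first by near=> n.
rewrite -[X in _ --> X]subr0 /=.
by apply: cvgB LU; exact: cvg_cst.
Unshelve. all: by end_near.
Qed.

HB.instance Definition _ := isCharge.Build _ _ _ nuS nuS0 nuS_fin nuS_sigma.

(** The constant sequence of indicators of a null set tends to 0 almost everywhere, so [Lcont]
    forces its value under [L] to be 0. *)
Let nuS_ac : nuS `<< mus.
Proof.
move=> N hN A mA AN; have A0 : mu A = 0%E by exact: hN.
have c : L (\1_(A `&` S)) @[n --> \oo] --> (0 : R).
  apply: (@Lcont z0 r0 (fun _ => \1_(A `&` S))) => //.
  - by move=> n; apply: measurable_indic; exact: measurableI.
  - by move=> n x; rewrite ger0_norm ?ind_ge0// ind_sub// => y [_ /Sb].
  - exists A; split => // x /= h; apply: contrapT => Ax; apply: h.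
    by apply: (@cvg_from _ _ _ 0) => n _; rewrite indF// => -[].
by rewrite /nuS; congr _%:E; apply: (cvg_unique _ (cvg_cst _) c).
Qed.

(** The Radon-Nikodym density represents [L] on indicators. Passing to bounded functions may use
    only linearity and [Lcont], whence the study of the defect [D] along binary expansions. *)
Lemma density_on : exists g, ig mu g /\
  forall h, measurable_fun [set: X] h -> (exists M : R, forall x, `|h x| <= M) ->
    L (fun x => \1_S x * h x) = J mu (fun x => g x * h x).
Proof.
have fi := Radon_Nikodym_integrable nuS_ac.
have ffin x := Radon_Nikodym_fin_num x nuS_ac.
pose g x := fine (Radon_Nikodym nuS mus x).
have gi : ig mu g.
  move: fi; rewrite /ig; congr integrable.
  by apply/funext => x; rewrite /g /= fineK.
exists g; split => //.
have mg := ig_meas gi.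
have gA A : measurable A -> L (\1_(A `&` S)) = J mu (fun x => g x * \1_A x).
  move=> mA; apply: EFin_inj; rewrite -[LHS]/(nuS A).
  have -> := Radon_Nikodym_integral nuS_ac mA.
  rewrite integral_mkcond EFin_J.
    apply: eq_integral => x _; rewrite patchE.
    have [Ax|Ax] := pselect (A x); first by rewrite mem_set// indT// mulr1 /g fineK.
    by rewrite memNset// indF// mulr0.
  apply: ig_le (ig_abs gi); first by apply: measurable_funM.
  by move=> x; rewrite normrM -[leRHS]mulr1 ler_wpM2l// ger0_norm ?ind_ge0 ?ind_le1.
have giM h : measurable_fun [set: X] h -> (exists M : R, forall x, `|h x| <= M) ->
    ig mu (fun x => g x * h x).
  move=> mh [M hM]; apply: ig_le (igZ M (ig_abs gi)).
    exact: measurable_funM.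
  by move=> x; rewrite normrM mulrC ler_wpM2r.
have bS h : measurable_fun [set: X] h -> (exists M : R, forall x, `|h x| <= M) ->
    bb (fun x => \1_S x * h x).
  by move=> mh bh; apply: bbM => //; exact: bb_ball Sb.
pose D h := L (fun x => \1_S x * h x) - J mu (fun x => g x * h x).
have Dlin a f1 f2 : measurable_fun [set: X] f1 ->
    (exists M : R, forall x, `|f1 x| <= M) -> measurable_fun [set: X] f2 ->
    (exists M : R, forall x, `|f2 x| <= M) ->
    D (fun x => a * f1 x + f2 x) = a * D f1 + D f2.
  move=> mf1 b1 mf2 b2; rewrite /D.
  have -> : (fun x => \1_S x * (a * f1 x + f2 x)) =
      (fun x => a * (\1_S x * f1 x) + \1_S x * f2 x).
    by apply/funext => x; ring.
  rewrite Llin; [|exact: bS..].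
  have -> : (fun x => g x * (a * f1 x + f2 x)) =
      (fun x => a * (g x * f1 x) + g x * f2 x).
    by apply/funext => x; ring.
  rewrite JD; [|by apply: igZ; exact: giM|exact: giM].
  by rewrite JZ; [ring|exact: giM].
have Dind A : measurable A -> D \1_A = 0.
  move=> mA; rewrite /D -gA//; apply/eqP; rewrite subr_eq0; apply/eqP; congr L.
  by apply/funext => x; rewrite indicI mulrC.
have b1 A : exists M : R, forall x, `|\1_A x| <= M.
  by exists 1 => x; rewrite ger0_norm ?ind_ge0 ?ind_le1.
(* Binary expansion: h is the sum of 2^-k times indicators, plus a remainder
   2^-n r_n with 0 <= r_n <= 1. *)
have D01 h : measurable_fun [set: X] h -> (forall x, 0 <= h x <= 1) -> D h = 0.
  move=> mh h01.
  have bin n : exists2 u : X -> R, measurable_fun [set: X] u /\ (forall x, 0 <= u x <= 1) &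
      D h = D (fun x => 2^-1 ^+ n * u x).
    elim: n => [|n [u [mr r01] ->]].
      by exists h => //; congr D; apply/funext => x; rewrite expr0 mul1r.
    pose E := [set x | 1 <= 2 * u x].
    have mE : measurable E.
      rewrite -[E]setTI; have -> : E = (fun x => 2 * u x) @^-1` `[1, +oo[.
        by apply/seteqP; split => x; rewrite /E /= in_itv/= andbT.
      by apply: measurable_funM => //; exact: measurable_itv.
    pose w' x := 2 * u x - \1_E x.
    have w01 x : 0 <= w' x <= 1.
      rewrite /w'; have [Ex|Ex] := pselect (E x).
        by rewrite indT//; have := r01 x; rewrite /E /= in Ex *; lra.
      rewrite indF//; have := r01 x.
      have : 2 * u x < 1 by rewrite ltNge; apply/negP.
      lra.
    have mw' : measurable_fun [set: X] w'.
      by apply: measurable_funB => //; exact: measurable_funM.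
    exists w' => //.
    have -> : (fun x => 2^-1 ^+ n * u x) =
        (fun x => 2^-1 ^+ n.+1 * \1_E x + 2^-1 ^+ n.+1 * w' x).
      by apply/funext => x; rewrite /w' exprSr; field.
    rewrite Dlin ?Dind ?mulr0 ?add0r//; first exact: measurable_funM.
    exists (2^-1 ^+ n.+1) => x; rewrite normrM ger0_norm ?exprn_ge0//.
    have /andP[? ?] := w01 x.
    by rewrite -[leRHS]mulr1 ler_wpM2l ?exprn_ge0// ger0_norm.
  have /choice[u uP] n : exists u : X -> R, (measurable_fun [set: X] u /\
      (forall x, 0 <= u x <= 1)) /\ D h = D (fun x => 2^-1 ^+ n * u x).
    by have [u ? ?] := bin n; exists u.
  have p0 : (2^-1 : R) ^+ n @[n --> \oo] --> (0 : R).
    by apply: cvg_expr; rewrite ger0_norm ?invr_ge0// invf_lt1// ltr1n.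
  have e01 n : 0 <= (2^-1 : R) ^+ n <= 1.
    by rewrite exprn_ge0 ?invr_ge0// exprn_ile1 ?invr_ge0// invf_le1// ler1n.
  have hc x : 2^-1 ^+ n * u n x @[n --> \oo] --> (0 : R).
    apply: (cvg0_le _ p0) => n.
    have /andP[? ?] := (uP n).1.2 x; have /andP[? ?] := e01 n.
    by rewrite ger0_norm ?mulr_ge0// -[leRHS]mulr1 ler_wpM2l.
  have mr n : measurable_fun [set: X] (fun x => 2^-1 ^+ n * u n x).
    by apply: measurable_funM => //; exact: (uP n).1.1.
  have bu n x : `|2^-1 ^+ n * u n x| <= 1.
    have /andP[? ?] := (uP n).1.2 x; have /andP[? ?] := e01 n.
    by rewrite ger0_norm ?mulr_ge0// mulr_ile1.
  have c1 : L (fun x => \1_S x * (2^-1 ^+ n * u n x)) @[n --> \oo] --> (0 : R).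
    apply: (@Lcont z0 r0).
    - by move=> n; apply: measurable_funM => //; exact: measurable_indic.
    - move=> n x; rewrite normrM ger0_norm ?ind_ge0//.
      rewrite (@le_trans _ _ (\1_S x))//; last exact: ind_sub.
      by rewrite -[leRHS]mulr1 ler_wpM2l ?ind_ge0.
    - apply: aeW => x; rewrite -[X in _ --> X](mulr0 (\1_S x)).
      by apply: cvgMr; exact: hc.
  have [|||||_ _ c2] := @J_dct _ _ _ mu (fun n x => g x * (2^-1 ^+ n * u n x))
    (fun=> 0) (fun x => `|g x|).
  - by move=> n; exact: measurable_funM.
  - exact: measurable_cst.
  - exact: ig_abs.
  - by move=> n; apply: aeW => x; rewrite normrM -[leRHS]mulr1 ler_wpM2l.
  - apply: aeW => x; rewrite -[X in _ --> X](mulr0 (g x)).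
    by apply: cvgMr; exact: hc.
  rewrite J0 in c2.
  have c : D h @[n --> \oo] --> (0 : R).
    have -> : (fun n : nat => D h) = (fun n => L (fun x => \1_S x * (2^-1 ^+ n * u n x)) -
        J mu (fun x => g x * (2^-1 ^+ n * u n x))).
      by apply/funext => n; exact: (uP n).2.
    rewrite -[X in _ --> X](subrr 0).
    by apply: cvgB.
  exact: (cvg_unique _ (cvg_cst _) c).
move=> h mh [M hM].
apply/eqP; rewrite -subr_eq0 -/(D h); apply/eqP.
pose M' := Num.max M 1.
have M'0 : 0 < M' by rewrite lt_max ltr01 orbT.
have hM' x : `|h x| <= M' by rewrite (le_trans (hM x))// le_max lexx.
(* The affine change of variable that brings the values of [h] into [0,1]; the constant it
   introduces is a multiple of an indicator. *)
pose k x := 2^-1 * (M'^-1 * h x + 1).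
have k01 x : 0 <= k x <= 1.
  have : `|M'^-1 * h x| <= 1.
    by rewrite normrM gtr0_norm ?invr_gt0// ler_pdivrMl// mulr1.
  by rewrite ler_norml /k; lra.
have mk : measurable_fun [set: X] k.
  apply: measurable_funM => //; apply: measurable_funD => //.
  exact: measurable_funM.
have -> : h = (fun x => (2 * M') * k x + (- M') * \1_[set: X] x).
  apply/funext => x; rewrite indT// /k; field.
  by rewrite gt_eqF.
have Dc : D (fun x => - M' * \1_[set: X] x) = 0.
  have -> : (fun x => - M' * \1_[set: X] x) =
      (fun x => - M' * \1_[set: X] x + (fun=> 0) x).
    by apply/funext => x; rewrite addr0.
  rewrite (@Dlin _ (\1_[set: X]) (fun=> 0)) ?Dind ?mulr0 ?add0r//.
    by rewrite D01// => x; rewrite lexx ler01.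
  by exists 0 => x; rewrite normr0.
rewrite (@Dlin _ k (fun x => (- M') * \1_[set: X] x)) ?Dc ?D01 ?mulr0 ?add0r//.
- by exists 1 => x; have /andP[? ?] := k01 x; rewrite ger0_norm.
- exact: measurable_funM.
- exists M' => x; rewrite normrM normrN (gtr0_norm M'0) -[leRHS]mulr1.
  by rewrite ler_wpM2l ?(ltW M'0)// ger0_norm ?ind_ge0 ?ind_le1.
Qed.

End Charge.

(** Integrability on every ball, and not only near every point: this is what a pairing with [bb]
    functions requires. *)
Definition loc g := measurable_fun [set: X] g /\
  forall z r, ig mu (fun x => \1_(ball z r) x * g x).

Definition pr g h := J mu (fun x => g x * h x).

Lemma loc_le g h : loc g -> bb h -> ig mu (fun x => g x * h x).
Proof.
move=> [mg lg] [mh [z [r [M h']]]].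
apply: ig_le (igZ M (ig_abs (lg z r))); first exact: measurable_funM.
move=> x; rewrite !normrM mulrC mulrA ler_wpM2r//.
by rewrite [`|\1__ _|]ger0_norm ?ind_ge0.
Qed.

Lemma locD (a : R) f g : loc f -> loc g -> loc (fun x => a * f x + g x).
Proof.
move=> [mf lf] [mg lg]; split.
  by apply: measurable_funD => //; exact: measurable_funM.
move=> z r; apply: eq_ig (igD (igZ a (lf z r)) (lg z r)) => x; ring.
Qed.

Lemma ig_loc g : ig mu g -> loc g.
Proof.
move=> gi; have mg := ig_meas gi; split => // z r.
apply: ig_le (ig_abs gi).
  by apply: measurable_funM => //; apply: measurable_indic; exact: mball.
by move=> x; rewrite normrM ger0_norm ?ind_ge0// ler_piMl ?ind_le1.
Qed.

Lemma prDl (a : R) f g h : loc f -> loc g -> bb h ->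
  pr (fun x => a * f x + g x) h = a * pr f h + pr g h.
Proof.
move=> lf lg bh; rewrite /pr -JZ ?loc_le// -JD; [|exact/igZ/loc_le|exact: loc_le].
by apply: eq_J => x; ring.
Qed.

Lemma prDr (a : R) f h k : loc f -> bb h -> bb k ->
  pr f (fun x => a * h x + k x) = a * pr f h + pr f k.
Proof.
move=> lf bh bk; rewrite /pr -JZ ?loc_le// -JD; [|exact/igZ/loc_le|exact: loc_le].
by apply: eq_J => x; ring.
Qed.

Lemma measurable_sg : measurable_fun [set: R] (@Num.sg R).
Proof.
apply: nondecreasing_measurable => // x y xy.
by case: (sgrP x) xy; case: (sgrP y) => *; lra.
Qed.

Lemma bb_sg g z r : measurable_fun [set: X] g ->
  bb (fun x => \1_(ball z r) x * Num.sg (g x)).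
Proof.
move=> mg; apply: bbM.
- by apply: (@bb_ball _ _ _ _ z r) => //; exact: mball.
- by apply: measurableT_comp => //; exact: measurable_sg.
- by exists 1 => x; case: sgrP; rewrite ?normr0 ?normrN ?normr1.
Qed.

(** Testing [g] against its sign on the ball of radius n gives the integral of [|g|] there. *)
Lemma loc_eq0 g : loc g -> (forall h, bb h -> pr g h = 0) ->
  {ae mu, forall x, g x = 0}.
Proof.
move=> lg g0; have [mg ig_] := lg.
have h n : {ae mu, forall x, \1_(ball (point : X) n%:R) x * `|g x| = 0}.
  apply: J_eq0_ae.
  - apply: eq_ig (ig_abs (ig_ point n%:R)) => x.
    by rewrite normrM ger0_norm ?ind_ge0.
  - by move=> x; rewrite mulr_ge0 ?ind_ge0.
  - rewrite -(g0 _ (bb_sg point n%:R mg)); apply: eq_J => x.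
    by rewrite mulrCA [g x * _]mulrC -normrEsg.
have := ae_foralln h; apply: filterS => x hx.
have := hx (Num.truncn (mdist point x)).+1.
rewrite indT ?mul1r; last by rewrite in_ballE truncnS_gt.
by move/eqP; rewrite normr_eq0 => /eqP.
Qed.

Lemma loc_inj f g : loc f -> loc g -> (forall h, bb h -> pr f h = pr g h) ->
  {ae mu, forall x, f x = g x}.
Proof.
move=> lf lg fg; have := @loc_eq0 _ (locD (-1) lf lg).
move=> /(_ _)/wrap[h bh|].
  by rewrite prDl// fg// mulN1r addNr.
by apply: filterS => x; lra.
Qed.

(** The space is cut into the bounded shells [S n], where [density_on] applies, and the densities
    are glued. A function with bounded support meets finitely many shells, so finite additivity of
    [L] is enough to conclude. *)
Lemma riesz (L : (X -> R) -> R) :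
  (forall a f g, bb f -> bb g -> L (fun x => a * f x + g x) = a * L f + L g) ->
  (forall z r (h_ : nat -> X -> R),
    (forall n, measurable_fun [set: X] (h_ n)) ->
    (forall n x, `|h_ n x| <= \1_(ball z r) x) ->
    {ae mu, forall x, h_ n x @[n --> \oo] --> (0 : R)} ->
    L (h_ n) @[n --> \oo] --> (0 : R)) ->
  exists g, loc g /\ forall h, bb h -> L h = pr g h.
Proof.
move=> Llin Lcont.
pose k x := Num.truncn (mdist (point : X) x).
pose S n := [set x | k x = n].
have Sb n : S n `<=` ball point n.+1%:R.
  by move=> x; rewrite /S /= => <-; rewrite in_ballE truncnS_gt.
have mS n : measurable (S n).
  have -> : S n = ball point n.+1%:R `\` ball point n%:R.
    apply/seteqP; split => x; rewrite /S /=.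
      move=> kx; split; first by apply: Sb.
      by rewrite in_ballE => /lt_geF; rewrite -kx truncn_le ?mdist_ge0.
    rewrite !in_ballE => -[xn /negP]; rewrite -leNgt => nx.
    by apply/eqP; rewrite truncn_eq ?mdist_ge0// nx xn.
  by apply: measurableD; exact: mball.
have [G GP] := choice (fun n => density_on (mS n) (Sb n) Llin Lcont).
have mG n : measurable_fun [set: X] (G n) by exact: ig_meas (GP n).1.
pose g x := G (k x) x.
have mg : measurable_fun [set: X] g.
  move=> mT A mA; rewrite setTI.
  have -> : g @^-1` A = \bigcup_n (S n `&` G n @^-1` A).
    apply/seteqP; split => x; first by exists (k x).
    by move=> [n _ [<-]].
  apply: bigcup_measurable => n _; apply: measurableI => //.
  by rewrite -[_ @^-1` _]setTI; exact: mG.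
have split_ball z r (h : X -> R) : (forall x, ~ ball z r x -> h x = 0) ->
    exists N, forall x, h x = \sum_(n < N) \1_(S n) x * h x.
  move=> h0; pose N := (Num.truncn (mdist point z + r)).+1; exists N => x.
  have [zx|zx] := pselect (ball z r x); last first.
    by rewrite h0// big1// => i _; rewrite mulr0.
  have kN : (k x < N)%N.
    rewrite ltnS /k.
    rewrite in_ballE in zx; have := metric_triangle point z x.
    by move=> tri; apply: le_truncn; lra.
  rewrite (bigD1 (Ordinal kN))//= indT ?mul1r// big1 ?addr0// => i ik.
  rewrite indF ?mul0r// => ki; move/eqP: ik; apply; apply: val_inj => /=.
  by rewrite -ki.
have lg : loc g.
  split => // z r.
  have [N NP] := split_ball z r (fun x => \1_(ball z r) x * g x)
    (fun x zx => eq_trans (congr1 ( *%R^~ (g x)) (indF zx)) (mul0r _)).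
  apply: (@ig_le _ _ _ _ _ (fun x => \sum_(n < N) `|G n x|)).
    by apply: measurable_funM => //; apply: measurable_indic; exact: mball.
  - move=> x; rewrite NP (le_trans (ler_norm_sum _ _ _))//.
    apply: ler_sum => n _; have [nx|nx] := pselect (S n x); last first.
      by rewrite indF ?mul0r ?normr0.
    rewrite indT// mul1r normrM ger0_norm ?ind_ge0//.
    by rewrite /g nx ler_piMl ?ind_le1.
  - by apply: ig_sum => n _; exact/ig_abs/(GP n).1.
exists g; split => // h /[dup] bh [mh [z [r [M hM]]]].
have [|N NP] := split_ball z r h.
  by move=> x zx; have := hM x; rewrite indF// mulr0 normr_le0 => /eqP.
have bSh n : bb (fun x => \1_(S n) x * h x) by exact: bb_ind.
have bSum (I : seq nat) : bb (fun x => \sum_(n <- I) \1_(S n) x * h x).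
  elim: I => [|i I IH].
    have -> : (fun x => \sum_(n <- [::]) \1_(S n) x * h x) = fun=> 0.
      by apply/funext => x; rewrite big_nil.
    exact: bb0.
  have -> : (fun x => \sum_(n <- i :: I) \1_(S n) x * h x) =
      (fun x => 1 * (\1_(S i) x * h x) + \sum_(n <- I) \1_(S n) x * h x).
    by apply/funext => x; rewrite big_cons mul1r.
  exact: bbD.
have hE : h = (fun x => \sum_(n <- iota 0 N) \1_(S n) x * h x).
  apply/funext => x; rewrite {1}NP -(big_mkord xpredT (fun n => \1_(S n) x * h x)).
  by rewrite /index_iota subn0.
rewrite hE; elim: (iota 0 N) => [|i I IH].
  have -> : (fun x => \sum_(n <- [::]) \1_(S n) x * h x) = fun=> 0.
    by apply/funext => x; rewrite big_nil.
  rewrite (Llin0 Llin) /pr -[LHS](@J0 _ _ _ mu).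
  by apply: eq_J => x; rewrite mulr0.
have -> : (fun x => \sum_(n <- i :: I) \1_(S n) x * h x) =
    (fun x => 1 * (\1_(S i) x * h x) + \sum_(n <- I) \1_(S n) x * h x).
  by apply/funext => x; rewrite big_cons mul1r.
rewrite Llin// prDr// -IH; congr (1 * _ + _).
have hb : exists M : R, forall x, `|\1_(S i) x * h x| <= M.
  exists (`|M|) => x; rewrite normrM ger0_norm ?ind_ge0//.
  rewrite (le_trans (ler_piMl _ _)) ?ind_le1// (le_trans (hM x))//.
  rewrite (le_trans (ler_norm _))// normrM.
  by rewrite ler_piMr// ger0_norm ?ind_ge0 ?ind_le1.
have mSh : measurable_fun [set: X] (fun x => \1_(S i) x * h x) by case: (bSh i).
have := (GP i).2 _ mSh hb.
have -> : (fun x => \1_(S i) x * (\1_(S i) x * h x)) = (fun x => \1_(S i) x * h x).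
  by apply/funext => x; rewrite mulrA indM.
move=> ->; rewrite /pr; apply: eq_J => x.
have [ix|ix] := pselect (S i x); last by rewrite indF// mul0r !mulr0.
by rewrite /g ix.
Qed.

End Riesz.

(** * Lebesgue spaces through real integrals, and the Cauchy-Schwarz inequality *)

Section Lebesgue.
Context (R : realType) (d : measure_display) (X : metricBorelType R d).
Context (mu : {measure set X -> \bar R}).
Implicit Types (f g h : X -> R).

Lemma integral_powR p f :
  (\int[mu]_x (`|(EFin \o f) x| `^ p) = \int[mu]_x (`|f x| `^ p)%:E)%E.
Proof. by apply: eq_integral => x _; rewrite -poweR_EFin. Qed.

Lemma measurable_powR_abs p f : measurable_fun [set: X] f ->
  measurable_fun [set: X] (fun x => `|f x| `^ p).
Proof.
move=> mf; apply: (measurableT_comp (measurable_powR p)).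
exact: measurableT_comp.
Qed.

Lemma LpP p f : 0 < p -> Lp mu p%:E f <->
  measurable_fun [set: X] f /\ ig mu (fun x => `|f x| `^ p).
Proof.
move=> p0; have pp : p^-1 != 0 by rewrite gt_eqF ?invr_gt0.
have E : (\int[mu]_x (`| (`|f x| `^ p) |)%:E = \int[mu]_x (`|f x| `^ p)%:E)%E.
  by apply: eq_integral => x _; rewrite ger0_norm ?powR_ge0.
rewrite /Lp /= inE; split.
  move=> /andP[]; rewrite !inE /= => mf; rewrite /finite_norm unlock.
  move=> /(lty_poweRy pp); rewrite integral_powR => fy; split => //.
  by apply/igP; split; [exact: measurable_powR_abs|rewrite E].
move=> [mf /igP[_]]; rewrite E => fy; apply/andP; rewrite !inE; split => //=.
by rewrite /finite_norm unlock integral_powR poweR_lty.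
Qed.

Lemma Lnorm_J p f : ig mu (fun x => `|f x| `^ p) ->
  ('N[mu]_p%:E [EFin \o f] = ((J mu (fun x => `|f x| `^ p)) `^ p^-1)%:E)%E.
Proof. by move=> fi; rewrite unlock integral_powR -EFin_J// poweR_EFin. Qed.

Lemma powR2 (x : R) : `|x| `^ 2 = x ^+ 2.
Proof. by rewrite powR_mulrn// real_normK ?num_real. Qed.

Lemma L2P f : Lp mu 2%:E f <->
  measurable_fun [set: X] f /\ ig mu (fun x => f x ^+ 2).
Proof.
rewrite LpP//.
by have -> : (fun x => `|f x| `^ 2) = (fun x => f x ^+ 2)
  by apply/funext => x; rewrite powR2.
Qed.

Lemma ig_mul2 f g : measurable_fun [set: X] f -> measurable_fun [set: X] g ->
  ig mu (fun x => f x ^+ 2) -> ig mu (fun x => g x ^+ 2) ->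
  ig mu (fun x => f x * g x).
Proof.
move=> mf mg f2 g2; apply: ig_le (igD f2 g2); first exact: measurable_funM.
by move=> x; rewrite normrM -(real_normK (num_real (f x)))
  -(real_normK (num_real (g x))); nra.
Qed.

Lemma ig_add2 (a : R) f g : measurable_fun [set: X] f -> measurable_fun [set: X] g ->
  ig mu (fun x => f x ^+ 2) -> ig mu (fun x => g x ^+ 2) ->
  ig mu (fun x => (a * f x + g x) ^+ 2).
Proof.
move=> mf mg f2 g2.
apply: eq_ig (igD (igZ (a ^+ 2) f2) (igD (igZ (a * 2) (ig_mul2 mf mg f2 g2)) g2)).
by move=> x; ring.
Qed.

Lemma J_CS f g : measurable_fun [set: X] f -> measurable_fun [set: X] g ->
  ig mu (fun x => f x ^+ 2) -> ig mu (fun x => g x ^+ 2) ->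
  (J mu (fun x => f x * g x)) ^+ 2 <=
  J mu (fun x => f x ^+ 2) * J mu (fun x => g x ^+ 2).
Proof.
move=> mf mg f2 g2; have fg := ig_mul2 mf mg f2 g2.
set a := J mu (fun x => f x ^+ 2); set b := J mu (fun x => f x * g x).
set c := J mu (fun x => g x ^+ 2).
have a0 : 0 <= a by apply: J_ge0 => x; exact: sqr_ge0.
have pos t : 0 <= t ^+ 2 * a + (t * 2 * b + c).
  have -> : t ^+ 2 * a + (t * 2 * b + c) = J mu (fun x => (t * f x + g x) ^+ 2).
    transitivity (J mu (fun x =>
        t ^+ 2 * (f x ^+ 2) + (t * 2 * (f x * g x) + g x ^+ 2))).
      have i1 := igZ (t ^+ 2) f2; have i2 := igZ (t * 2) fg.
      by rewrite JD//; [rewrite JD// !JZ|exact: igD].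
    by apply: eq_J => x; ring.
  by apply: J_ge0 => x; exact: sqr_ge0.
(* If [a = 0] the nonnegative polynomial in [t] is affine; for [b != 0] it would take the value -1
   at the point chosen below. Otherwise its minimum, at [- b / a], is the discriminant. *)
have [a1|a1] := eqVneq a 0.
  have [b0|b0] := eqVneq b 0; first by rewrite b0 expr0n mulr_ge0//; apply: J_ge0 => x; exact: sqr_ge0.
  have := pos (- (c + 1) / (2 * b)); rewrite a1 mulr0 add0r.
  have -> : - (c + 1) / (2 * b) * 2 * b + c = - 1 by field.
  by rewrite ler0N1.
have ap : 0 < a by rewrite lt_neqAle eq_sym a1.
have := pos (- b / a).
have -> : (- b / a) ^+ 2 * a + (- b / a * 2 * b + c) = (a * c - b ^+ 2) / a.
  by field.
by rewrite pmulr_lge0 ?invr_gt0// subr_ge0.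
Qed.

Lemma J_CS_cvg0 (F : nat -> X -> R) g : (forall n, measurable_fun [set: X] (F n)) ->
  measurable_fun [set: X] g -> (forall n, ig mu (fun x => F n x ^+ 2)) ->
  ig mu (fun x => g x ^+ 2) ->
  J mu (fun x => F n x ^+ 2) @[n --> \oo] --> (0 : R) ->
  J mu (fun x => F n x * g x) @[n --> \oo] --> (0 : R).
Proof.
move=> mF mg F2 g2 F0.
have c : (fun n => J mu (fun x => F n x ^+ 2) * J mu (fun x => g x ^+ 2)) @ \oo --> (0 : R).
  by rewrite -[X in _ --> X](mul0r (J mu (fun x => g x ^+ 2))); exact: cvgMl.
have s : Num.sqrt (J mu (fun x => F n x ^+ 2) * J mu (fun x => g x ^+ 2))
    @[n --> \oo] --> (0 : R).
  rewrite -[X in _ --> X](@sqrtr0 R).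
  by apply: (cvg_comp _ _ c); exact: sqrt_continuous.
apply: cvg0_le s => n; rewrite -sqrtr_sqr ler_wsqrtr//.
exact: J_CS.
Qed.

End Lebesgue.

(** * Truncation to bounded functions with bounded support *)

Section Truncation.
Context (R : realType) (d : measure_display) (X : metricBorelType R d).
Context (mu : {measure set X -> \bar R}).
Implicit Types (f g h : X -> R).

(** Large values are replaced by 0 rather than by [n], so that the product of [g] with its
    truncation is the square of the truncation ([cut_mul]): this makes [cut n g] a test function
    that computes the L^2 norm. *)
Definition cut (n : nat) g x : R :=
  \1_(ball point n%:R `&` [set x | `|g x| <= n%:R]) x * g x.

Lemma measurable_le_cst g (c : R) : measurable_fun [set: X] g ->
  measurable [set x | `|g x| <= c].
Proof.
move=> mg; rewrite -[[set x | _]]setTI.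
have -> : [set x | `|g x| <= c] = (fun x => `|g x|) @^-1` `]-oo, c].
  by apply/seteqP; split => x; rewrite /= in_itv.
by apply: measurableT_comp => //; exact: measurable_itv.
Qed.

Lemma cut_bb n g : measurable_fun [set: X] g -> bb (cut n g).
Proof.
move=> mg; split.
  apply: measurable_funM => //; apply: measurable_indic; apply: measurableI.
    exact: mball.
  exact: measurable_le_cst.
exists point, n%:R, n%:R => x; rewrite normrM ger0_norm ?ind_ge0//.
have [[a b]|h] := pselect ((ball point n%:R `&` [set x | `|g x| <= n%:R]) x).
  by rewrite indT// mul1r indT// mulr1.
by rewrite indF// mul0r mulr_ge0 ?ind_ge0.
Qed.

Lemma cut_le n g x : `|cut n g x| <= `|g x|.
Proof. by rewrite normrM ger0_norm ?ind_ge0// ler_piMl ?ind_le1. Qed.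

Lemma cut_id g x : exists N, forall n, (N <= n)%N -> cut n g x = g x.
Proof.
exists (maxn (Num.truncn (mdist point x)) (Num.truncn `|g x|)).+1.
move=> n; rewrite gtn_max => /andP[n1 n2]; rewrite /cut indT ?mul1r//; split.
  by rewrite in_ballE (lt_le_trans (truncnS_gt _))// ler_nat.
by rewrite /= (le_trans (ltW (truncnS_gt _)))// ler_nat.
Qed.

Lemma cut_cvg g x : cut n g x @[n --> \oo] --> g x.
Proof. by have [N h] := cut_id g x; exact: cvg_from h. Qed.

Lemma cut_mul n g x : g x * cut n g x = cut n g x ^+ 2.
Proof. by rewrite /cut exprMn [_ ^+ 2]expr2 indM; ring. Qed.

End Truncation.

(** * Calderon-Zygmund operators restricted to bounded functions with bounded support *)

Section Operators.
Context (R : realType) (d : measure_display) (X : metricBorelType R d).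
Context (mu : {measure set X -> \bar R}) (lam : X -> R -> R).
Hypothesis mud : upper_doubling mu lam.
Hypothesis Xd : geometrically_doubling X.
Implicit Types (x y z : X) (r s : R) (f g h : X -> R) (K : X -> X -> R)
  (T : (X -> R) -> X -> R).

(** What the estimates use of the operator. [C0] bounds the squares of L^2 norms, and the
    representation holds at points near which [f] vanishes identically, which avoids the essential
    support. *)
Record CZO T K (C0 C c delta : R) : Prop := MkCZO {
  cz_C0 : 0 < C0 ;
  cz_kernel : std_kernel lam K C c delta ;
  cz_lin : forall a f g, bb f -> bb g ->
    {ae mu, forall x, T (fun x => a * f x + g x) x = a * T f x + T g x} ;
  cz_meas : forall f, bb f -> measurable_fun [set: X] (T f) ;
  cz_ig : forall f, bb f -> ig mu (fun x => T f x ^+ 2) ;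
  cz_L2 : forall f, bb f ->
    J mu (fun x => T f x ^+ 2) <= C0 * J mu (fun x => f x ^+ 2) ;
  cz_rep : forall f, bb f -> {ae mu, forall x,
    (exists2 s, 0 < s & forall y, ball x s y -> f y = 0) ->
    T f x = J mu (fun y => K x y * f y)}
}.

Lemma bb_L2 f : bb f -> ig mu (fun x => f x ^+ 2).
Proof. by move=> bf; apply: (bb_ig mud); exact: bb_mul. Qed.

Lemma L2_loc f : measurable_fun [set: X] f -> ig mu (fun x => f x ^+ 2) -> loc mu f.
Proof.
move=> mf f2; split => // z r; apply: ig_mul2 => //.
  by apply: measurable_indic; exact: mball.
by apply: bb_L2; apply: (@bb_ball _ _ _ _ z r) => //; exact: mball.
Qed.

(** Setting the kernel to 0 on the diagonal, a measurable set by [measurable_offdiag], makes it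
    measurable on the whole product. *)
Lemma CZ_std_kernel K : CZ_kernel mu lam K -> exists K' C c delta,
  std_kernel lam K' C c delta /\ forall x y, x <> y -> K' x y = K x y.
Proof.
move=> [mK _ [C [c [delta [C0 c0 /andP[d0 _] size reg]]]]].
pose O := [set p : X * X | p.1 <> p.2].
pose K' x y := \1_O (x, y) * K x y.
have KE x y : x <> y -> K' x y = K x y by move=> xy; rewrite /K' indT// mul1r.
have mO : measurable O by exact: measurable_offdiag.
have mK' : measurable_fun [set: X * X] (fun p : X * X => K' p.1 p.2).
  have -> : (fun p : X * X => K' p.1 p.2) = (fun p : X * X => K p.1 p.2) \_ O.
    apply/funext => -[x y]; rewrite patchE /K' /=.
    have [Oxy|Oxy] := pselect (O (x, y)); first by rewrite mem_set// indT ?mul1r.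
    by rewrite memNset// indF ?mul0r.
  exact/(measurable_restrictT _ mO).
exists K', C, c, delta; split => //; split => //.
- have := measurableT_comp mK' (@measurable_swap _ _ X X).
  exact.
- move=> x y xy; rewrite KE// (le_trans (size x y xy))// ler_wpM2l ?(ltW C0)//.
  by rewrite ge_min lexx.
- move=> x y xy; have yx : y <> x by move=> e; exact: xy.
  rewrite KE// (le_trans (size y x yx))// ler_wpM2l ?(ltW C0)//.
  by rewrite (metric_sym y x) ge_min lexx orbT.
- move=> x x' y xy xy' h; rewrite !KE//.
  by apply: le_trans (reg x x' y xy xy' h); rewrite lerDl.
- move=> x x' y xy xy' h; rewrite !KE//; [|exact/nesym..].
  by apply: le_trans (reg x x' y xy xy' h); rewrite lerDr.
Qed.

Lemma CZ_operatorP K T : CZ_operator mu lam K T -> Lp_bounded mu 2%:E T ->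
  exists K' C0 C c delta, [/\ CZO T K' C0 C c delta,
    forall a f g, Lp mu 2%:E f -> Lp mu 2%:E g ->
      {ae mu, forall x, T (fun x => a * f x + g x) x = a * T f x + T g x} &
    forall f, Lp mu 2%:E f -> Lp mu 2%:E (T f) /\
      J mu (fun x => T f x ^+ 2) <= C0 * J mu (fun x => f x ^+ 2)].
Proof.
move=> [Kk Tlin Trep] [B Tbd].
have [K' [C [c [delta [sk KE]]]]] := CZ_std_kernel Kk.
(* The sign of [B] is unknown, whence the absolute value; adding 1 makes [C0] positive even if
   [B = 0]. *)
pose C0 := `|B| ^+ 2 + 1.
have C00 : 0 < C0 by rewrite ltr_wpDl ?sqr_ge0.
have lin a f g : Lp mu 2%:E f -> Lp mu 2%:E g ->
    {ae mu, forall x, T (fun x => a * f x + g x) x = a * T f x + T g x}.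
  move=> f2 g2; have := Tlin a f g f2 g2.
  by apply: filterS => x /(_ Logic.I).
have bd f : Lp mu 2%:E f -> Lp mu 2%:E (T f) /\
    J mu (fun x => T f x ^+ 2) <= C0 * J mu (fun x => f x ^+ 2).
  move=> f2; have [Tf2] := Tbd f f2; split => //; move: b.
  have E h : (fun x => h x ^+ 2) = (fun x => `|h x| `^ 2).
    by apply/funext => x; rewrite powR2.
  have /L2P[_ i1] := f2; have /L2P[_ i2] := Tf2.
  rewrite E in i1; rewrite E in i2.
  rewrite !E (Lnorm_J i1) (Lnorm_J i2) -EFinM lee_fin !powR12_sqrt ?J_ge0//;
    try by move=> x; exact: powR_ge0.
  set a := J mu _; set b := J mu _ => h.
  have a0 : 0 <= a by apply: J_ge0 => x; exact: powR_ge0.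
  have b0 : 0 <= b by apply: J_ge0 => x; exact: powR_ge0.
  have h' : Num.sqrt a <= `|B| * Num.sqrt b.
    by rewrite (le_trans h)// ler_wpM2r ?sqrtr_ge0 ?ler_norm.
  rewrite -(sqr_sqrtr a0) -(sqr_sqrtr b0) (@le_trans _ _ ((`|B| * Num.sqrt b) ^+ 2))//.
    by rewrite ler_sqr ?nnegrE ?sqrtr_ge0// mulr_ge0 ?sqrtr_ge0.
  by rewrite exprMn ler_wpM2r ?sqr_ge0// lerDl.
have bbL f : bb f -> Lp mu 2%:E f.
  by move=> bf; apply/L2P; split; [exact: bb_meas|exact: bb_L2].
exists K', C0, C, c, delta; split => //; split => //.
- by move=> a f g bf bg; apply: lin; exact: bbL.
- by move=> f bf; have [/L2P[]] := bd f (bbL f bf).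
- by move=> f bf; have [/L2P[]] := bd f (bbL f bf).
- by move=> f bf; have [] := bd f (bbL f bf).
- move=> f bf; have mf := bb_meas bf.
  have [r [M [r0 M0 fM]]] := bbP bf.
  have fy : Lp mu +oo f.
    rewrite /Lp /= inE; apply/andP; rewrite !inE; split => //=.
    rewrite /finite_norm unlock; case: ifPn => // _.
    apply: le_lt_trans (ltry M); apply/ess_supP; apply: aeW => x /=.
    rewrite lee_fin (le_trans (fM x))// -[leRHS]mulr1.
    by rewrite ler_wpM2l ?(ltW M0)// ind_le1.
  have sf : bounded_support mu f.
    exists (point, r); apply: aeW => x /= h.
    by have := fM x; rewrite indF// mulr0 normr_le0 => /eqP.
  have := Trep f fy sf; apply: filterS => x h [s s0 f0].
  have /h : ~ supp mu f x.
    move=> /(_ s s0); apply; apply: aeW => y /contrapT.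
    exact: f0.
  have -> : (\int[mu]_y (K x y * f y)%:E = \int[mu]_y (K' x y * f y)%:E)%E.
    apply: eq_integral => y _.
    have [xy|/KE ->//] := pselect (x = y).
    (* The two kernels may differ at [y = x], but [f] vanishes there. *)
    by rewrite -xy f0 ?mulr0// in_ballE mdistxx.
  by rewrite /J /Rintegral => <-.
Qed.

End Operators.

(** * The adjoint operator *)

Section Adjoint.
Context (R : realType) (d : measure_display) (X : metricBorelType R d).
Context (mu : {measure set X -> \bar R}) (lam : X -> R -> R).
Hypothesis mud : upper_doubling mu lam.
Hypothesis Xd : geometrically_doubling X.
Implicit Types (x y z : X) (r s : R) (f g h : X -> R).

Let lam_gt0 x r : 0 < r -> 0 < lam x r.
Proof. by case: mud => h _ _ _ _; exact: h. Qed.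

Variables (K : X -> X -> R) (T : (X -> R) -> X -> R) (C0 C c delta : R).
Hypothesis TK : CZO mu lam T K C0 C c delta.

Lemma cz_loc f : bb f -> loc mu (T f).
Proof. by move=> bf; apply: (L2_loc mud); [exact: cz_meas TK _ bf|exact: cz_ig TK _ bf]. Qed.

Lemma ind_dom_bb z r h : measurable_fun [set: X] h ->
  (forall x, `|h x| <= \1_(ball z r) x) -> bb h.
Proof. by move=> mh h1; split => //; exists z, r, 1 => x; rewrite mul1r. Qed.

Lemma dom_L2_cvg0 z r (h_ : nat -> X -> R) :
  (forall n, measurable_fun [set: X] (h_ n)) ->
  (forall n x, `|h_ n x| <= \1_(ball z r) x) ->
  {ae mu, forall x, h_ n x @[n --> \oo] --> (0 : R)} ->
  J mu (fun x => h_ n x ^+ 2) @[n --> \oo] --> (0 : R).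
Proof.
move=> mh h1 h0.
have [|||||_ _ cv] := @J_dct _ _ _ mu (fun n x => h_ n x ^+ 2) (fun=> 0)
    (fun x => \1_(ball z r) x).
- by move=> n; exact: measurable_funX.
- exact: measurable_cst.
- exact: ig_ind_ball mud z r.
- move=> n; apply: aeW => x; rewrite normrX (@le_trans _ _ (\1_(ball z r) x ^+ 2))//.
    by rewrite ler_sqr ?nnegrE ?ind_ge0.
  by rewrite expr2 indM.
- apply: filterS h0 => x h0; rewrite -[X in _ --> X](mulr0 0).
  exact: cvgM.
by rewrite J0 in cv.
Qed.

(** The L^2 bound and dominated convergence give the continuity of the functional that [riesz] asks
    for. *)
Lemma adjoint_fun h : bb h -> exists g, loc mu g /\
  forall f, bb f -> J mu (fun x => T f x * h x) = pr mu g f.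
Proof.
move=> bh; have mh := bb_meas bh; have h2 := bb_L2 mud bh.
have bT f : bb f -> ig mu (fun x => T f x * h x).
  by move=> bf; apply: ig_mul2 => //; [exact: cz_meas TK _ bf|exact: cz_ig TK _ bf].
have [||g [lg gP]] := @riesz _ _ _ _ _ mud (fun f => J mu (fun x => T f x * h x)).
- move=> a f g bf bg.
  rewrite -JZ ?bT// -JD; [|exact/igZ/bT|exact: bT].
  apply: eq_J_ae; first exact/bT/bbD.
    by apply: igD; [exact/igZ/bT|exact: bT].
  by apply: filterS (cz_lin TK a bf bg) => x ->; ring.
- move=> z r h_ mh_ h1 h0.
  have bh_ n : bb (h_ n) by exact: ind_dom_bb (mh_ n) (h1 n).
  apply: J_CS_cvg0 => //.
  + by move=> n; exact: cz_meas TK _ (bh_ n).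
  + by move=> n; exact: cz_ig TK _ (bh_ n).
  apply: (@cvg0_le _ _ (fun n => C0 * J mu (fun x => h_ n x ^+ 2))).
    move=> n; rewrite ger0_norm ?(cz_L2 TK)//.
    by apply: J_ge0 => x; exact: sqr_ge0.
  rewrite -[X in _ --> X](mulr0 C0); apply: cvgMr.
  exact: dom_L2_cvg0 h0.
by exists g.
Qed.

Lemma L2_cut_bound g (M : R) : 0 <= M -> measurable_fun [set: X] g ->
  (forall n, J mu (fun x => cut n g x ^+ 2) <= M) ->
  ig mu (fun x => g x ^+ 2) /\ J mu (fun x => g x ^+ 2) <= M.
Proof.
move=> M0 mg gM.
apply: (@ig_fatou _ _ _ mu (fun n x => cut n g x ^+ 2)) => //.
- by move=> n; apply: (bb_L2 mud); exact: cut_bb.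
- by move=> n x; exact: sqr_ge0.
- exact: measurable_funX.
- by move=> x; apply: cvgM; exact: cut_cvg.
Qed.

Lemma cut_L2_cvg f : measurable_fun [set: X] f -> ig mu (fun x => f x ^+ 2) ->
  J mu (fun x => (cut n f x - f x) ^+ 2) @[n --> \oo] --> (0 : R).
Proof.
move=> mf f2.
have [|||||_ _ cv] := @J_dct _ _ _ mu (fun n x => (cut n f x - f x) ^+ 2) (fun=> 0)
    (fun x => 4 * f x ^+ 2).
- move=> n; apply: measurable_funX; apply: measurable_funB => //.
  exact: bb_meas (cut_bb n mf).
- exact: measurable_cst.
- exact: igZ.
- move=> n; apply: aeW => x; rewrite ger0_norm ?sqr_ge0//.
  have := cut_le n f x; rewrite -(real_normK (num_real (cut n f x - f x))).
  rewrite -(real_normK (num_real (f x))).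
  have := ler_normB (cut n f x) (f x); have := normr_ge0 (cut n f x - f x).
  by nra.
- apply: aeW => x; have cf := @cut_cvg _ _ _ f x.
  rewrite -[X in _ --> X](_ : (f x - f x) * (f x - f x) = 0); last by rewrite subrr mul0r.
  by apply: cvgM; apply: cvgB => //; exact: cvg_cst.
by rewrite J0 in cv.
Qed.

Section AdjointOperator.
Variable T' : (X -> R) -> X -> R.
Hypothesis T'loc : forall h, bb h -> loc mu (T' h).
Hypothesis T'P : forall h f, bb h -> bb f ->
  J mu (fun x => T f x * h x) = pr mu (T' h) f.

(** With [u = cut n (T' h)] the integral [I] of [u ^+ 2] equals that of [T u * h], so I^2 <= C0 I
    |h|^2. Dividing by [I], which is finite because [u] is truncated, gives a bound uniform in
    [n]. *)
Lemma adjoint_L2 h : bb h -> ig mu (fun x => T' h x ^+ 2) /\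
  J mu (fun x => T' h x ^+ 2) <= C0 * J mu (fun x => h x ^+ 2).
Proof.
move=> bh; have mg := (T'loc bh).1.
have C00 := cz_C0 TK.
have H0 : 0 <= J mu (fun x => h x ^+ 2) by apply: J_ge0 => x; exact: sqr_ge0.
apply: L2_cut_bound => //; first by rewrite mulr_ge0// ltW.
move=> n; have bc := cut_bb n mg.
set I := J mu _.
have I0 : 0 <= I by apply: J_ge0 => x; exact: sqr_ge0.
have IE : I = J mu (fun x => T (cut n (T' h)) x * h x).
  by rewrite T'P// /I /pr; apply: eq_J => x; rewrite cut_mul.
have : I ^+ 2 <= (C0 * I) * J mu (fun x => h x ^+ 2).
  rewrite {1}IE (le_trans (J_CS (cz_meas TK bc) (bb_meas bh) (cz_ig TK bc) (bb_L2 mud bh)))//.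
  by rewrite ler_wpM2r// (cz_L2 TK).
have [->|In0] := eqVneq I 0; first by rewrite mulr_ge0// ltW.
have Ip : 0 < I by rewrite lt_neqAle eq_sym In0.
by rewrite expr2 [C0 * I]mulrC -mulrA ler_pM2l.
Qed.

Lemma adjoint_lin a f g : bb f -> bb g ->
  {ae mu, forall x, T' (fun x => a * f x + g x) x = a * T' f x + T' g x}.
Proof.
move=> bf bg; apply: loc_inj => //.
- exact/T'loc/bbD.
- by apply: locD; exact: T'loc.
- move=> h bh; rewrite prDl; [|exact: T'loc..|by []].
  rewrite -!T'P//; last exact: bbD.
  rewrite -/(pr mu (T h) _) prDr//; exact: cz_loc.
Qed.

(** The supports of [f] and [h] are at distance at least [s], hence the kernel is bounded on their
    product and Fubini's theorem applies. *)
Lemma kernel_fubini z s f h : 0 < s -> bb f -> bb h ->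
  (forall y, ball z (2 * s) y -> f y = 0) -> (forall y, ~ ball z s y -> h y = 0) ->
  [/\ ig mu (fun x => f x * J mu (fun y => K x y * h y)),
    ig mu (fun y => h y * J mu (fun x => K x y * f x)) &
    J mu (fun x => f x * J mu (fun y => K x y * h y)) =
    J mu (fun y => h y * J mu (fun x => K x y * f x))].
Proof.
move=> s0 bf bh f0 h0.
have sk := cz_kernel TK; have skT := std_kernel_tr sk.
have [L1 [L1p L1P]] := lam_comp mud 1.
(* The size of [K x y] is measured at [y], a point of the ball of centre [z] and radius [s]; [L1]
   carries the bound over to [z]. *)
pose c1 := C * L1 / lam z s.
pose F (p : X * X) : \bar R := (f p.1 * K p.1 p.2 * h p.2)%:E.
have mF : measurable_fun [set: X * X] F.
  apply/measurable_EFinP; apply: measurable_funM; last first.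
    exact: (measurableT_comp (bb_meas bh)).
  apply: measurable_funM; first exact: (measurableT_comp (bb_meas bf)).
  exact: (sk_meas sk).
have far x y : ball z s y -> ~ ball z (2 * s) x -> ~ ball y s x.
  rewrite !in_ballE => zy zx yx; apply: zx.
  by have := mdist_lt zy yx; rewrite mulr_natl mulr2n.
have Kb x y : ball z s y -> ~ ball z (2 * s) x -> `|K x y| <= c1.
  move=> zy /(far _ _ zy) yx.
  rewrite (le_trans (kernel_bound mud skT s0 yx))// /c1 -mulrA.
  rewrite ler_wpM2l ?(ltW (sk_C sk))//.
  rewrite -[leLHS]mul1r ler_pdivrMr ?lam_gt0// mulrAC ler_pdivlMr ?lam_gt0// mul1r.
  apply: L1P => //; first by rewrite mul1r.
  by rewrite mul1r ltW// -in_ballE.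
have FB x y : `|f x * K x y * h y| <= `|f x| * (c1 * `|h y|).
  rewrite !normrM -mulrA.
  have [zx|zx] := pselect (ball z (2 * s) x); first by rewrite f0// normr0 !mul0r.
  have [zy|zy] := pselect (ball z s y); last by rewrite h0// normr0 !mulr0.
  by rewrite ler_wpM2l// ler_wpM2r// Kb.
have mu' := mus mud.
have igf := bb_ig mud bf; have igh := bb_ig mud bh.
have Fi : (mus mud \x mus mud)%E.-integrable [set: X * X] F.
  apply/integrable12ltyP => //.
  apply: (@le_lt_trans _ _ (\int[mu]_x (`|f x| * (c1 * J mu (fun y => `|h y|)))%:E)%E).
    apply: ge0_le_integral => //.
    - by move=> x _; apply: integral_ge0.
    - apply: (measurable_fun_fubini_tonelli_F (abse \o F)) => //=.
      exact: measurableT_comp.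
    - apply/measurable_EFinP; apply: measurable_funM => //.
      exact: measurableT_comp (bb_meas bf).
    - move=> x _; rewrite EFinM -JZ; last exact: ig_abs.
      rewrite EFin_J; last by apply: igZ; exact: ig_abs.
      rewrite -ge0_integralZl//.
      + apply: ge0_le_integral => //.
        * have := @measurable_fun_pair2 _ _ _ _ _ _ (abse \o F) x
            (measurableT_comp (@abse_measurable R setT) mF).
          exact.
        * apply: measurable_funeM; apply/measurable_EFinP.
          by apply: measurable_funM => //; exact: measurableT_comp (bb_meas bh).
        * by move=> y _; rewrite /F /= -EFinM lee_fin.
      + apply/measurable_EFinP.
        by apply: measurable_funM => //; exact: measurableT_comp (bb_meas bh).
      + move=> y _; rewrite lee_fin mulr_ge0// /c1.
        by rewrite mulr_ge0 ?invr_ge0 ?(ltW (lam_gt0 z s0))// mulr_ge0 ?ltW// (sk_C sk).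
  have := igZ (c1 * J mu (fun y => `|h y|)) (ig_abs igf).
  move/igP => [_]; apply: le_lt_trans.
  apply: ge0_le_integral => //.
  - move=> x _; rewrite lee_fin !mulr_ge0 ?J_ge0//.
      exact: ltW (sk_C sk).
      exact: ltW.
    by rewrite invr_ge0 ltW// lam_gt0.
  - apply/measurable_EFinP; apply: measurable_funM => //.
    exact: measurableT_comp (bb_meas bf).
  - apply/measurable_EFinP; apply: measurableT_comp => //.
    apply: measurable_funM => //.
    exact: measurableT_comp (bb_meas bf).
  - by move=> x _; rewrite lee_fin mulrC ler_norm.
have E1 x : (\int[mu]_y F (x, y) = (f x * J mu (fun y => K x y * h y))%:E)%E.
  have [zx|zx] := pselect (ball z (2 * s) x).
    rewrite f0// mul0r; apply: integral0_eq => y _.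
    by rewrite /F /= f0// !mul0r.
  have ik : ig mu (fun y => K x y * h y).
    apply: (ig_kernel mud sk s0 bh) => y xy; apply: h0 => zy.
    by have := far x y zy zx; rewrite !in_ballE metric_sym; rewrite in_ballE in xy.
  rewrite -JZ// EFin_J; last exact: igZ.
  by apply: eq_integral => y _; rewrite /F /= mulrA.
have E2 y : (\int[mu]_x F (x, y) = (h y * J mu (fun x => K x y * f x))%:E)%E.
  have [zy|zy] := pselect (ball z s y); last first.
    rewrite h0// mul0r; apply: integral0_eq => x _.
    by rewrite /F /= h0// !mulr0.
  have ik : ig mu (fun x => K x y * f x).
    apply: (ig_kernel mud skT s0 bf) => x xy; apply: f0.
    rewrite in_ballE in xy; rewrite in_ballE in zy; rewrite in_ballE.
    by have := mdist_lt zy xy; rewrite mulr_natl mulr2n.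
  rewrite -JZ// EFin_J; last exact: igZ.
  by apply: eq_integral => x _; rewrite /F /=; congr _%:E; ring.
have iF : ig mu (fun x => f x * J mu (fun y => K x y * h y)).
  move: (integrable_fubini_F Fi); rewrite /ig; congr integrable.
  by apply/funext => x; exact: E1.
have iG : ig mu (fun y => h y * J mu (fun x => K x y * f x)).
  apply: ig_le (igZ (c1 * J mu (fun x => `|f x|)) (ig_abs igh)).
    apply/measurable_EFinP; move: (measurable_fubini_G Fi); congr measurable_fun.
    by apply/funext => y; exact: E2.
  move=> y; have [zy|zy] := pselect (ball z s y); last by rewrite h0// mul0r normr0 mulr0.
  have ik : ig mu (fun x => K x y * f x).
    apply: (ig_kernel mud skT s0 bf) => x xy; apply: f0.
    rewrite in_ballE in xy; rewrite in_ballE in zy; rewrite in_ballE.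
    by have := mdist_lt zy xy; rewrite mulr_natl mulr2n.
  rewrite normrM mulrC ler_wpM2r// -JZ; last exact: ig_abs.
  apply: J_norm_le => //; first exact/igZ/ig_abs.
  move=> x; rewrite normrM.
  have [zx|zx] := pselect (ball z (2 * s) x); first by rewrite f0// normr0 !mulr0.
  by rewrite ler_wpM2r// Kb.
split; [exact: iF|exact: iG|].
have := Fubini Fi.
rewrite (eq_integral (fun x => (f x * J mu (fun y => K x y * h y))%:E)); last first.
  by move=> x _; exact: E1.
rewrite [in X in _ = X](eq_integral (fun y => (h y * J mu (fun x => K x y * f x))%:E)).
  by rewrite /J /Rintegral => ->.
by move=> y _; exact: E2.
Qed.

(** Both sides are localized to the ball and tested against an arbitrary [h]. The representation of
    [T] applies to [1_B h], whose support is away from that of [f]. *)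
Lemma adjoint_rep_ball z s f : 0 < s -> bb f ->
  (forall y, ball z (2 * s) y -> f y = 0) ->
  {ae mu, forall y, ball z s y -> T' f y = J mu (fun x => K x y * f x)}.
Proof.
move=> s0 bf f0.
have b1 : bb (\1_(ball z s) : X -> R).
  by apply: (@bb_ball _ _ _ _ z s) => //; exact: mball.
have h0 y : ~ ball z s y -> (\1_(ball z s) y : R) = 0 by move=> h; rewrite indF.
have [_ Gi _] := kernel_fubini s0 bf b1 f0 h0.
have [mT' lT'] := T'loc bf.
have l1 : loc mu (fun y => \1_(ball z s) y * T' f y) by apply: ig_loc; exact: lT'.
have : {ae mu, forall y, \1_(ball z s) y * T' f y =
    \1_(ball z s) y * J mu (fun x => K x y * f x)}.
  apply: loc_inj => //; first exact: ig_loc.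
  move=> h bh.
  have bh' : bb (fun y => \1_(ball z s) y * h y) by exact: bb_mul.
  have h'0 y : ~ ball z s y -> \1_(ball z s) y * h y = 0.
    by move=> zy; rewrite indF// mul0r.
  have [F'i _ E] := kernel_fubini s0 bf bh' f0 h'0.
  transitivity (pr mu (T' f) (fun y => \1_(ball z s) y * h y)).
    by rewrite /pr; apply: eq_J => y; ring.
  rewrite -T'P//.
  have E' : J mu (fun x => T (fun y => \1_(ball z s) y * h y) x * f x) =
      J mu (fun x => f x * J mu (fun y => K x y * (\1_(ball z s) y * h y))).
    have iT : ig mu (fun x => T (fun y => \1_(ball z s) y * h y) x * f x).
      by apply: loc_le bf; exact: cz_loc.
    have aeE : {ae mu, forall x, T (fun y => \1_(ball z s) y * h y) x * f x =
        f x * J mu (fun y => K x y * (\1_(ball z s) y * h y))}.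
      apply: filterS (cz_rep TK bh') => x hx.
      have [zx|zx] := pselect (ball z (2 * s) x); first by rewrite f0// mul0r mulr0.
      rewrite hx; first by rewrite mulrC.
      exists s; first exact: s0.
      move=> y xy; apply: h'0 => zy; apply: zx.
      rewrite in_ballE in xy; rewrite in_ballE in zy; rewrite in_ballE.
      rewrite metric_sym in xy.
      by have := mdist_lt zy xy; rewrite mulr_natl mulr2n.
    exact: eq_J_ae.
  rewrite E' E /pr; apply: eq_J => y; ring.
apply: filterS => y + zy; rewrite indT// !mul1r; exact.
Qed.

(** The exceptional set in [adjoint_rep_ball] depends on the ball, so only balls with centres in a
    countable dense set and radii 1/(m+1) are used. *)
Lemma adjoint_rep f : bb f -> {ae mu, forall x,
  (exists2 s, 0 < s & forall y, ball x s y -> f y = 0) ->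
  T' f x = J mu (fun y => K y x * f y)}.
Proof.
move=> bf; have [D DP] := countable_dense Xd.
have h n m : {ae mu, forall y,
    (forall y, ball (D n) (2 * m.+1%:R^-1) y -> f y = 0) ->
    ball (D n) (m.+1%:R^-1) y -> T' f y = J mu (fun x => K x y * f x)}.
  have [f0|f0] := pselect (forall y, ball (D n) (2 * m.+1%:R^-1) y -> f y = 0).
    have m0 : 0 < m.+1%:R^-1 :> R by rewrite invr_gt0.
    by apply: filterS (adjoint_rep_ball m0 bf f0) => y hy _.
  by apply: aeW => y /f0.
have := ae_foralln (fun n => ae_foralln (h n)); apply: filterS => x hx [s s0 f0].
(* If the centre is at distance less than 1/(m+1) from [x], the ball of radius 2/(m+1) about it lies
   in the ball of radius 3/(m+1) < s about [x]. *)
pose m := Num.truncn (3 / s).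
have m0 : 0 < m.+1%:R^-1 :> R by rewrite invr_gt0.
have ms : 3 * m.+1%:R^-1 < s.
  by rewrite ltr_pdivrMr// -ltr_pdivrMl// mulrC truncnS_gt.
have [n nx] := DP x _ m0.
apply: (hx n m); last by rewrite in_ballE.
move=> y; rewrite in_ballE => ny; apply: f0; rewrite in_ballE.
rewrite metric_sym in nx; have := mdist_lt nx ny.
by move/lt_trans; apply; apply: le_lt_trans ms; rewrite -{1}[_^-1]mul1r -mulrDl.
Qed.

Lemma adjoint_CZO : CZO mu lam T' (fun x y => K y x) C0 C c delta.
Proof.
split.
- exact: cz_C0 TK.
- exact: std_kernel_tr (cz_kernel TK).
- exact: adjoint_lin.
- by move=> f bf; exact: (T'loc bf).1.
- by move=> f bf; exact: (adjoint_L2 bf).1.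
- by move=> f bf; exact: (adjoint_L2 bf).2.
- exact: adjoint_rep.
Qed.

End AdjointOperator.

Lemma adjoint_exists : exists T', CZO mu lam T' (fun x y => K y x) C0 C c delta /\
  forall f h, bb f -> bb h -> J mu (fun x => T f x * h x) = pr mu (T' h) f.
Proof.
have /choice[T' T'P] : forall h, exists g, bb h -> loc mu g /\
    forall f, bb f -> J mu (fun x => T f x * h x) = pr mu g f.
  move=> h; have [/adjoint_fun[g gP]|nb] := pselect (bb h); first by exists g.
  by exists (fun=> 0).
exists T'; split; last by move=> f h bf bh; apply: (T'P h bh).2.
apply: adjoint_CZO; first by move=> h bh; exact: (T'P h bh).1.
by move=> h f bh bf; apply: (T'P h bh).2.
Qed.

(** The duality is known for [cut n f]. Both sides tend to 0 on the difference [cut n f - f], which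
    tends to 0 in L^2. *)
Lemma adjoint_L2_pairing T' f h :
  (forall a f g, Lp mu 2%:E f -> Lp mu 2%:E g ->
    {ae mu, forall x, T (fun x => a * f x + g x) x = a * T f x + T g x}) ->
  (forall f, Lp mu 2%:E f -> Lp mu 2%:E (T f) /\
    J mu (fun x => T f x ^+ 2) <= C0 * J mu (fun x => f x ^+ 2)) ->
  CZO mu lam T' (fun x y => K y x) C0 C c delta ->
  (forall f h, bb f -> bb h -> J mu (fun x => T f x * h x) = pr mu (T' h) f) ->
  Lp mu 2%:E f -> bb h -> J mu (fun x => T f x * h x) = pr mu f (T' h).
Proof.
move=> lin bd TK' T'P L2f bh; have /L2P[mf f2] := L2f.
have mh := bb_meas bh; have h2 := bb_L2 mud bh.
have mT' := cz_meas TK' bh; have T'2 := cz_ig TK' bh.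
have bc n : bb (cut n f) by exact: cut_bb.
have L2c n : Lp mu 2%:E (cut n f).
  apply/L2P; split; first exact: bb_meas (bc n).
  exact: bb_L2 mud _ (bc n).
have cv := cut_L2_cvg mf f2.
have mcf n : measurable_fun [set: X] (fun x => cut n f x - f x).
  by apply: measurable_funB => //; exact: bb_meas (bc n).
have icf n : ig mu (fun x => (cut n f x - f x) ^+ 2).
  have := ig_add2 (-1) mf (bb_meas (bc n)) f2 (bb_L2 mud (bc n)).
  by apply: eq_ig => x; ring.
have L2cf n : Lp mu 2%:E (fun x => cut n f x - f x) by apply/L2P.
have c1 : J mu (fun x => (cut n f x - f x) * T' h x) @[n --> \oo] --> (0 : R).
  exact: J_CS_cvg0.
have c2 : J mu (fun x => T (fun x => cut n f x - f x) x * h x) @[n --> \oo] --> (0 : R).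
  apply: J_CS_cvg0 => //.
  - by move=> n; have [/L2P[]] := bd _ (L2cf n).
  - by move=> n; have [/L2P[]] := bd _ (L2cf n).
  apply: (@cvg0_le _ _ (fun n => C0 * J mu (fun x => (cut n f x - f x) ^+ 2))).
    move=> n; rewrite ger0_norm ?(bd _ (L2cf n)).2//.
    by apply: J_ge0 => x; exact: sqr_ge0.
  by rewrite -[X in _ --> X](mulr0 C0); exact: cvgMr.
have iTf u : Lp mu 2%:E u -> ig mu (fun x => T u x * h x).
  by move=> /bd[/L2P[mTu Tu2] _]; exact: ig_mul2.
have ifT u : Lp mu 2%:E u -> ig mu (fun x => u x * T' h x).
  by move=> /L2P[mu_ u2]; exact: ig_mul2.
have E n : J mu (fun x => T f x * h x) - pr mu f (T' h) =
    J mu (fun x => (cut n f x - f x) * T' h x) -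
    J mu (fun x => T (fun x => cut n f x - f x) x * h x).
  have -> : J mu (fun x => (cut n f x - f x) * T' h x) =
      pr mu (T' h) (cut n f) - pr mu f (T' h).
    have i1 : ig mu (fun x => T' h x * cut n f x).
      by apply: eq_ig (ifT _ (L2c n)) => x; rewrite mulrC.
    rewrite /pr -JB//; last exact: ifT.
    by apply: eq_J => x; ring.
  rewrite -T'P//.
  have -> : J mu (fun x => T (fun x => cut n f x - f x) x * h x) =
      J mu (fun x => T (cut n f) x * h x) - J mu (fun x => T f x * h x).
    rewrite -JB; [|exact/iTf|exact/iTf].
    apply: eq_J_ae; first exact: iTf.
      by apply: igB; exact: iTf.
    have -> : (fun x => cut n f x - f x) = (fun x => -1 * f x + cut n f x).
      by apply/funext => x; ring.
    by apply: filterS (lin (-1) _ _ L2f (L2c n)) => x ->; ring.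
  by ring.
apply/eqP; rewrite -subr_eq0; apply/eqP.
have c3 : (J mu (fun x => T f x * h x) - pr mu f (T' h)) @[n --> \oo] --> (0 : R).
  rewrite (_ : (fun _ : nat => _) = (fun n =>
    J mu (fun x => (cut n f x - f x) * T' h x) -
    J mu (fun x => T (fun x => cut n f x - f x) x * h x))).
    by rewrite -[X in _ --> X](subrr 0); exact: cvgB.
  by apply/funext => n; exact: E.
exact: (cvg_unique _ (cvg_cst _) c3).
Qed.

End Adjoint.

(** * Oscillation of T h *)

Section RBMO.
Context (R : realType) (d : measure_display) (X : metricBorelType R d).
Context (mu : {measure set X -> \bar R}) (lam : X -> R -> R).
Hypothesis mud : upper_doubling mu lam.
Implicit Types (x y z : X) (r s : R) (f g h : X -> R).

Let lam_gt0 x r : 0 < r -> 0 < lam x r.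
Proof. by case: mud => h _ _ _ _; exact: h. Qed.

Let lam_nd x r s : 0 < r -> r <= s -> lam x r <= lam x s.
Proof. by case: mud => _ h _ _ _; exact: h. Qed.

Lemma ball_ratio (M : R) : exists D : R, 0 < D /\ forall z r, 0 < r -> 0 < M ->
  m mu (ball z (M * r)) / lam z r <= D.
Proof.
have [L [L0 LP]] := lam_scale mud M; exists L; split => // z r r0 M0.
rewrite ler_pdivrMr ?lam_gt0// (le_trans (m_ball_lam mud z _)) ?mulr_gt0//.
exact: LP.
Qed.

(** The integrand of [K_coef] extended by 0: for balls of centre [z] and radii [r], [r'], [K_coef]
    is [1 + J mu (kann z r r')]. It depends on the larger ball only through its radius. *)
Definition kann z r r' (y : X) : R :=
  \1_[set y | r <= mdist y z <= r'] y * (lam z (mdist y z))^-1.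

Lemma measurable_annulus z r r' : measurable [set y : X | r <= mdist y z <= r'].
Proof.
rewrite -[[set y | _]]setTI.
have -> : [set y : X | r <= mdist y z <= r'] = mdist z @^-1` `[r, r'].
  by apply/seteqP; split => y; rewrite /= in_itv/= (metric_sym y).
by apply: measurable_mdist => //; exact: measurable_itv.
Qed.

Lemma kann_ge0 z r r' y : 0 < r -> 0 <= kann z r r' y.
Proof.
move=> r0; rewrite /kann.
have [h|h] := pselect ([set y : X | r <= mdist y z <= r'] y); last first.
  by rewrite indF// mul0r.
rewrite indT// mul1r invr_ge0 ltW// lam_gt0// (lt_le_trans r0)//.
by case/andP: h.
Qed.

Lemma measurable_kann z r r' : 0 < r -> measurable_fun [set: X] (kann z r r').
Proof.
move=> r0.
have -> : kann z r r' = fun y => \1_[set y | r <= mdist y z <= r'] y *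
    (lam z (Num.max (mdist z y) r))^-1.
  apply/funext => y; rewrite /kann.
  have [h|h] := pselect ([set y : X | r <= mdist y z <= r'] y); last first.
    by rewrite !indF// !mul0r.
  have /andP[h1 h2] := h.
  by rewrite (metric_sym y z) in h1 *; rewrite (max_idPl h1).
apply: measurable_funM; last exact: (measurable_lam_inv mud).
by apply: measurable_indic; exact: measurable_annulus.
Qed.

Lemma ig_kann z r r' : 0 < r -> ig mu (kann z r r').
Proof.
move=> r0.
apply: ig_le (igZ (lam z r)^-1 (ig_ind_ball mud z (r' + 1))).
  exact: measurable_kann.
move=> y; rewrite ger0_norm ?kann_ge0// /kann.
have [h|h] := pselect ([set y : X | r <= mdist y z <= r'] y); last first.
  by rewrite (indF h) mul0r mulr_ge0 ?ind_ge0// invr_ge0 ltW// lam_gt0.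
have /andP[h1 h2] := h; rewrite (metric_sym y z) in h1 h2 *.
rewrite (indT h) indT ?mul1r ?mulr1.
  by rewrite lef_pV2 ?posrE ?lam_gt0 ?lam_nd// (lt_le_trans r0).
by rewrite in_ballE; lra.
Qed.

Variables (K : X -> X -> R) (T : (X -> R) -> X -> R) (C0 C c delta : R).
Hypothesis TK : CZO mu lam T K C0 C c delta.
Variable a : R.
Hypothesis a1 : 1 < a.

Let sk := cz_kernel TK.

(* The far part of T h, evaluated at the center of the ball. *)
Definition center_value h z r : R :=
  J mu (fun y => K z y * (\1_(~` ball z (a * r)) y * h y)).

Lemma bb_far h z r : bb h -> bb (fun y => \1_(~` ball z r) y * h y).
Proof. by move=> bh; apply: bb_ind => //; apply: measurableC; exact: mball. Qed.

Lemma far0 h z r y : ball z r y -> \1_(~` ball z r) y * h y = 0.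
Proof. by move=> zy; rewrite indF ?mul0r//= => /(_ zy). Qed.

Lemma ig_center_value h z r : 0 < r -> bb h ->
  ig mu (fun y => K z y * (\1_(~` ball z (a * r)) y * h y)).
Proof.
move=> r0 bh; apply: (ig_kernel mud sk (s := a * r)).
- by rewrite mulr_gt0// (lt_trans ltr01).
- exact: bb_far.
- by move=> y; exact: far0.
Qed.

Lemma far_oscillation : exists D : R, 0 < D /\ forall h, bb h ->
  (forall x, `|h x| <= 1) -> forall z r x, 0 < r -> ball z r x ->
  ig mu (fun y => K x y * (\1_(~` ball z (a * r)) y * h y)) /\
  `|J mu (fun y => K x y * (\1_(~` ball z (a * r)) y * h y)) - center_value h z r| <= D.
Proof.
have [D [D0 DP]] := hormander mud sk a1.
exists D; split => // h bh h1 z r x r0 zx.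
have [iH JH] := DP z r x r0 zx.
have ix : ig mu (fun y => K x y * (\1_(~` ball z (a * r)) y * h y)).
  apply: (ig_kernel mud sk (s := a * r - r)).
  - by rewrite subr_gt0 ltr_pMl.
  - exact: bb_far.
  - move=> y xy; apply: far0; rewrite in_ballE in zx; rewrite in_ballE in xy.
    by rewrite in_ballE; have := mdist_lt zx xy; rewrite addrC subrK.
split => //; rewrite /center_value -JB//; last exact: ig_center_value.
apply: le_trans JH; apply: J_norm_le => //.
  by apply: igB => //; exact: ig_center_value.
move=> y; rewrite -mulrBl !normrM mulrC.
by rewrite [`|\1__ _|]ger0_norm ?ind_ge0// mulrAC ler_piMr// mulr_ge0 ?ind_ge0.
Qed.

Lemma near_far h z r : bb h -> 0 < r -> {ae mu, forall x, ball z (a * r) x ->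
  T h x = T (fun y => \1_(ball z (a * r)) y * h y) x +
    J mu (fun y => K x y * (\1_(~` ball z (a * r)) y * h y))}.
Proof.
move=> bh r0.
have bn : bb (fun y => \1_(ball z (a * r)) y * h y).
  by apply: bb_ind => //; exact: mball.
have bf := bb_far z (a * r) bh.
have hE : h = (fun x => 1 * (\1_(ball z (a * r)) x * h x) +
    \1_(~` ball z (a * r)) x * h x).
  by apply/funext => x; rewrite indC; ring.
apply: filterS2 (cz_lin TK 1 bn bf) (cz_rep TK bf) => x h1 h2 zx.
rewrite [in LHS]hE h1 mul1r h2//.
rewrite in_ballE in zx; exists (a * r - mdist z x); first by rewrite subr_gt0.
move=> y xy; apply: far0; rewrite in_ballE; rewrite in_ballE in xy.
by have := metric_triangle z x y; lra.
Qed.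

(** Splitting [h] at the dilated ball: the near part is controlled by the L^2 bound through
    [|u| <= 1 + u ^+ 2], which contributes [1 + C0], and the far part by Hoermander's condition,
    which contributes [H]. *)
Lemma rbmo_mean : exists D : R, 0 < D /\ forall h, bb h ->
  (forall x, `|h x| <= 1) -> forall z r, 0 < r ->
  ig mu (fun x => \1_(ball z r) x * `|T h x - center_value h z r|) /\
  J mu (fun x => \1_(ball z r) x * `|T h x - center_value h z r|) <=
    D * m mu (ball z (a * r)).
Proof.
have [H [H0 HP]] := far_oscillation.
have C00 := cz_C0 TK.
exists (1 + C0 + H); split; first by rewrite !addr_gt0.
move=> h bh h1 z r r0.
have ar : r < a * r by rewrite ltr_pMl.
have bn : bb (fun y => \1_(ball z (a * r)) y * h y).
  by apply: bb_ind => //; exact: mball.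
have ib := ig_ind_ball mud z r.
have iT : ig mu (fun x => \1_(ball z r) x * `|T h x - center_value h z r|).
  have [mT lT] : loc mu (T h).
    by apply: (L2_loc mud); [exact: cz_meas TK _ bh|exact: cz_ig TK _ bh].
  apply: eq_ig (ig_abs (igB (lT z r) (igZ (center_value h z r) ib))) => x.
  by rewrite [_ * \1__ _]mulrC -mulrBr normrM ger0_norm ?ind_ge0.
pose G x := (1 + H) * \1_(ball z r) x + T (fun y => \1_(ball z (a * r)) y * h y) x ^+ 2.
have iG : ig mu G by apply: igD; [exact: igZ|exact: cz_ig TK _ bn].
split => //; apply: (@le_trans _ _ (J mu G)).
  apply: J_le_ae => //.
  apply: filterS (near_far z bh r0) => x hx.
  have [zx|zx] := pselect (ball z r x); last first.
    by rewrite indF// mul0r addr_ge0 ?sqr_ge0// mulr_ge0 ?ind_ge0// addr_ge0// ltW.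
  have zx' : ball z (a * r) x by apply: sub_ball zx; rewrite mdistxx add0r ltW.
  rewrite /G !(indT zx) mul1r mulr1 hx//.
  have [_ ] := HP h bh h1 z r x r0 zx.
  set u := T _ x; set v := J mu _ => hv.
  have tri : `|u + v - center_value h z r| <= `|u| + `|v - center_value h z r|.
    by rewrite -addrA ler_normD.
  have uu : `|u| <= 1 + u ^+ 2.
    by rewrite -(real_normK (num_real u)); have := normr_ge0 u; nra.
  by rewrite (le_trans tri)//; lra.
rewrite /G JD ?JZ//; [|exact: igZ|exact: cz_ig TK _ bn].
rewrite (J_ind_ball mu z r) addrAC [leRHS]mulrDl lerD//.
  rewrite ler_wpM2l ?addr_ge0 ?(ltW H0)//.
  apply: (m_ball_le mud); apply: sub_ball.
  by rewrite mdistxx add0r ltW.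
apply: (le_trans (cz_L2 TK bn)); rewrite ler_wpM2l ?(ltW C00)//.
rewrite -(J_ind_ball mu); apply: J_le => //.
- exact: (bb_L2 mud).
- exact: (ig_ind_ball mud).
- move=> x; rewrite exprMn [\1__ _ ^+ 2]expr2 indM.
  rewrite -[leRHS]mulr1 ler_wpM2l ?ind_ge0//.
  rewrite -(real_normK (num_real (h x))) expr_le1//.
Qed.

(** The centre is first moved from [z'] to [z] by [far_oscillation]. What remains is an integral of
    [K z] over the symmetric difference of the two dilated balls, where the size of the kernel is
    enough. *)
Lemma rbmo_chain : exists D : R, 0 < D /\ forall h, bb h ->
  (forall x, `|h x| <= 1) -> forall z r z' r', 0 < r -> 0 < r' ->
  ball z r `<=` ball z' r' ->
  `|center_value h z r - center_value h z' r'| <= D * (1 + J mu (kann z r r')).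
Proof.
have [H [H0 HP]] := far_oscillation.
have C1 := sk_C sk.
have [L1 [L10 L1P]] := ball_ratio (a + 1).
have [L2 [L20 L2P]] := ball_ratio a.
have a0 : 0 < a by exact: lt_trans a1.
pose D := H + C * L1 + C * L2 + C.
exists D; split; first by rewrite !addr_gt0// mulr_gt0.
move=> h bh h1 z r z' r' r0 r'0 zz'.
have z'z : ball z' r' z by apply: zz'; rewrite in_ballE mdistxx.
have [iI JI] := HP h bh h1 z' r' z r'0 z'z.
set I := J mu _ in JI.
have zz'd : mdist z' z < r' by rewrite -in_ballE.
(* The first two terms cover the points of the large dilated ball outside the small one, at distance
   at most [r'] from [z] or beyond. The third covers the points of the small dilated ball outside
   the large one: inclusion of the balls does not order their dilates. *)
pose G y := C * kann z r r' y + (C / lam z r') * \1_(ball z ((a + 1) * r')) y +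
  (C / lam z r) * \1_(ball z (a * r)) y.
have iG : ig mu G.
  apply: igD; last exact/igZ/(ig_ind_ball mud).
  by apply: igD; [exact/igZ/ig_kann|exact/igZ/(ig_ind_ball mud)].
have JG : J mu G <= C * J mu (kann z r r') + C * L1 + C * L2.
  rewrite /G JD ?JD ?JZ ?(J_ind_ball mu); first last.
  - exact/igZ/(ig_ind_ball mud).
  - by apply: igD; [exact/igZ/ig_kann|exact/igZ/(ig_ind_ball mud)].
  - exact/igZ/(ig_ind_ball mud).
  - exact/igZ/ig_kann.
  - exact: ig_kann.
  - exact: ig_ind_ball mud _ _.
  - exact: ig_ind_ball mud _ _.
  rewrite lerD ?lerD// -mulrA ler_wpM2l ?(ltW C1)// mulrC.
    by apply: L1P => //; rewrite addr_gt0.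
  exact: L2P.
have k0 : 0 <= J mu (kann z r r') by apply: J_ge0 => y; exact: kann_ge0.
suff IG : `|center_value h z r - I| <= J mu G.
  have : `|center_value h z r - center_value h z' r'| <= J mu G + H.
    rewrite -(subrK I (center_value h z r)) -addrA (le_trans (ler_normD _ _))//.
    exact: lerD.
  move/le_trans; apply; apply: (le_trans (lerD JG (lexx H))).
  rewrite /D; have : 0 <= (H + C * L1 + C * L2) * J mu (kann z r r').
    by rewrite mulr_ge0// !addr_ge0// ?mulr_ge0// ltW.
  nra.
rewrite /center_value /I -JB//; last exact: ig_center_value.
apply: J_norm_le => //; first by apply: igB => //; exact: ig_center_value.
move=> y; rewrite -mulrBr -mulrBl !normrM mulrA.
have Gp : [/\ 0 <= C * kann z r r' y,
    0 <= (C / lam z r') * \1_(ball z ((a + 1) * r')) y &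
    0 <= (C / lam z r) * \1_(ball z (a * r)) y].
  by split; rewrite mulr_ge0 ?kann_ge0 ?ind_ge0 ?divr_ge0// ?ltW// lam_gt0.
have [G1 G2 G3] := Gp.
have ar : r < a * r by rewrite ltr_pMl.
have ar' : r' < a * r' by rewrite ltr_pMl.
have G0 : 0 <= G y by rewrite !addr_ge0.
rewrite (@le_trans _ _ (`|K z y| * `|\1_(~` ball z (a * r)) y - \1_(~` ball z' (a * r')) y|))//.
  by rewrite ler_piMr// mulr_ge0.
have -> : \1_(~` ball z (a * r)) y - \1_(~` ball z' (a * r')) y =
    \1_(ball z' (a * r')) y - \1_(ball z (a * r)) y :> R.
  by rewrite !indC; ring.
have lz := lam_gt0 z r0; have lz' := lam_gt0 z r'0.
have [zy|zy] := pselect (ball z (a * r) y); have [zy'|zy'] := pselect (ball z' (a * r') y).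
- by rewrite !indT// subrr normr0 mulr0.
- rewrite (indT zy) (indF zy') sub0r normrN normr1 mulr1.
  have nzy : ~ ball z r y.
    by move=> /zz' h'; apply: zy'; apply: sub_ball h'; rewrite mdistxx add0r ltW.
  rewrite /G (indT zy) mulr1 ler_wpDl ?addr_ge0//.
  exact: (kernel_bound mud sk r0 nzy).
- rewrite (indF zy) (indT zy') subr0 normr1 mulr1.
  have nzy := nball_le zy.
  have zyr : r <= mdist z y by rewrite (le_trans (ltW ar)).
  have zyp : z <> y by apply: (nball_neq r0) => h'; apply: zy; apply: sub_ball h'; rewrite mdistxx add0r ltW.
  have [zyr'|zyr'] := leP (mdist z y) r'.
    rewrite /G -addrA ler_wpDr ?addr_ge0//.
    rewrite /kann indT; last by rewrite /= metric_sym zyr.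
    by rewrite mul1r (metric_sym y z); exact: (sk_size sk zyp).
  have zy2 : ball z ((a + 1) * r') y.
    rewrite in_ballE in zy'; rewrite in_ballE.
    by have := metric_triangle z z' y; rewrite (metric_sym z z'); lra.
  rewrite /G (indT zy2) mulr1 addrAC ler_wpDl ?addr_ge0//.
  apply: (kernel_bound mud sk r'0); rewrite in_ballE.
  by apply/negP; rewrite -leNgt ltW.
- by rewrite !indF// subrr normr0 mulr0.
Qed.

Lemma cz_scale (k : R) h : bb h -> {ae mu, forall x,
  T (fun x => k * h x) x = k * T h x}.
Proof.
move=> bh; have -> : (fun x => k * h x) = (fun x => (k - 1) * h x + h x).
  by apply/funext => x; ring.
by apply: filterS (cz_lin TK (k - 1) bh bh) => x ->; ring.
Qed.

Lemma center_value_lin (k : R) h g z r : 0 < r -> bb h -> bb g ->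
  center_value (fun x => k * h x + g x) z r =
  k * center_value h z r + center_value g z r.
Proof.
move=> r0 bh bg; rewrite /center_value.
have ih := ig_center_value z r0 bh; have ig' := ig_center_value z r0 bg.
rewrite -JZ// -JD//; last exact: igZ.
by apply: eq_J => y; ring.
Qed.

(** The weight on the right is the one whose inverse bounds the size of an atom, so that the
    integral of an atom against the oscillation is at most [D * M]. The bound for [|h| <= M] follows
    from [M = 1] by homogeneity. *)
Lemma osc_bound : exists D : R, 0 < D /\ forall h M, bb h -> 0 < M ->
  (forall x, `|h x| <= M) -> forall z r z' r', 0 < r -> 0 < r' ->
  ball z r `<=` ball z' r' ->
  ig mu (fun x => \1_(ball z r) x * `|T h x - center_value h z' r'|) /\
  J mu (fun x => \1_(ball z r) x * `|T h x - center_value h z' r'|) <=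
    D * M * (m mu (ball z (a * r)) * (1 + J mu (kann z r r'))).
Proof.
have [D1 [D10 D1P]] := rbmo_mean; have [D2 [D20 D2P]] := rbmo_chain.
have unit h : bb h -> (forall x, `|h x| <= 1) -> forall z r z' r', 0 < r -> 0 < r' ->
    ball z r `<=` ball z' r' ->
    ig mu (fun x => \1_(ball z r) x * `|T h x - center_value h z' r'|) /\
    J mu (fun x => \1_(ball z r) x * `|T h x - center_value h z' r'|) <=
      (D1 + D2) * (m mu (ball z (a * r)) * (1 + J mu (kann z r r'))).
  move=> bh h1 z r z' r' r0 r'0 zz'.
  have [i1 J1] := D1P h bh h1 z r r0.
  have J2 := D2P h bh h1 z r z' r' r0 r'0 zz'.
  have ib := ig_ind_ball mud z r.
  have k0 : 0 <= J mu (kann z r r') by apply: J_ge0 => y; exact: kann_ge0.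
  set c1 := center_value h z r in i1 J1 J2.
  set c2 := center_value h z' r' in J2 *.
  have iT : ig mu (fun x => \1_(ball z r) x * `|T h x - c2|).
    have [mT lT] : loc mu (T h).
      by apply: (L2_loc mud); [exact: cz_meas TK _ bh|exact: cz_ig TK _ bh].
    apply: eq_ig (ig_abs (igB (lT z r) (igZ c2 ib))) => x.
    by rewrite [_ * \1__ _]mulrC -mulrBr normrM ger0_norm ?ind_ge0.
  split => //.
  have iG := igD i1 (igZ `|c1 - c2| ib).
  apply: (le_trans (J_le iT iG _)).
    move=> x; rewrite [_ * \1__ _]mulrC -mulrDr ler_wpM2l ?ind_ge0//.
    by rewrite -(subrK c1 (T h x)) -[_ - _ + _ - _]addrA (le_trans (ler_normD _ _))// addrNK.
  rewrite JD ?JZ//; last exact: igZ.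
  rewrite (J_ind_ball mu z r).
  have mm : m mu (ball z r) <= m mu (ball z (a * r)).
    apply: (m_ball_le mud); apply: sub_ball.
    by rewrite mdistxx add0r ler_peMl// ltW.
  have m0 := m_ge0 mu (ball z r); have m0' := m_ge0 mu (ball z (a * r)).
  rewrite mulrDl lerD//.
    rewrite (le_trans J1)// ler_wpM2l ?(ltW D10)// ler_peMr//.
    by rewrite lerDl.
  rewrite (@le_trans _ _ (D2 * (1 + J mu (kann z r r')) * m mu (ball z r)))//.
    by rewrite ler_wpM2r.
  by rewrite mulrAC -mulrA ler_wpM2l ?(ltW D20)// ler_wpM2r// addr_ge0.
exists (D1 + D2); split; first exact: addr_gt0.
move=> h M bh M0 hM z r z' r' r0 r'0 zz'.
pose h' x := M^-1 * h x.
have bh' : bb h' by exact: bbZ.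
have h'1 x : `|h' x| <= 1.
  by rewrite normrM gtr0_norm ?invr_gt0// ler_pdivrMl// mulr1.
have hE : h = fun x => M * h' x.
  by apply/funext => x; rewrite /h' mulVKf// gt_eqF.
have [i1 J1] := unit h' bh' h'1 z r z' r' r0 r'0 zz'.
have cE : center_value h z' r' = M * center_value h' z' r'.
  rewrite {1}hE /center_value -JZ; last exact: ig_center_value.
  by apply: eq_J => y; ring.
have aeE : {ae mu, forall x, \1_(ball z r) x * `|T h x - center_value h z' r'| =
    M * (\1_(ball z r) x * `|T h' x - center_value h' z' r'|)}.
  apply: filterS (cz_scale M bh') => x; rewrite -hE cE => ->.
  by rewrite -mulrBr normrM (gtr0_norm M0); ring.
have iT : ig mu (fun x => \1_(ball z r) x * `|T h x - center_value h z' r'|).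
  have ib := ig_ind_ball mud z r.
  have [mT lT] : loc mu (T h).
    by apply: (L2_loc mud); [exact: cz_meas TK _ bh|exact: cz_ig TK _ bh].
  apply: eq_ig (ig_abs (igB (lT z r) (igZ (center_value h z' r') ib))) => x.
  by rewrite [_ * \1__ _]mulrC -mulrBr normrM ger0_norm ?ind_ge0.
split => //.
rewrite (eq_J_ae iT (igZ M i1) aeE) JZ// [_ * M]mulrC -mulrA ler_wpM2l ?(ltW M0)//.
Qed.

End RBMO.

(** * Boundedness on the atomic Hardy space *)

Section Series.
Context (R : realType).
Implicit Types (u c : nat -> R).

Let cnt : {measure set nat -> \bar R} := @counting _ R.

(** A series is an integral for the counting measure, so [J_dct] also passes to the limit under sums
    over atoms and over blocks. *)
Definition ssum u : R := J cnt u.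
Definition summ u : Prop := ig cnt u.

Lemma measurable_nat u : measurable_fun [set: nat] u.
Proof. by []. Qed.

Lemma summ_nneg c : (forall j, 0 <= c j) ->
  (\sum_(0 <= j <oo) (c j)%:E < +oo)%E ->
  summ c /\ (ssum c)%:E = (\sum_(0 <= j <oo) (c j)%:E)%E.
Proof.
move=> c0 cy.
have E : (\int[cnt]_j (c j)%:E = \sum_(0 <= j <oo) (c j)%:E)%E.
  by rewrite ge0_integral_count// => j; rewrite lee_fin.
have sc : summ c.
  apply/igP; split; first exact: measurable_nat.
  by under eq_integral do rewrite ger0_norm//; rewrite E.
by split => //; rewrite EFin_J.
Qed.

Lemma summ_le u c : (forall j, `|u j| <= c j) -> summ c -> summ u.
Proof. by move=> uc; apply: ig_le => //; exact: measurable_nat. Qed.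

Lemma ssum_norm_le u c : (forall j, `|u j| <= c j) -> summ c -> `|ssum u| <= ssum c.
Proof. by move=> uc sc; apply: J_norm_le => //; exact: summ_le uc sc. Qed.

Lemma ssum_cvg (u : nat -> nat -> R) v c : (forall n j, `|u n j| <= c j) -> summ c ->
  (forall j, u n j @[n --> \oo] --> v j) ->
  ssum (u n) @[n --> \oo] --> ssum v.
Proof.
move=> uc sc uv.
by have [|||||_ _ ] := @J_dct _ _ _ cnt u v c => //;
  [move=> n; exact: aeW|exact: aeW].
Qed.

Lemma ssum_trunc u n : ssum (fun j => \1_[set k : nat | (k < n)%N] j * u j) = \sum_(j < n) u j.
Proof.
have one k : ig cnt (\1_[set k] : nat -> R) /\ J cnt (\1_[set k] : nat -> R) = 1.
  have E : (\int[cnt]_j (\1_[set k] j)%:E = 1)%E.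
    rewrite integral_indic// setIT /cnt/= /counting asboolT; last exact: finite_set1.
    by rewrite fset_set1 finmap.cardfs1.
  have i1 : ig cnt (\1_[set k] : nat -> R).
    apply/igP; split; first exact: measurable_nat.
    under eq_integral do rewrite ger0_norm ?ind_ge0//.
    by rewrite E ltry.
  by split => //; apply: EFin_inj; rewrite EFin_J.
rewrite /ssum (@eq_J _ _ _ _ _ (fun j => \sum_(k < n) u k * \1_[set (k : nat)] j)).
  rewrite J_sum; last by move=> k _; apply: igZ; exact: (one k).1.
  apply: eq_bigr => k _; rewrite JZ ?(one k).2 ?mulr1//.
  exact: (one k).1.
move=> j; have [jn|jn] := ltnP j n.
  rewrite indT//= mul1r (bigD1 (Ordinal jn))//= indT//= mulr1 big1 ?addr0//.
  move=> k kj; rewrite indF ?mulr0//= => jk; move/eqP: kj; apply.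
  by apply: val_inj => /=; rewrite -jk.
rewrite indF ?mul0r; last by rewrite /= ltnNge jn.
rewrite big1// => k _; rewrite indF ?mulr0//= => jk.
by move: jn; rewrite jk leqNgt ltn_ord.
Qed.

Lemma ssum_partial u : summ u -> \sum_(j < n) u j @[n --> \oo] --> ssum u.
Proof.
move=> su.
have -> : (fun n => \sum_(j < n) u j) =
    (fun n => ssum (fun j => \1_[set k : nat | (k < n)%N] j * u j)).
  by apply/funext => n; rewrite ssum_trunc.
apply: (@ssum_cvg _ _ (fun j => `|u j|)).
- by move=> n j; rewrite normrM ger0_norm ?ind_ge0// ler_piMl ?ind_le1.
- exact: ig_abs.
- move=> j; apply: (@cvg_from _ _ _ j.+1) => n jn.
  by rewrite indT ?mul1r.
Qed.

Lemma ssumD (a : R) u v : summ u -> summ v ->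
  ssum (fun j => a * u j + v j) = a * ssum u + ssum v.
Proof. by move=> su sv; rewrite /ssum JD ?JZ//; exact: igZ. Qed.

End Series.

Section Clip.
Context (R : realType).
Implicit Types (N u v : R).

(** Unlike [cut], this truncation is 1-Lipschitz, so that it preserves oscillation bounds. *)
Definition clip N u : R := Num.max (- N) (Num.min N u).

Lemma clip_bound N u : 0 <= N -> `|clip N u| <= N.
Proof.
move=> N0; rewrite ler_norml le_max lexx/= ge_max ge_min lexx/= andbT.
by rewrite (le_trans _ N0)// oppr_le0.
Qed.

Lemma clip_id N u : `|u| <= N -> clip N u = u.
Proof.
by rewrite ler_norml => /andP[h1 h2]; rewrite /clip (min_idPr h2) (max_idPr h1).
Qed.

Lemma clip_lip N u v : `|clip N u - clip N v| <= `|u - v|.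
Proof.
rewrite /clip /Num.max /Num.min.
by case: (ltP N u) => /= ?; case: (ltP N v) => /= ?; case: (ltP (- N) N) => /= ?;
  case: (ltP (- N) u) => /= ?; case: (ltP (- N) v) => /= ?;
  rewrite ler_norml; case: (ger0P (u - v)) => ?; lra.
Qed.

Lemma clip0 N : 0 <= N -> clip N 0 = 0.
Proof. by move=> N0; rewrite clip_id// normr0. Qed.

Lemma clip_le N u : 0 <= N -> `|clip N u| <= `|u|.
Proof. by move=> N0; have := clip_lip N u 0; rewrite clip0// !subr0. Qed.

Lemma measurable_clip N : measurable_fun [set: R] (clip N).
Proof. by apply: measurable_maxr => //; exact: measurable_minr. Qed.

Lemma clip_cvg u : clip n%:R u @[n --> \oo] --> u.
Proof.
apply: (@cvg_from _ _ _ (Num.truncn `|u|).+1) => n hn; apply: clip_id.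
by rewrite (le_trans (ltW (truncnS_gt _)))// ler_nat.
Qed.

End Clip.

(** * Series converging in L^1 and sizes of atoms *)

Section H1Estimates.
Context (R : realType) (d : measure_display) (X : metricBorelType R d).
Context (mu : {measure set X -> \bar R}) (lam : X -> R -> R).
Hypothesis mud : upper_doubling mu lam.
Implicit Types (x y z : X) (r s : R) (f g h : X -> R).

Let lam_gt0 x r : 0 < r -> 0 < lam x r.
Proof. by case: mud => h _ _ _ _; exact: h. Qed.

Lemma sums_in_L1_ig (u : nat -> X -> R) f : (forall j, ig mu (u j)) ->
  measurable_fun [set: X] f -> sums_in_L1 mu u f ->
  ig mu f /\ J mu (fun x => `|f x - \sum_(j < n) u j x|) @[n --> \oo] --> (0 : R).
Proof.
move=> iu mf; rewrite /sums_in_L1 => cv.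
have E n : ('N[mu]_1 [(fun x => (f x - \sum_(j < n) u j x)%:E)] =
    \int[mu]_x (`|f x - \sum_(j < n) u j x|)%:E)%E.
  by rewrite Lnorm1; apply: eq_integral => x _.
have iS n : ig mu (fun x => \sum_(j < n) u j x) by exact: ig_sum.
have mS n : measurable_fun [set: X] (fun x => f x - \sum_(j < n) u j x).
  by apply: measurable_funB => //; exact: ig_meas (iS n).
have fi : ig mu f.
  (* Extended reals tending to 0 are eventually finite; [f] then differs from a finite sum by an
     integrable function. *)
  have [n] : exists n, (\int[mu]_x (`|f x - \sum_(j < n) u j x|)%:E < +oo)%E.
    have /fine_cvgP[[n _ /(_ n (leqnn n)) h] _] := cv; exists n.
    by rewrite -E ltey_eq; apply/orP; left.
  move=> h; have : ig mu (fun x => f x - \sum_(j < n) u j x) by apply/igP.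
  by move=> /igD/(_ (iS n)); apply: eq_ig => x; rewrite subrK.
split => //.
have -> : (fun n => J mu (fun x => `|f x - \sum_(j < n) u j x|)) = (fun n => fine
    ('N[mu]_1 [(fun x => (f x - \sum_(j < n) u j x)%:E)])%E).
  by apply/funext => n; rewrite E.
exact: (fine_cvg cv).
Qed.

Lemma sums_in_L1_pair (u : nat -> X -> R) f (phi : X -> R) N :
  (forall j, ig mu (u j)) -> measurable_fun [set: X] f -> sums_in_L1 mu u f ->
  measurable_fun [set: X] phi -> (forall x, `|phi x| <= N) ->
  summ (fun j => J mu (fun x => u j x * phi x)) ->
  J mu (fun x => f x * phi x) = ssum (fun j => J mu (fun x => u j x * phi x)).
Proof.
move=> iu mf cv mphi phiN su.
have [fi cv0] := sums_in_L1_ig iu mf cv.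
have ip g : ig mu g -> ig mu (fun x => g x * phi x).
  move=> gi; apply: ig_le (igZ N (ig_abs gi)).
    by apply: measurable_funM => //; exact: ig_meas gi.
  by move=> x; rewrite normrM mulrC ler_wpM2r.
have iS n : ig mu (fun x => \sum_(j < n) u j x) by exact: ig_sum.
have c1 : J mu (fun x => f x * phi x) - \sum_(j < n) J mu (fun x => u j x * phi x)
    @[n --> \oo] --> (0 : R).
  apply: (@cvg0_le _ _ (fun n => N * J mu (fun x => `|f x - \sum_(j < n) u j x|))).
    move=> n; rewrite -J_sum; last by move=> j _; exact: ip.
    have iD : ig mu (fun x => f x - \sum_(j < n) u j x) by exact: igB.
    rewrite -JB; [|exact: ip|by apply: ig_sum => j _; exact: ip].
    rewrite -JZ; last exact: ig_abs.
    apply: J_norm_le.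
    - by apply: igB; [exact: ip|apply: ig_sum => j _; exact: ip].
    - exact/igZ/ig_abs.
    - move=> x; rewrite -mulr_suml -mulrBl normrM mulrC ler_wpM2r//.
  by rewrite -[X in _ --> X](mulr0 N); exact: cvgMr.
have c2 := ssum_partial su.
apply: (@cvg_const_eq _ (fun n =>
  J mu (fun x => f x * phi x) - \sum_(j < n) J mu (fun x => u j x * phi x) +
  \sum_(j < n) J mu (fun x => u j x * phi x))); first by move=> n; rewrite subrK.
rewrite -[X in _ --> X]add0r.
exact: (cvgD c1 c2).
Qed.

(* When [mu (rho B_j) = 0] the atom vanishes almost everywhere, although the
   bound on its size is [+oo]. *)
Lemma atom_ae (rho : R) (a : X -> R) (z z' : X) (r r' : R) :
  1 < rho -> 0 < r -> supported_in mu a (ball z r) ->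
  ('N[mu]_+oo [EFin \o a] <=
     (mu (ball z (rho * r)) * K_coef mu lam (z, r) (z', r'))^-1)%E ->
  exists b : R, [/\ 0 <= b, {ae mu, forall x, `|a x| <= b * \1_(ball z r) x} &
    b * (m mu (ball z (rho * r)) * (1 + J mu (kann lam z r r'))) <= 1].
Proof.
move=> rho1 r0 sa0 na.
have sa : {ae mu, forall x, ~ ball z r x -> a x = 0} := sa0.
have Bsub : ball z r `<=` ball z (rho * r).
  by apply: sub_ball; rewrite mdistxx add0r ler_peMl// ltW.
set M := m mu (ball z (rho * r)).
have muM : mu (ball z (rho * r)) = M%:E.
  by rewrite -(EFin_m mud (mball _ _) (@subset_refl _ (ball z (rho * r)))).
set q := 1 + J mu (kann lam z r r').
have q1 : 1 <= q by rewrite lerDl; apply: J_ge0 => y; exact: (kann_ge0 mud).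
have q0 : 0 < q by exact: lt_le_trans q1.
have Kq : K_coef mu lam (z, r) (z', r') = q%:E.
  rewrite /K_coef /= EFinD EFin_J; last exact: (ig_kann mud).
  congr (_ + _)%E; rewrite [LHS]integral_mkcond.
  apply: eq_integral => y _.
  rewrite patchE /kann.
  have [h|h] := pselect ([set y : X | r <= mdist y z <= r'] y).
    by rewrite mem_set// indT// mul1r.
  by rewrite memNset// indF// mul0r.
have M0 : 0 <= M := m_ge0 mu _.
have [Mz|Mn] := eqVneq M 0.
  exists 0; split => //; last by rewrite mul0r ler01.
  have nb : {ae mu, forall x, ~ ball z r x}.
    exists (ball z (rho * r)); split; [exact: mball|by rewrite muM Mz|].
    by move=> x /= /contrapT; exact: Bsub.
  by apply: filterS2 sa nb => x h1 h2; rewrite h1 ?normr0 ?mul0r.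
have Mp : 0 < M by rewrite lt_neqAle eq_sym Mn.
exists (M * q)^-1; split.
- by rewrite invr_ge0 mulr_ge0// ltW.
- have mT : (0 < mu [set: X])%E.
    have : (0 < mu (ball z (rho * r)))%E by rewrite muM lte_fin.
    move=> /lt_le_trans; apply; apply: le_measure => //; rewrite ?inE//.
    exact: mball.
  move: na; rewrite unlock mT muM Kq -EFinM inver.
  rewrite mulf_eq0 (gt_eqF Mp) (gt_eqF q0) /= => /ess_supP h.
  apply: filterS2 h sa => x; rewrite /= lee_fin => h1 h2.
  have [zx|zx] := pselect (ball z r x); first by rewrite indT// mulr1.
  by rewrite h2// normr0 indF// mulr0.
- by rewrite mulVf// mulf_neq0// gt_eqF.
Qed.

Lemma atom_bound (a : X -> R) (z : X) (r b k Q : R) (G : X -> R) :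
  measurable_fun [set: X] a -> 0 <= b ->
  {ae mu, forall x, `|a x| <= b * \1_(ball z r) x} -> b * Q <= 1 -> 0 <= k ->
  measurable_fun [set: X] G -> (forall x, 0 <= G x) ->
  ig mu (fun x => \1_(ball z r) x * G x) ->
  J mu (fun x => \1_(ball z r) x * G x) <= k * Q ->
  ig mu (fun x => `|a x| * G x) /\ J mu (fun x => `|a x| * G x) <= k.
Proof.
move=> ma b0 ab bQ k0 mG G0 iG JG.
have aG : {ae mu, forall x, `|a x| * G x <= b * (\1_(ball z r) x * G x)}.
  by apply: filterS ab => x h; rewrite mulrA ler_wpM2r.
have iaG : ig mu (fun x => `|a x| * G x).
  apply: ig_le_ae (igZ b iG) => //.
    by apply: measurable_funM => //; exact: measurableT_comp.
  by apply: filterS aG => x; rewrite normrM normr_id (ger0_norm (G0 x)).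
split => //; rewrite (le_trans (J_le_ae iaG (igZ b iG) aG))// JZ//.
rewrite (le_trans (ler_wpM2l b0 JG))// mulrCA -[leRHS]mulr1 ler_wpM2l//.
Qed.

End H1Estimates.

(** * The pairing of an atomic block with T h *)

Section BlockLimit.
Context (R : realType) (d : measure_display) (X : metricBorelType R d).
Context (mu : {measure set X -> \bar R}) (lam : X -> R -> R).
Hypothesis mud : upper_doubling mu lam.
Implicit Types (x y z : X) (r s : R) (f g h : X -> R).
Variables (K : X -> X -> R) (T : (X -> R) -> X -> R) (C0 C c delta : R).
Hypothesis TK : CZO mu lam T K C0 C c delta.
Variable rho : R.
Hypothesis rho1 : 1 < rho.

Local Notation cv h B := (center_value mu K rho h B.1 B.2).

Variable D : R.
Hypothesis D0 : 0 < D.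
Hypothesis DP : forall h M, bb h -> 0 < M ->
  (forall x, `|h x| <= M) -> forall z r z' r', 0 < r -> 0 < r' ->
  ball z r `<=` ball z' r' ->
  ig mu (fun x => \1_(ball z r) x * `|T h x - center_value mu K rho h z' r'|) /\
  J mu (fun x => \1_(ball z r) x * `|T h x - center_value mu K rho h z' r'|) <=
    D * M * (m mu (ball z (rho * r)) * (1 + J mu (kann lam z r r'))).

Section OneBlock.
Variables (b : X -> R) (B : X * R) (l : nat -> R) (a : nat -> X -> R)
  (Bj : nat -> X * R).
Hypothesis AB : atomic_block mu lam rho b B l a Bj.
Hypothesis sl : summ (fun j => `|l j|).

Lemma block_atom j : exists2 q : R, 0 <= q &
  {ae mu, forall x, `|a j x| <= q * \1_(ball (Bj j).1 (Bj j).2) x} /\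
  q * (m mu (ball (Bj j).1 (rho * (Bj j).2)) *
    (1 + J mu (kann lam (Bj j).1 (Bj j).2 B.2))) <= 1.
Proof.
have := atom_size AB j; have := atom_support AB j; have := atom_radius AB j.
case: (Bj j) => z r; case: B => z' r' /= r0 sa na.
by have [q [? ? ?]] := atom_ae mud rho1 r0 sa na; exists q.
Qed.

Lemma atom_ig j : ig mu (a j).
Proof.
have [q q0 [aq _]] := block_atom j.
apply: ig_le_ae (igZ q (ig_ind_ball mud (Bj j).1 (Bj j).2)) => //.
exact: atom_measurable AB j.
Qed.

Lemma atom_L2 j : ig mu (fun x => a j x ^+ 2).
Proof.
have [q q0 [aq _]] := block_atom j.
apply: ig_le_ae (igZ (q ^+ 2) (ig_ind_ball mud (Bj j).1 (Bj j).2)) => //.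
  exact: measurable_funX (atom_measurable AB j).
apply: filterS aq => x h; rewrite normrX -(indM R (ball (Bj j).1 (Bj j).2)) -expr2 -exprMn.
by rewrite ler_sqr ?nnegrE// mulr_ge0 ?ind_ge0.
Qed.

Lemma atom_pair j h M : bb h -> 0 < M -> (forall x, `|h x| <= M) ->
  ig mu (fun x => `|a j x| * `|T h x - cv h B|) /\
  J mu (fun x => `|a j x| * `|T h x - cv h B|) <= D * M.
Proof.
move=> bh M0 hM; have [q q0 [aq qQ]] := block_atom j.
have [i1 J1] := DP bh M0 hM (atom_radius AB j) (block_radius AB) (atom_ball AB (j := j)).
apply: (atom_bound (atom_measurable AB j) q0 aq qQ) => //.
- by rewrite mulr_ge0// ltW.
- apply: measurableT_comp => //; apply: measurable_funB => //.
  exact: cz_meas TK _ bh.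
Qed.

Lemma atom_pair_ig j h : bb h -> ig mu (fun x => a j x * (T h x - cv h B)).
Proof.
move=> bh; have [r [M [_ M0 hM]]] := bbP bh.
have hM' x : `|h x| <= M.
  by rewrite (le_trans (hM x))// -[leRHS]mulr1 ler_wpM2l ?(ltW M0) ?ind_le1.
have [i1 _] := atom_pair j bh M0 hM'.
apply: ig_le i1; last by move=> x; rewrite normrM.
apply: measurable_funM; first exact: atom_measurable AB j.
by apply: measurable_funB => //; exact: cz_meas TK _ bh.
Qed.

(** The pairing of the block with [T h], expanded in atoms; subtracting the constant is licit
    because the block has mean 0. By [block_clip_cvg] the value depends on the function [b]
    alone. *)
Definition beta h := ssum (fun j => l j * J mu (fun x => a j x * (T h x - cv h B))).

Lemma beta_term j h M : bb h -> 0 < M -> (forall x, `|h x| <= M) ->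
  `|l j * J mu (fun x => a j x * (T h x - cv h B))| <= D * M * `|l j|.
Proof.
move=> bh M0 hM; have [i1 J1] := atom_pair j bh M0 hM.
rewrite normrM mulrC ler_wpM2r// (le_trans _ J1)//.
apply: J_norm_le => //; first exact: atom_pair_ig.
by move=> x; rewrite normrM.
Qed.

Lemma beta_le h M : bb h -> 0 < M -> (forall x, `|h x| <= M) ->
  `|beta h| <= D * M * ssum (fun j => `|l j|).
Proof.
move=> bh M0 hM.
rewrite /ssum -JZ//; apply: ssum_norm_le; last exact: igZ.
by move=> j; exact: beta_term.
Qed.

(** Both [T h] and the constant are clipped, so the Lipschitz property gives a bound that does not
    depend on [N]. *)
Lemma clip_term j N h M : 0 <= N -> bb h -> 0 < M -> (forall x, `|h x| <= M) ->
  ig mu (fun x => a j x * (clip N (T h x) - clip N (cv h B))) /\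
  `|l j * J mu (fun x => a j x * (clip N (T h x) - clip N (cv h B)))| <=
    D * M * `|l j|.
Proof.
move=> N0 bh M0 hM; have [i1 J1] := atom_pair j bh M0 hM.
have le x : `|a j x * (clip N (T h x) - clip N (cv h B))| <=
    `|a j x| * `|T h x - cv h B|.
  by rewrite normrM ler_wpM2l// clip_lip.
have i2 : ig mu (fun x => a j x * (clip N (T h x) - clip N (cv h B))).
  apply: ig_le i1 => //.
  apply: measurable_funM; first exact: atom_measurable AB j.
  apply: measurable_funB => //; apply: measurableT_comp => //.
    exact: measurable_clip.
  exact: cz_meas TK _ bh.
split => //; rewrite normrM mulrC ler_wpM2r// (le_trans _ J1)//.
exact: J_norm_le.
Qed.

Lemma block_ig : ig mu b.
Proof.
apply: (sums_in_L1_ig _ (block_L1_loc AB).1 (block_sum AB)).1 => j.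
by apply: igZ; exact: atom_ig.
Qed.

(** The clipped function is bounded, hence a series converging in L^1 may be paired with it term by
    term; the constant comes in for free by [block_mean0]. *)
Lemma block_clip N h M : 0 <= N -> bb h -> 0 < M -> (forall x, `|h x| <= M) ->
  J mu (fun x => b x * clip N (T h x)) =
  ssum (fun j => l j * J mu (fun x => a j x * (clip N (T h x) - clip N (cv h B)))).
Proof.
move=> N0 bh M0 hM; have ib := block_ig.
pose phi x := clip N (T h x) - clip N (cv h B).
have mT := cz_meas TK bh.
have mphi : measurable_fun [set: X] phi.
  apply: measurable_funB => //; apply: measurableT_comp => //.
  exact: measurable_clip.
have phiN x : `|phi x| <= N + N.
  by rewrite (le_trans (ler_normB _ _))// lerD// clip_bound.
have E j : J mu (fun x => l j * a j x * phi x) = l j * J mu (fun x => a j x * phi x).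
  rewrite -JZ; last exact: (clip_term j N0 bh M0 hM).1.
  by apply: eq_J => x; rewrite mulrA.
have -> : J mu (fun x => b x * clip N (T h x)) = J mu (fun x => b x * phi x).
  have i1 : ig mu (fun x => b x * clip N (T h x)).
    apply: ig_le (igZ N (ig_abs ib)).
      apply: measurable_funM; first exact: ig_meas ib.
      by apply: measurableT_comp => //; exact: measurable_clip.
    by move=> x; rewrite normrM mulrC ler_wpM2r// clip_bound.
  have b0 : J mu b = 0 by rewrite /J /Rintegral (block_mean0 AB).
  rewrite -[LHS]subr0 -(mulr0 (clip N (cv h B))) -b0 -JZ// -JB//; last exact: igZ.
  by apply: eq_J => x; rewrite /phi; ring.
rewrite (sums_in_L1_pair (u := fun j x => l j * a j x) (N := N + N)) //.
- by rewrite /ssum; apply: eq_J => j; exact: E.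
- by move=> j; apply: igZ; exact: atom_ig.
- exact: (block_L1_loc AB).1.
- exact: block_sum AB.
- apply: (summ_le (c := fun j => D * M * `|l j|)); last exact: igZ.
  by move=> j; rewrite E; exact: (clip_term j N0 bh M0 hM).2.
Qed.

Lemma block_clip_le N h M : 0 <= N -> bb h -> 0 < M -> (forall x, `|h x| <= M) ->
  `|J mu (fun x => b x * clip N (T h x))| <= D * M * ssum (fun j => `|l j|).
Proof.
move=> N0 bh M0 hM; rewrite (block_clip N0 bh M0 hM).
rewrite /ssum -JZ//; apply: ssum_norm_le; last exact: igZ.
by move=> j; exact: (clip_term j N0 bh M0 hM).2.
Qed.

(** Dominated convergence twice: over the atoms, with the bounds of [clip_term], and for each atom
    in [x], with the unclipped oscillation. *)
Lemma block_clip_cvg h : bb h ->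
  J mu (fun x => b x * clip n%:R (T h x)) @[n --> \oo] --> beta h.
Proof.
move=> bh; have [r [M [_ M0 hM]]] := bbP bh.
have hM' x : `|h x| <= M.
  by rewrite (le_trans (hM x))// -[leRHS]mulr1 ler_wpM2l ?(ltW M0) ?ind_le1.
rewrite (_ : (fun n => _) = (fun n => ssum (fun j => l j *
    J mu (fun x => a j x * (clip n%:R (T h x) - clip n%:R (cv h B))))));
  last by apply/funext => n; exact: block_clip bh M0 hM'.
apply: (@ssum_cvg _ _ _ (fun j => D * M * `|l j|)).
- by move=> n j; exact: (clip_term j (ler0n _ n) bh M0 hM').2.
- exact: igZ.
- move=> j; apply: cvgMr.
  have [i1 _] := atom_pair j bh M0 hM'.
  have ma := atom_measurable AB j; have mT := cz_meas TK bh.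
  have [|||||_ _ cvj] := @J_dct _ _ _ mu
    (fun n x => a j x * (clip n%:R (T h x) - clip n%:R (cv h B)))
    (fun x => a j x * (T h x - cv h B)) (fun x => `|a j x| * `|T h x - cv h B|).
  + move=> n; exact: ig_meas (clip_term j (ler0n _ n) bh M0 hM').1.
  + exact: ig_meas (atom_pair_ig j bh).
  + exact: i1.
  + by move=> n; apply: aeW => x; rewrite normrM ler_wpM2l// clip_lip.
  + by apply: aeW => x; apply: cvgMr; apply: cvgB; exact: clip_cvg.
  exact: cvj.
Qed.

Lemma beta_lin (k : R) h g : bb h -> bb g ->
  beta (fun x => k * h x + g x) = k * beta h + beta g.
Proof.
move=> bh bg.
have su u : bb u -> summ (fun j => l j * J mu (fun x => a j x * (T u x - cv u B))).
  move=> bu; have [r [M [_ M0 hM]]] := bbP bu.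
  have hM' x : `|u x| <= M.
    by rewrite (le_trans (hM x))// -[leRHS]mulr1 ler_wpM2l ?(ltW M0) ?ind_le1.
  apply: (summ_le (c := fun j => D * M * `|l j|)); last exact: igZ.
  by move=> j; exact: beta_term.
rewrite /beta -ssumD; [|exact: su|exact: su].
rewrite /ssum; apply: eq_J => j.
have ih := atom_pair_ig j bh; have ig' := atom_pair_ig j bg.
have E : J mu (fun x => a j x * (T (fun x => k * h x + g x) x -
      cv (fun x => k * h x + g x) B)) =
    k * J mu (fun x => a j x * (T h x - cv h B)) +
    J mu (fun x => a j x * (T g x - cv g B)).
  rewrite -JZ// -JD//; last exact: igZ.
  apply: eq_J_ae.
  - by apply: atom_pair_ig; exact: bbD.
  - by apply: igD => //; exact: igZ.
  - apply: filterS (cz_lin TK k bh bg) => x ->.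
    rewrite (center_value_lin mud TK rho1) //; last exact: block_radius AB.
    by ring.
by rewrite E; move: (J mu _) (J mu _) => v w; ring.
Qed.

(** Each atom is square integrable, so its pairing with [T (h_ n)] tends to 0 by the L^2 bound, and
    the centre values tend to 0 by dominated convergence. The sum over the atoms is dominated by
    [D * |l j|]. *)
Lemma beta_cont z r (h_ : nat -> X -> R) :
  (forall n, measurable_fun [set: X] (h_ n)) ->
  (forall n x, `|h_ n x| <= \1_(ball z r) x) ->
  {ae mu, forall x, h_ n x @[n --> \oo] --> (0 : R)} ->
  beta (h_ n) @[n --> \oo] --> (0 : R).
Proof.
move=> mh h1 h0.
have bh n : bb (h_ n) by exact: ind_dom_bb (mh n) (h1 n).
have hM n x : `|h_ n x| <= 1 by rewrite (le_trans (h1 n x))// ind_le1.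
have cv0 : cv (h_ n) B @[n --> \oo] --> (0 : R).
  have r0 := block_radius AB.
  pose one : X -> R := \1_(ball z r).
  have bone : bb one by apply: (@bb_ball _ _ _ _ z r) => //; exact: mball.
  have iK := ig_center_value mud TK rho1 B.1 r0 bone.
  have [|||||_ _ cvj] := @J_dct _ _ _ mu
    (fun n y => K B.1 y * (\1_(~` ball B.1 (rho * B.2)) y * h_ n y)) (fun=> 0)
    (fun y => `|K B.1 y * (\1_(~` ball B.1 (rho * B.2)) y * one y)|).
  - by move=> n; exact: ig_meas (ig_center_value mud TK rho1 B.1 r0 (bh n)).
  - exact: measurable_cst.
  - exact: ig_abs.
  - move=> n; apply: aeW => y; rewrite !normrM ler_wpM2l// ler_wpM2l//.
    by rewrite [leRHS]ger0_norm ?ind_ge0.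
  - apply: filterS h0 => y h0.
    rewrite -[X in _ --> X](mulr0 (K B.1 y)); apply: cvgMr.
    by rewrite -[X in _ --> X](mulr0 (\1_(~` ball B.1 (rho * B.2)) y)); exact: cvgMr.
  by rewrite J0 in cvj.
have L2 := dom_L2_cvg0 mud mh h1 h0.
have TL2 : J mu (fun x => T (h_ n) x ^+ 2) @[n --> \oo] --> (0 : R).
  apply: (@cvg0_le _ _ (fun n => C0 * J mu (fun x => h_ n x ^+ 2))).
    move=> n; rewrite ger0_norm ?(cz_L2 TK)//.
    by apply: J_ge0 => x; exact: sqr_ge0.
  by rewrite -[X in _ --> X](mulr0 C0); exact: cvgMr.
have s0 : ssum (fun _ : nat => 0 : R) = 0 by exact: J0.
rewrite -[X in _ --> X]s0.
apply: (@ssum_cvg _ _ _ (fun j => D * 1 * `|l j|)).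
- by move=> n j; exact: beta_term.
- exact: igZ.
- move=> j; rewrite -[X in _ --> X](mulr0 (l j)); apply: cvgMr.
  have ma := atom_measurable AB j; have a2 := atom_L2 j; have ai := atom_ig j.
  have iTa n : ig mu (fun x => T (h_ n) x * a j x).
    by apply: ig_mul2 => //; [exact: cz_meas TK _ (bh n)|exact: cz_ig TK _ (bh n)].
  have E n : J mu (fun x => a j x * (T (h_ n) x - cv (h_ n) B)) =
      J mu (fun x => T (h_ n) x * a j x) - cv (h_ n) B * J mu (a j).
    rewrite -JZ// -JB//; last exact: igZ.
    by apply: eq_J => x; ring.
  rewrite (_ : (fun n => J mu _) = (fun n => J mu (fun x => T (h_ n) x * a j x) -
    cv (h_ n) B * J mu (a j))); last by apply/funext => n; exact: E.
  rewrite -[X in _ --> X](subr0 0); apply: cvgB.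
    apply: J_CS_cvg0 => //.
    + by move=> n; exact: cz_meas TK _ (bh n).
    + by move=> n; exact: cz_ig TK _ (bh n).
  by rewrite -[X in _ --> X](mul0r (J mu (a j))); exact: cvgMl.
Qed.

End OneBlock.

End BlockLimit.

(** * The operator on the Hardy space *)

Section H1Operator.
Context (R : realType) (d : measure_display) (X : metricBorelType R d).
Context (mu : {measure set X -> \bar R}) (lam : X -> R -> R).
Hypothesis mud : upper_doubling mu lam.
Implicit Types (x y z : X) (r s : R) (f g h : X -> R).
Variables (K : X -> X -> R) (T T' : (X -> R) -> X -> R) (C0 C c delta : R).
Hypothesis TK : CZO mu lam T' K C0 C c delta.
Hypothesis T2 : forall f, Lp mu 2%:E f -> Lp mu 2%:E (T f).
Hypothesis TT' : forall f h, Lp mu 2%:E f -> bb h ->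
  J mu (fun x => T f x * h x) = pr mu f (T' h).
Variable rho : R.
Hypothesis rho1 : 1 < rho.

(** The relation [g = S f]. It refers to no decomposition of [f], so uniqueness, linearity and
    agreement with [T] on L^2 are immediate. *)
Definition H1spec f g := loc mu g /\ forall h, bb h ->
  J mu (fun x => f x * clip n%:R (T' h x)) @[n --> \oo] --> pr mu g h.

Lemma ig_clip f N h : ig mu f -> 0 <= N -> bb h ->
  ig mu (fun x => f x * clip N (T' h x)).
Proof.
move=> fi N0 bh; apply: ig_le (igZ N (ig_abs fi)).
  apply: measurable_funM; first exact: ig_meas fi.
  apply: measurableT_comp; first exact: measurable_clip.
  exact: cz_meas TK _ bh.
by move=> x; rewrite normrM mulrC ler_wpM2r// clip_bound.
Qed.

Lemma H1spec_uniq f g1 g2 : H1spec f g1 -> H1spec f g2 ->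
  {ae mu, forall x, g1 x = g2 x}.
Proof.
move=> [l1 s1] [l2 s2]; apply: loc_inj => // h bh.
by apply: cvg_unique (s1 h bh) (s2 h bh).
Qed.

Lemma H1spec_lin (a : R) f1 f2 g1 g2 : ig mu f1 -> ig mu f2 ->
  H1spec f1 g1 -> H1spec f2 g2 ->
  H1spec (fun x => a * f1 x + f2 x) (fun x => a * g1 x + g2 x).
Proof.
move=> i1 i2 [l1 s1] [l2 s2]; split; first exact: locD.
move=> h bh; rewrite prDl//.
rewrite (_ : (fun n => J mu _) = (fun n => a * J mu (fun x => f1 x * clip n%:R (T' h x)) +
  J mu (fun x => f2 x * clip n%:R (T' h x)))); last first.
  apply/funext => n; have j1 := ig_clip i1 (ler0n _ n) bh.
  have j2 := ig_clip i2 (ler0n _ n) bh.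
  rewrite -JZ// -JD//; last exact: igZ.
  by apply: eq_J => x; ring.
by apply: cvgD; [apply: cvgMr; exact: s1|exact: s2].
Qed.

Lemma H1spec_L2 f : ig mu f -> Lp mu 2%:E f -> H1spec f (T f).
Proof.
move=> fi f2; have /L2P[mTf Tf2] := T2 f2; have /L2P[mf if2] := f2.
split; first exact: (L2_loc mud).
move=> h bh; rewrite /pr TT'// /pr.
have mT := cz_meas TK bh.
have iT : ig mu (fun x => f x * T' h x).
  by apply: ig_mul2 => //; exact: cz_ig TK _ bh.
have [|||||_ _ cv] := @J_dct _ _ _ mu (fun n x => f x * clip n%:R (T' h x))
  (fun x => f x * T' h x) (fun x => `|f x * T' h x|) => //.
- by move=> n; exact: ig_meas (ig_clip fi (ler0n _ n) bh).
- exact: ig_meas iT.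
- exact: ig_abs.
- by move=> n; apply: aeW => x; rewrite !normrM ler_wpM2l// clip_le.
- by apply: aeW => x; apply: cvgMr; exact: clip_cvg.
Qed.

Variable D : R.
Hypothesis D0 : 0 < D.
Hypothesis DP : forall h M, bb h -> 0 < M ->
  (forall x, `|h x| <= M) -> forall z r z' r', 0 < r -> 0 < r' ->
  ball z r `<=` ball z' r' ->
  ig mu (fun x => \1_(ball z r) x * `|T' h x - center_value mu K rho h z' r'|) /\
  J mu (fun x => \1_(ball z r) x * `|T' h x - center_value mu K rho h z' r'|) <=
    D * M * (m mu (ball z (rho * r)) * (1 + J mu (kann lam z r r'))).

Lemma bb_bound h : bb h -> exists2 M, 0 < M & forall x, `|h x| <= M.
Proof.
move=> bh; have [r [M [_ M0 hM]]] := bbP bh; exists M => // x.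
by rewrite (le_trans (hM x))// -[leRHS]mulr1 ler_wpM2l ?(ltW M0) ?ind_le1.
Qed.

(** A decomposition serves to prove that the limit of clipped pairings exists, is continuous in [h]
    and is bounded by [D * M * t]; [riesz] then provides [g]. *)
Lemma H1spec_decomposition f t : ig mu f -> H1_decomposition mu lam rho f t ->
  (t < +oo)%E -> exists g, H1spec f g /\
    (forall h M, bb h -> 0 < M -> (forall x, `|h x| <= M) ->
      ((`|pr mu g h|)%:E <= (D * M)%:E * t)%E).
Proof.
move=> fi [b [s [bs bf ts]]] ty; have mf := ig_meas fi.
have {bs}/choice[B /choice[l /choice[a /choice[Bj bP]]]] :
  forall i, exists B l a Bj, atomic_block mu lam rho (b i) B l a Bj /\
    s i = (\sum_(0 <= j <oo) (`|l j|)%:E)%E := bs.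
have s0 i : (0 <= s i)%E.
  by rewrite (bP i).2; apply: nneseries_ge0 => j _ _; rewrite lee_fin.
have sy i : (s i < +oo)%E.
  apply: le_lt_trans ty; rewrite ts.
  apply: (@le_trans _ _ (\sum_(0 <= k < i.+1) s k)%E).
    by rewrite big_nat_recr//= leeDr// sume_ge0.
  by apply: nneseries_lim_ge => k _ _.
have sl i : summ (fun j => `|l i j|) /\ (ssum (fun j => `|l i j|))%:E = s i.
  have [||? E] := @summ_nneg _ (fun j => `|l i j|) => //.
    by rewrite -(bP i).2.
  by split => //; rewrite E -(bP i).2.
pose sig i := ssum (fun j => `|l i j|).
have sig0 i : 0 <= sig i by apply: J_ge0 => j.
have [sS sE] : summ sig /\ (ssum sig)%:E = t.
  have tE : t = (\sum_(0 <= i <oo) (sig i)%:E)%E.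
    by rewrite ts; apply: eq_eseriesr => i _; rewrite (sl i).2.
  by rewrite tE; apply: summ_nneg => //; rewrite -tE.
have AB i := (bP i).1.
have ib i : ig mu (b i) by exact: (block_ig mud rho1 (AB i)).
pose L h := ssum (fun i => beta mu K T' rho (B i) (l i) (a i) h).
have Lterm h M i : bb h -> 0 < M -> (forall x, `|h x| <= M) ->
    `|beta mu K T' rho (B i) (l i) (a i) h| <= D * M * sig i.
  by move=> bh M0 hM; exact: (beta_le mud TK rho1 D0 DP (AB i) (sl i).1).
have Lsumm h : bb h -> summ (fun i => beta mu K T' rho (B i) (l i) (a i) h).
  move=> bh; have [M M0 hM] := bb_bound bh.
  apply: (summ_le (c := fun i => D * M * sig i)); last exact: igZ.
  by move=> i; exact: Lterm.
have Lle h M : bb h -> 0 < M -> (forall x, `|h x| <= M) ->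
    `|L h| <= D * M * ssum sig.
  move=> bh M0 hM; rewrite /ssum -JZ//; apply: ssum_norm_le; last exact: igZ.
  by move=> i; exact: Lterm.
have Lcv h : bb h ->
    J mu (fun x => f x * clip n%:R (T' h x)) @[n --> \oo] --> L h.
  move=> bh; have [M M0 hM] := bb_bound bh.
  have mT := cz_meas TK bh.
  have bnd n i : `|J mu (fun x => b i x * clip n%:R (T' h x))| <= D * M * sig i.
    exact: (block_clip_le mud TK rho1 D0 DP (AB i) (sl i).1 (ler0n _ n)).
  have E n : J mu (fun x => f x * clip n%:R (T' h x)) =
      ssum (fun i => J mu (fun x => b i x * clip n%:R (T' h x))).
    apply: (sums_in_L1_pair (N := n%:R)) => //.
    - by apply: measurableT_comp => //; exact: measurable_clip.
    - by move=> x; exact: clip_bound.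
    - apply: (summ_le (c := fun i => D * M * sig i)) => //; exact: igZ.
  rewrite (_ : (fun n => J mu _) = (fun n =>
    ssum (fun i => J mu (fun x => b i x * clip n%:R (T' h x)))));
    last by apply/funext => n; exact: E.
  apply: (@ssum_cvg _ _ _ (fun i => D * M * sig i)) => //; first exact: igZ.
  by move=> i; exact: (block_clip_cvg mud TK rho1 D0 DP (AB i) (sl i).1).
have [||g [lg gP]] := @riesz _ _ _ _ _ mud L.
- move=> k h1 h2 b1 b2; rewrite /L -ssumD; [|exact: Lsumm|exact: Lsumm].
  rewrite /ssum; apply: eq_J => i.
  exact: (beta_lin mud TK rho1 D0 DP (AB i) (sl i).1).
- move=> z r h_ mh h1 h0.
  have bh n : bb (h_ n) by exact: ind_dom_bb (mh n) (h1 n).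
  have hM n x : `|h_ n x| <= 1 by rewrite (le_trans (h1 n x))// ind_le1.
  have z0 : ssum (fun _ : nat => 0 : R) = 0 by exact: J0.
  rewrite -[X in _ --> X]z0.
  apply: (@ssum_cvg _ _ _ (fun i => D * 1 * sig i)); last 1 first.
  + by move=> i; exact: (beta_cont mud TK rho1 D0 DP (AB i) (sl i).1 mh h1 h0).
  + by move=> n i; exact: Lterm.
  + exact: igZ.
exists g; split; first by split => // h bh; rewrite -gP//; exact: Lcv.
move=> h M bh M0 hM; rewrite -gP// -sE -EFinM lee_fin.
exact: Lle.
Qed.

Lemma loc_L1_bound g (M : R) : 0 <= M -> loc mu g ->
  (forall h, bb h -> (forall x, `|h x| <= 1) -> `|pr mu g h| <= M) ->
  ig mu g /\ J mu (fun x => `|g x|) <= M.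
Proof.
move=> M0 [mg lg] gM.
have [|||||i1 J1] := @ig_fatou _ _ _ mu
    (fun n x => \1_(ball (point : X) n%:R) x * `|g x|) (fun x => `|g x|) M.
- move=> n; apply: eq_ig (ig_abs (lg point n%:R)) => x.
  by rewrite normrM ger0_norm ?ind_ge0.
- by move=> n x; rewrite mulr_ge0 ?ind_ge0.
- move=> n; have bh := bb_sg point n%:R mg.
  have -> : J mu (fun x => \1_(ball (point : X) n%:R) x * `|g x|) =
      pr mu g (fun x => \1_(ball (point : X) n%:R) x * Num.sg (g x)).
    by rewrite /pr; apply: eq_J => x; rewrite normrEsg; ring.
  rewrite (le_trans (ler_norm _))// gM// => x.
  rewrite normrM ger0_norm ?ind_ge0//.
  apply: mulr_ile1; rewrite ?ind_ge0 ?ind_le1//.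
  by case: sgrP; rewrite ?normr0 ?normrN ?normr1.
- exact: measurableT_comp.
- move=> x; apply: (@cvg_from _ _ _ (Num.truncn (mdist point x)).+1) => n hn.
  rewrite indT ?mul1r// in_ballE (lt_le_trans (truncnS_gt _))// ler_nat//.
split => //; apply: ig_le i1 => // x.
Qed.

Lemma H1_bounded :
  exists S, extends_L2 mu T (H1at mu lam rho) S /\
    bounded_from mu (H1at mu lam rho) (H1at_norm mu lam rho) 1%E S.
Proof.
have /choice[S SP] : forall f, exists g, (exists g', H1spec f g') -> H1spec f g.
  move=> f; have [[g' ?]|n] := pselect (exists g', H1spec f g').
    by exists g'.
  by exists (fun=> 0).
have H1ig f : H1at mu lam rho f -> ig mu f.
  by move=> [fL _]; apply/Lfun1_integrable.
have Sspec f : H1at mu lam rho f -> H1spec f (S f).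
  move=> Hf; apply: SP; have fi := H1ig f Hf.
  have [_ [t dec ty]] := Hf.
  by have [g [? _]] := H1spec_decomposition fi dec ty; exists g.
exists S; split; first split.
- move=> a f g Hf Hg.
  have spec := H1spec_lin a (H1ig f Hf) (H1ig g Hg) (Sspec f Hf) (Sspec g Hg).
  have spec' : H1spec (fun x => a * f x + g x) (S (fun x => a * f x + g x)).
    by apply: SP; eexists; exact: spec.
  by apply: filterS (H1spec_uniq spec' spec) => x.
- move=> f Hf f2.
  have := H1spec_uniq (Sspec f Hf) (H1spec_L2 (H1ig f Hf) f2).
  by apply: filterS => x.
exists D => f Hf; have fi := H1ig f Hf.
(* [S f] was chosen once, but by uniqueness it agrees with the function built from any other
   decomposition and inherits its bound. *)
have bound t : H1_decomposition mu lam rho f t -> (t < +oo)%E ->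
    ig mu (S f) /\ ((J mu (fun x => `|S f x|))%:E <= D%:E * t)%E.
  move=> dec ty; have [g [gs gB]] := H1spec_decomposition fi dec ty.
  have [lS _] := Sspec f Hf.
  have gE := H1spec_uniq (Sspec f Hf) gs.
  have prE h : bb h -> pr mu (S f) h = pr mu g h.
    move=> bh; apply: eq_J_ae; [exact: loc_le|exact: loc_le gs.1 bh|].
    by apply: filterS gE => x ->.
  have t0 : (0 <= t)%E.
    have [b [s [bs _ ->]]] := dec; apply: nneseries_ge0 => i _ _.
    have [? [l [? [? [_ ->]]]]] := bs i.
    by apply: nneseries_ge0 => j _ _; rewrite lee_fin.
  have tf : t \is a fin_num by rewrite ge0_fin_numE.
  have [||iS JS] := @loc_L1_bound (S f) (D * fine t) _ lS.
  - by rewrite mulr_ge0 ?fine_ge0// ltW.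
  - move=> h bh h1; have := gB h 1 bh ltr01 h1.
    by rewrite mulr1 prE// -{1}(fineK tf) -EFinM lee_fin.
  split => //; rewrite -(fineK tf) -EFinM lee_fin//.
have [_ [t0 dec0 t0y]] := Hf.
have [iS _] := bound t0 dec0 t0y.
split; first by apply/Lfun1_integrable.
have -> : ('N[mu]_1 [EFin \o S f] = (J mu (fun x => `|S f x|))%:E)%E.
  by rewrite Lnorm1 EFin_J//; exact: ig_abs.
(* Divided by [D], the L^1 norm of [S f] is a lower bound of all values of decompositions; the value
   +oo is bounded trivially. *)
rewrite -lee_pdivrMl// /H1at_norm; apply: le_ereal_inf_tmp => t dec.
have [ty|] := ltP t +oo%E; last by rewrite leye_eq => /eqP ->; rewrite leey.
by rewrite lee_pdivrMl//; exact: (bound t dec ty).2.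
Qed.

End H1Operator.

(** * Covering and differentiation by doubling balls *)

Lemma ig_restr (R : realType) d (T : measurableType d)
    (mu : {measure set T -> \bar R}) (A : set T) (f : T -> R) :
  measurable A -> ig mu f -> ig mu (fun x => \1_A x * f x).
Proof.
move=> mA fi; apply: ig_le (ig_abs fi).
  apply: measurable_funM; first exact: measurable_indic.
  exact: ig_meas fi.
by move=> x; rewrite normrM ger0_norm ?ind_ge0// ler_piMl// ind_le1.
Qed.

Section Covering.
Context (R : realType) (d : measure_display) (X : metricBorelType R d).
Context (mu : {measure set X -> \bar R}).
Hypothesis Xd : geometrically_doubling X.
Implicit Types (x y z : X) (r s : R).

(** Greedy selection by decreasing radius: the list is sorted increasingly and the induction treats
    its tail first, so a new ball meeting a selected one is no larger and lies in its triple.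
    Disjointness is stated with indicators, the form in which it is integrated. *)
Lemma finite_vitali (s : seq X) (rad : X -> R) : exists t : seq X,
  [/\ forall y, y \in t -> y \in s,
      forall z, \sum_(y <- t) \1_(ball y (rad y)) z <= 1 :> R &
      forall x, x \in s ->
        exists2 y, y \in t & ball x (rad x) `<=` ball y (3 * rad y)].
Proof.
pose e x y := rad x <= rad y.
have etot : total e by move=> x y; exact: le_total.
have etr : transitive e by move=> y x z; exact: le_trans.
have : sorted e (sort e s) by exact: sort_sorted.
have sE x : (x \in s) = (x \in sort e s) by rewrite mem_sort.
suff H u : sorted e u -> exists t : seq X,
  [/\ forall y, y \in t -> y \in u,
      forall z, \sum_(y <- t) \1_(ball y (rad y)) z <= 1 :> R &
      forall x, x \in u ->
        exists2 y, y \in t & ball x (rad x) `<=` ball y (3 * rad y)].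
  move=> /H[t [ts t1 t3]]; exists t; split => [y /ts|//|x]; rewrite ?sE//.
  exact: t3.
elim: u => [|x u IH] xu.
  by exists [::]; split => // z; rewrite big_nil.
have ux : {in u, forall y, rad x <= rad y}.
  by move=> y; move: (order_path_min etr xu) => /allP/(_ y).
have [t [tu t1 t3]] := IH (path_sorted xu).
have [[y [yt [z [xz yz]]]]|dis] := pselect (exists y, y \in t /\
    exists z, ball x (rad x) z /\ ball y (rad y) z).
  exists t; split => // [w /tu|w]; rewrite ?inE; first by move=> ->; rewrite orbT.
  move=> /orP[/eqP ->|/t3//]; exists y => //; apply: sub_ball.
  move: xz yz; rewrite !in_ballE => xz yz; rewrite metric_sym in xz.
  have := mdist_lt yz xz; have := ux y (tu y yt).
  by rewrite /e; lra.
exists (x :: t); split => [w|z|w]; rewrite ?inE.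
- by move=> /orP[->//|/tu ->]; rewrite orbT.
- rewrite big_cons; have [xz|xz] := pselect (ball x (rad x) z).
    rewrite indT// big1_seq ?addr0// => y /andP[_ yt].
    by rewrite indF// => yz; apply: dis; exists y; split => //; exists z.
  by rewrite indF// add0r.
- move=> /orP[/eqP ->|/t3[y yt h]]; last by exists y; rewrite ?inE ?yt ?orbT.
  have [r0|r0] := ltP 0 (rad x); last first.
    exists x; rewrite ?inE ?eqxx// => z; rewrite in_ballE => h.
    by have := mdist_ge0 x z; lra.
  by exists x; rewrite ?inE ?eqxx//; apply: le_ball; lra.
Qed.

(* Only finitely many balls are selected at a time: nets of the sets of points
   whose radii are bounded below, and Fatou's lemma. *)
Lemma vitali (f g : X -> R) : ig mu f -> ig mu g ->
  (forall x, 0 <= f x) -> (forall x, 0 <= g x) ->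
  (forall x, f x != 0 -> exists2 r, 0 < r &
    J mu (fun y => \1_(ball x (3 * r)) y * f y) <=
    J mu (fun y => \1_(ball x r) y * g y)) ->
  J mu f <= J mu g.
Proof.
move=> fi gi f0 g0 h.
have {h}/choice[rad radP] : forall x, exists r, f x != 0 -> 0 < r /\
    J mu (fun y => \1_(ball x (3 * r)) y * f y) <=
    J mu (fun y => \1_(ball x r) y * g y).
  move=> x; have [_|/h[r r0 ?]] := eqVneq (f x) 0; first by exists 1.
  by exists r.
(* A net of [E n] at scale 1/(n+1) has centres [z] with [rad z] at least 1/(n+1), so finitely many
   of the given balls cover [E n]. *)
pose E n := [set x | [/\ f x != 0, ball (point : X) n%:R x & n.+1%:R^-1 <= rad x]].
have /choice[s sP] : forall n, exists s : seq X, (forall y, y \in s -> E n y) /\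
    E n `<=` [set y | exists2 z, z \in s & ball z (n.+1%:R^-1) y].
  by move=> n; apply: (@net_in _ _ _ Xd _ point n%:R); [rewrite invr_gt0|move=> x []].
have /choice[t tP] := fun n => finite_vitali (s n) rad.
pose V n := \bigcup_(y in [set` t n]) ball y (3 * rad y).
have mV n : measurable (V n).
  by apply: open_borel; apply: bigcup_open => y _; exact: ball_openm.
have [|||||//] := @ig_fatou _ _ _ mu (fun n x => \1_(V n) x * f x) f (J mu g).
- by move=> n; exact: ig_restr.
- by move=> n x; rewrite mulr_ge0 ?ind_ge0.
- move=> n; have [ts t1 t3] := tP n.
  apply: (@le_trans _ _ (\sum_(y <- t n) J mu (fun x => \1_(ball y (3 * rad y)) x * f x))).
    rewrite -J_sum; last by move=> y _; apply: ig_restr => //; exact: mball.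
    apply: J_le; first exact: ig_restr.
      by apply: ig_sum => y _; apply: ig_restr => //; exact: mball.
    move=> x; have [[y /= yt yx]|Vx] := pselect (V n x); last first.
      rewrite indF// mul0r sumr_ge0// => y _.
      by rewrite mulr_ge0 ?ind_ge0.
    rewrite (big_rem y)//= indT; last by exists y.
    rewrite indT// lerDl sumr_ge0// => w _.
    by rewrite mulr_ge0 ?ind_ge0.
  apply: (@le_trans _ _ (\sum_(y <- t n) J mu (fun x => \1_(ball y (rad y)) x * g x))).
    rewrite big_seq [leRHS]big_seq; apply: ler_sum => y /ts /(sP n).1[fy _ _].
    exact: (radP y fy).2.
  rewrite -J_sum; last by move=> y _; apply: ig_restr => //; exact: mball.
  apply: J_le => //.
    by apply: ig_sum => y _; apply: ig_restr => //; exact: mball.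
  by move=> x; rewrite -mulr_suml ler_piMl.
- exact: ig_meas fi.
- move=> x; have [fx|fx] := eqVneq (f x) 0.
    by apply: (@cvg_from _ _ _ 0%N) => n _; rewrite fx mulr0.
  have [rx _] := radP x fx.
  pose N := maxn (Num.truncn (mdist point x)).+1 (Num.truncn (rad x)^-1).
  apply: (@cvg_from _ _ _ N) => n; rewrite geq_max => /andP[n1 n2].
  rewrite indT ?mul1r//.
  have Ex : E n x.
    split => //; first by rewrite in_ballE (lt_le_trans (truncnS_gt _))// ler_nat.
    rewrite -[leRHS]invrK lef_pV2 ?posrE ?invr_gt0// (le_trans (ltW (truncnS_gt _)))//.
    by rewrite ler_nat ltnS.
  have [z zs zx] := (sP n).2 x Ex; have [_ _ h3] := tP n.
  have [y yt zy] := h3 z zs; exists y => //; apply: zy.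
  by apply: le_ball zx; have [] := (sP n).1 z zs.
Qed.

End Covering.

(** * Outer regularity of Borel measures *)

Section Regularity.
Context (R : realType) (d : measure_display) (X : metricBorelType R d).
Context (mu : {measure set X -> \bar R}) (W : set X).
Hypotheses (mW : measurable W) (Wy : (mu W < +oo)%E).
Implicit Types (x y z : X) (r s e : R) (A B U : set X).

Definition outer_regular A := forall e, 0 < e -> exists U,
  [/\ open U, A `<=` U & (mu ((U `\` A) `&` W) < e%:E)%E].

Lemma outer_regular_bigcup (A : nat -> set X) :
  (forall n, measurable (A n)) -> (forall n, outer_regular (A n)) ->
  outer_regular (\bigcup_n A n).
Proof.
move=> mA Ar e e0; have e20 : 0 < e / 2 by rewrite divr_gt0.
have /choice[U UP] : forall n, exists U, [/\ open U, A n `<=` U &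
    (mu ((U `\` A n) `&` W) < (e / 2 / (2 ^ n.+1)%:R)%:E)%E].
  by move=> n; apply: Ar; rewrite divr_gt0// ltr0n expn_gt0.
have mU n : measurable (U n) by apply: open_borel; have [] := UP n.
exists (\bigcup_n U n); split.
- by apply: bigcup_open => n _; have [] := UP n.
- by move=> x [n _ xA]; exists n => //; have [_ + _] := UP n; exact.
apply: (@le_lt_trans _ _ (e / 2)%:E); last by rewrite lte_fin; lra.
apply: (@le_trans _ _ (\sum_(0 <= n <oo) mu ((U n `\` A n) `&` W))%E).
  apply: measure_sigma_subadditive.
  - by move=> n; apply: measurableI => //; exact: measurableD.
  - apply: measurableI => //; apply: measurableD; exact: bigcup_measurable.
  - move=> x [[[n _ xU] xA] xW]; exists n => //; split => //; split => //.
    by move=> h; apply: xA; exists n.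
apply: le_trans (epsilon_trick0 xpredT (ltW e20)).
by apply: lee_nneseries => // n _; rewrite ltW//; have [] := UP n.
Qed.

(** Finite intersections are handled by subadditivity. A countable one is then approximated by them
    through continuity from above, where the finite measure of [W] enters. *)
Lemma outer_regular_bigcap (A : nat -> set X) :
  (forall n, measurable (A n)) -> (forall n, outer_regular (A n)) ->
  outer_regular (\bigcap_n A n).
Proof.
move=> mA Ar.
pose B n := \bigcap_(i < n) A i.
have mB n : measurable (B n) by exact: bigcap_measurableType.
have Br n : outer_regular (B n).
  elim: n => [|n IH] e e0.
    exists setT; split => //; first exact: openT.
    by rewrite /B bigcap_mkord big_ord0 setDv set0I measure0.
  have e20 : 0 < e / 2 by rewrite divr_gt0.
  have [U [oU UB Ue]] := IH _ e20; have [V [oV VA Ve]] := Ar n _ e20.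
  have BE : B n.+1 = B n `&` A n by rewrite /B !bigcap_mkord big_ord_recr.
  exists (U `&` V); rewrite BE; split; first exact: openI.
    by apply: setISS.
  have mU := open_borel oU; have mV := open_borel oV.
  apply: (@le_lt_trans _ _ (mu (((U `\` B n) `&` W) `|` ((V `\` A n) `&` W)))).
    apply: le_measure; rewrite ?inE.
    + by apply: measurableI => //; apply: measurableD; exact: measurableI.
    + by apply: measurableU; apply: measurableI => //; exact: measurableD.
    + move=> x [[[xU xV] xn] xW]; have [xB|xB] := pselect (B n x).
        by right; split => //; split => // xA; apply: xn.
      by left.
  apply: (@le_lt_trans _ _ (mu ((U `\` B n) `&` W) + mu ((V `\` A n) `&` W))%E).
  + by apply: measureU2; apply: measurableI => //; exact: measurableD.
  + by rewrite [e]splitr EFinD lteD.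
move=> e e0; have e20 : 0 < e / 2 by rewrite divr_gt0.
have mC : measurable (\bigcap_n A n) by exact: bigcapT_measurable.
pose D n := (B n `\` \bigcap_n A n) `&` W.
have mD n : measurable (D n) by apply: measurableI => //; exact: measurableD.
have D0 : \bigcap_n D n = set0.
  apply/seteqP; split => // x h; have [[_ xA] _] := h 0%N I; apply: xA => n _.
  by have [[xB _] _] := h n.+1 I; apply: xB => /=.
have h : mu (D n) @[n --> \oo] --> 0%E.
  rewrite -[X in _ --> X](measure0 mu) -D0; apply: nonincreasing_cvg_mu => //.
  - apply: le_lt_trans Wy; apply: le_measure; rewrite ?inE//.
    by move=> x [].
  - by rewrite D0.
  - apply/nonincreasing_seqP => n; apply/subsetPset => x [[xB xA] xW]; split => //.
    by split => // i /= ni; apply: xB => /=; rewrite (ltn_trans ni).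
have [N _ /(_ N (leqnn N)) Ne] : \forall n \near \oo, (mu (D n) < (e / 2)%:E)%E.
  apply: (h [set y | (y < (e / 2)%:E)%E]); apply: open_nbhs_nbhs; split.
    exact: open_ereal_lt_ereal.
  by rewrite /= lte_fin.
have [U [oU UB Ue]] := Br N _ e20; have mU := open_borel oU.
exists U; split => //; first by move=> x xA; apply: UB => i _; exact: xA.
apply: (@le_lt_trans _ _ (mu (((U `\` B N) `&` W) `|` D N))).
  apply: le_measure; rewrite ?inE.
  + by apply: measurableI => //; exact: measurableD.
  + by apply: measurableU => //; apply: measurableI => //; exact: measurableD.
  + move=> x [[xU xA] xW]; have [xB|xB] := pselect (B N x); last by left.
    by right.
apply: (@le_lt_trans _ _ (mu ((U `\` B N) `&` W) + mu (D N))%E).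
+ by apply: measureU2 => //; apply: measurableI => //; exact: measurableD.
+ by rewrite [e]splitr EFinD lteD.
Qed.

Lemma open_outer_regular U : open U -> outer_regular U.
Proof.
by move=> oU e e0; exists U; split => //; rewrite setDv set0I measure0.
Qed.

(** The sets that are outer regular together with their complements form a sigma-algebra. It
    contains the open sets, since a closed set is the intersection of its neighbourhoods of radius
    1/(n+1). *)
Lemma measurable_outer_regular A : measurable A -> outer_regular A.
Proof.
suff : @measurable d X `<=` [set A | [/\ measurable A, outer_regular A &
    outer_regular (~` A)]] by move=> /[apply] -[].
rewrite [X in X `<=` _]borel_measurableE; apply: smallest_sub; last first.
  move=> U oU; split; [exact: open_borel|exact: open_outer_regular|].
  pose V n := \bigcup_(x in ~` U) ball x n.+1%:R^-1.
  have oV n : open (V n) by apply: bigcup_open => x _; exact: ball_openm.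
  have -> : ~` U = \bigcap_n V n.
    apply/seteqP; split => x.
      by move=> xU n _; exists x => //; apply: ballxx; rewrite invr_gt0.
    move=> xV xU; have [e e0 xe] := openP_metric oU xU.
    pose n := Num.truncn e^-1.
    have [y yU] := xV n I; rewrite in_ballE => yx; apply: yU; apply: xe.
    rewrite in_ballE metric_sym (lt_trans yx)// -[ltRHS]invrK.
    by rewrite ltf_pV2 ?posrE ?invr_gt0// truncnS_gt.
  apply: outer_regular_bigcap => n; first exact: open_borel.
  exact: open_outer_regular.
split.
- split; [exact: measurable0| |]; first by apply: open_outer_regular; exact: open0.
  by rewrite setC0; apply: open_outer_regular; exact: openT.
- move=> B [mB rB rBC]; rewrite setTD; split => //; first exact: measurableC.
  by rewrite setCK.
- move=> F FP; have mF n : measurable (F n) by have [] := FP n.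
  split; first exact: bigcupT_measurable.
    by apply: outer_regular_bigcup => // n; have [] := FP n.
  rewrite setC_bigcup; apply: outer_regular_bigcap => n; first exact: measurableC.
  by have [] := FP n.
Qed.

End Regularity.

(** * Small doubling balls and differentiation *)

Section Doubling.
Context (R : realType) (d : measure_display) (X : metricBorelType R d).
Context (mu : {measure set X -> \bar R}) (lam : X -> R -> R).
Hypotheses (mud : upper_doubling mu lam) (Xd : geometrically_doubling X).
Implicit Types (x y z : X) (r s b : R).

Lemma negligible_small (A : set X) :
  (forall e : R, 0 < e -> exists V, [/\ measurable V, A `<=` V & (mu V <= e%:E)%E]) ->
  mu.-negligible A.
Proof.
move=> h.
have /choice[V VP] : forall n : nat, exists V, [/\ measurable V, A `<=` V &
    (mu V <= (n.+1%:R^-1)%:E)%E] by move=> n; apply: h; rewrite invr_gt0.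
have mV n : measurable (V n) by have [] := VP n.
exists (\bigcap_n V n); split.
- exact: bigcapT_measurable.
- apply/eqP; rewrite eq_le measure_ge0 andbT; apply/lee_addgt0Pr => e e0.
  rewrite add0e; pose n := Num.truncn e^-1.
  apply: (@le_trans _ _ (mu (V n))).
    by apply: le_measure; rewrite ?inE//; [exact: bigcapT_measurable|exact: bigcap_inf].
  have [_ _ /le_trans] := VP n; apply; rewrite lee_fin -[leRHS]invrK.
  by rewrite lef_pV2 ?posrE ?invr_gt0// ltW// truncnS_gt.
- by move=> x Ax n _; have [_ + _] := VP n; exact.
Qed.

Lemma mu_bigsetU I (s : seq I) (P : pred I) (F : I -> set X) (a : R) : 0 <= a ->
  (forall i, P i -> measurable (F i) /\ (mu (F i) <= a%:E)%E) ->
  (mu (\big[setU/set0]_(i <- s | P i) F i) <= ((size s)%:R * a)%:E)%E.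
Proof.
move=> a0 h; elim: s => [|i s IH]; first by rewrite big_nil measure0 mul0r.
have E : (size (i :: s))%:R * a = a + (size s)%:R * a :> R by rewrite /= -nat1r; ring.
rewrite big_cons E EFinD; case: ifPn => [Pi|_]; last by rewrite (le_trans IH)// leeDr.
have [mF Fa] := h i Pi.
apply: (@le_trans _ _ (mu (F i) + mu (\big[setU/set0]_(j <- s | P j) F j))%E).
  by apply: measureU2 => //; apply: bigsetU_measurable => j /h[].
exact: leeD.
Qed.

Let sc (k : nat) : R := (8 ^+ k)^-1.

Let sc0 k : 0 < sc k. Proof. by rewrite invr_gt0 exprn_gt0. Qed.

Let scS k : 8 * sc k.+1 = sc k.
Proof. by rewrite /sc exprS invfM mulrA divff// mul1r. Qed.

Let sc2 k : sc k = (2 ^+ (3 * k))^-1.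
Proof. by rewrite /sc exprM (_ : 2 ^+ 3 = 8 :> R)//; ring. Qed.

(* A point that is not the centre of small doubling balls lies in balls of
   rapidly decreasing measure, and nets at scale 2^-j only have N^j elements. *)
Lemma small_doubling : exists b0 : R, 0 < b0 /\ forall b, b0 <= b ->
  {ae mu, forall x, forall k0, exists k, (k0 <= k)%N /\
    m mu (ball x (64 * sc k)) <= b * m mu (ball x (sc k))}.
Proof.
have [N XN] := Xd.
(* Dividing the radius by 64 = 2^6 multiplies the size of the nets by [q], while the measure of a
   ball about a bad point is divided by [b]; [b >= 2 * q] leaves a factor 1/2 at each step. *)
pose q : R := N%:R ^+ 6.
exists (2 * q + 1); have q0 : 0 <= q by rewrite exprn_ge0.
split => [|b bq]; first by lra.
have b0 : 0 < b by lra.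
pose bad n k0 := [set x | ball (point : X) (2 ^+ n) x /\ forall k, (k0 <= k)%N ->
   b * m mu (ball x (sc k)) < m mu (ball x (64 * sc k))].
suff H n k0 : mu.-negligible (bad n k0).
  have : mu.-negligible (\bigcup_n \bigcup_k0 bad n k0).
    by apply: negligible_bigcup => n; apply: negligible_bigcup => k0.
  apply: negligibleS => x /= /existsNP[k0 xk].
  have [n nx] : exists n : nat, mdist point x < 2 ^+ n :> R.
    exists (Num.truncn (mdist point x)).+1; rewrite (lt_trans (truncnS_gt _))//.
    by rewrite -natrX ltr_nat ltn_expl.
  exists n => //; exists k0 => //; split; first by rewrite in_ballE.
  by move=> k k0k; rewrite ltNge; apply/negP => h; apply: xk; exists k.
pose M := m mu (ball point (2 ^+ n + sc k0)).
have M0 : 0 <= M by exact: m_ge0.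
have decay i x : bad n k0 x -> b ^+ i * m mu (ball x (sc (k0 + 2 * i))) <= M.
  move=> [nx xk]; elim: i => [|i IH].
    rewrite expr0 mul1r muln0 addn0; apply: (m_ball_le mud).
    by apply: sub_ball; rewrite lerD2r ltW// -in_ballE.
  apply: le_trans IH; rewrite exprSr -mulrA ler_wpM2l ?exprn_ge0 ?(ltW b0)//.
  have e : 64 * sc (k0 + 2 * i.+1) = sc (k0 + 2 * i).
    have -> : (k0 + 2 * i.+1)%N = (k0 + 2 * i).+2 by rewrite mulnS addnCA.
    by have := scS (k0 + 2 * i)%N; have := scS (k0 + 2 * i).+1; lra.
  by rewrite -e ltW// xk// leq_addr.
pose c1 := N%:R ^+ (n + 1 + 3 * k0) * M.
have c10 : 0 <= c1 by rewrite mulr_ge0// exprn_ge0.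
have cover i : exists V, [/\ measurable V, bad n k0 `<=` V &
    (mu V <= (c1 * 2^-1 ^+ i)%:E)%E].
  (* Twice the net radius is then the radius [sc (k0 + 2 * i)], so a net ball containing a bad point
     [x] lies in the small ball about [x], whose measure [decay] controls. *)
  pose j := (n + 1 + 3 * (k0 + 2 * i))%N.
  have [s sN sb] := net_exp XN j (point : X) (exprn_gt0 n (ltr0n R 2)).
  have j2 : 2 * (2 ^+ n / 2 ^+ j) = sc (k0 + 2 * i) :> R.
    rewrite sc2 /j; set K := (3 * (k0 + _))%N; rewrite !exprD expr1.
    by field; rewrite !expf_neq0.
  pose P z := `[<exists x, bad n k0 x /\ ball z (2 ^+ n / 2 ^+ j) x>].
  exists (\big[setU/set0]_(z <- s | P z) ball z (2 ^+ n / 2 ^+ j)); split.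
  - by apply: bigsetU_measurable => z _; exact: mball.
  - move=> x xb; have [z zs zx] := sb x xb.1.
    rewrite (big_rem z zs) /= ifT; first by left.
    by apply/asboolP; exists x.
  have a0 : 0 <= M / b ^+ i by rewrite divr_ge0// exprn_ge0// ltW.
  apply: (@le_trans _ _ ((size s)%:R * (M / b ^+ i))%:E).
    apply: mu_bigsetU => // z /asboolP[x [xb zx]]; split; first exact: mball.
    rewrite -(EFin_m mud (mball _ _) (@subset_refl _ _)) lee_fin.
    rewrite ler_pdivlMr ?exprn_gt0// mulrC; apply: le_trans (decay i _ xb).
    rewrite ler_wpM2l ?exprn_ge0 ?(ltW b0)//; apply: (m_ball_le mud).
    rewrite -j2; apply: sub_ball; rewrite mulr_natl mulr2n lerD2r ltW//.
    by move: zx; rewrite in_ballE metric_sym.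
  rewrite lee_fin; apply: (@le_trans _ _ ((N ^ j)%:R * (M / b ^+ i))).
    by rewrite ler_wpM2r// ler_nat.
  rewrite natrX /j mulnDr addnA exprD mulnA exprM -/q /c1 mulrACA.
  rewrite ler_wpM2l// -expr_div_n; apply: lerXn2r.
  - by rewrite nnegrE divr_ge0// ltW.
  - by rewrite nnegrE invr_ge0.
  - by rewrite ler_pdivrMr//; lra.
apply: negligible_small => e e0.
have [i ie] : exists i : nat, c1 * 2^-1 ^+ i <= e.
  exists (Num.truncn (c1 / e)).+1; rewrite exprVn ler_pdivrMr ?exprn_gt0//.
  rewrite mulrC -ler_pdivrMr// (le_trans (ltW (truncnS_gt _)))//.
  by rewrite -natrX ler_nat ltnW// ltn_expl.
have [V [mV bV Ve]] := cover i; exists V; split => //.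
by rewrite (le_trans Ve)// lee_fin.
Qed.

Lemma measurable_le_fun (f g : X -> R) : measurable_fun [set: X] f ->
  measurable_fun [set: X] g -> measurable [set x | f x <= g x].
Proof.
move=> mf mg; have := measurable_fun_ler mf mg.
move=> /(_ measurableT [set true] I); rewrite setTI; congr measurable.
Qed.

(* Such averages are lower semicontinuous functions of the centre. *)
Lemma measurable_ball_integral (u : X -> R) r : ig mu u -> (forall x, 0 <= u x) ->
  measurable_fun [set: X] (fun x => J mu (fun y => \1_(ball x r) y * u y)).
Proof.
move=> ui u0 mT; apply: (measurability _ (RGenOInfty.measurableE R)) => //.
move=> _ [_ [c ->] <-]; rewrite setTI; apply: open_borel; apply: open_metric => x.
rewrite /= in_itv /= andbT => cx.
pose rn (n : nat) : R := r - n.+1%:R^-1.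
have [|||||_ _ cv] := @J_dct _ _ _ mu (fun n y => \1_(ball x (rn n)) y * u y)
  (fun y => \1_(ball x r) y * u y) u => //.
- by move=> n; apply: ig_meas (ig_restr _ ui); exact: mball.
- by apply: ig_meas (ig_restr _ ui); exact: mball.
- by move=> n; apply: aeW => y; rewrite ger0_norm ?mulr_ge0 ?ind_ge0// ler_piMl// ind_le1.
- apply: aeW => y; have [xy|xy] := ltP (mdist x y) r; last first.
    apply: (@cvg_from _ _ _ 0%N) => n _; rewrite !indF// in_ballE; apply/negP; rewrite -leNgt//.
    by rewrite (le_trans _ xy)// gerBl invr_ge0.
  apply: (@cvg_from _ _ _ (Num.truncn (r - mdist x y)^-1)) => n hn.
  rewrite !indT// in_ballE// /rn ltrBrDr -ltrBrDl -[ltRHS]invrK.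
  rewrite ltf_pV2 ?posrE ?invr_gt0 ?subr_gt0// (lt_le_trans (truncnS_gt _))//.
  by rewrite ler_nat ltnS.
have [N _ /(_ N (leqnn N)) cN] : \forall n \near \oo,
    c < J mu (fun y => \1_(ball x (rn n)) y * u y).
  exact: (cvgr_gt _ cv).
exists N.+1%:R^-1; first by rewrite invr_gt0.
move=> z; rewrite in_ballE => xz; rewrite /= in_itv /= andbT (lt_le_trans cN)//.
apply: J_le; [by apply: ig_restr => //; exact: mball|
  by apply: ig_restr => //; exact: mball|move=> y].
rewrite ler_wpM2r//; apply: ind_sub; apply: sub_ball; rewrite metric_sym /rn.
by move: xz; set e := _^-1; lra.
Qed.

(* The doubling property yields the Lebesgue differentiation theorem only up to
   the factor 4b, which is harmless. *)
Lemma differentiation : exists b0 : R, 0 < b0 /\ forall b, b0 <= b ->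
  forall (u : X -> R) (a : R), ig mu u -> (forall x, 0 <= u x) -> 0 < a ->
  {ae mu, forall x, 4 * b * a < u x -> exists k,
    m mu (ball x (8 * sc k)) <= b * m mu (ball x (sc k)) /\
    a * m mu (ball x (sc k)) < J mu (fun y => \1_(ball x (sc k)) y * u y)}.
Proof.
have [b0 [b00 sd]] := small_doubling; exists b0; split => // b bb u a ui u0 a0.
have bp : 0 < b by exact: lt_le_trans bb.
have [N0 [mN0 N00 N0P]] := sd b bb.
pose Z n := [set x | [/\ ball (point : X) n%:R x, 4 * b * a < u x, ~ N0 x & forall k,
  m mu (ball x (8 * sc k)) <= b * m mu (ball x (sc k)) ->
  J mu (fun y => \1_(ball x (sc k)) y * u y) <= a * m mu (ball x (sc k))]].
suff Z0 n : mu.-negligible (Z n).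
  have [N1 [mN1 N10 N1P]] : mu.-negligible (N0 `|` \bigcup_n Z n).
    apply: negligibleU; first by exists N0; split.
    exact: negligible_bigcup.
  exists N1; split => // x xh; apply: N1P; have [?|xN] := pselect (N0 x); [by left|right].
  move/not_implyP: xh => [ux xk]; exists (Num.truncn (mdist point x)).+1 => //.
  split => //; first by rewrite in_ballE truncnS_gt.
  by move=> k h; rewrite leNgt; apply/negP => h'; apply: xk; exists k.
have Wi := ig_ind_ball mud (point : X) (n%:R + 8).
(* The measure of a small ball is rewritten as a ball integral of a fixed integrable function, so
   that [measurable_ball_integral] gives its measurability in the centre. *)
have mE x s : ball (point : X) n%:R x -> s <= 8 ->
    m mu (ball x s) = J mu (fun y => \1_(ball x s) y * \1_(ball (point : X) (n%:R + 8)) y).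
  rewrite in_ballE => nx s8; rewrite -J_ind_ball; apply: eq_J => y.
  have [xy|xy] := pselect (ball x s y); last by rewrite indF// mul0r.
  by rewrite !indT ?mulr1//; apply: sub_ball xy; lra.
have sc1 k : sc k <= 1 by rewrite invf_le1 ?exprn_gt0// exprn_ege1// ler1n.
have mZ : measurable (Z n).
  have -> : Z n = ball (point : X) n%:R `&` ~` [set x | u x <= 4 * b * a] `&` ~` N0 `&`
    \bigcap_k (~` [set x |
      J mu (fun y => \1_(ball x (8 * sc k)) y * \1_(ball (point : X) (n%:R + 8)) y) <=
      b * J mu (fun y => \1_(ball x (sc k)) y * \1_(ball (point : X) (n%:R + 8)) y)] `|`
     [set x | J mu (fun y => \1_(ball x (sc k)) y * u y) <=
      a * J mu (fun y => \1_(ball x (sc k)) y * \1_(ball (point : X) (n%:R + 8)) y)]).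
    have sk8 k : sc k <= 8 by rewrite (le_trans (sc1 k))// ler1n.
    have sk88 k : 8 * sc k <= 8 by rewrite ler_piMr.
    apply/seteqP; split => x /=.
      move=> [nx ux xN xk]; split; [split|]; [split => //|by []|].
        by apply/negP; rewrite -ltNge.
      move=> k _ /=; rewrite -!mE//.
      by have [h|h] := pselect (m mu (ball x (8 * sc k)) <= b * m mu (ball x (sc k)));
        [right; exact: xk|left].
    move=> [[[nx ux] xN] xk]; split => //; first by rewrite ltNge; apply/negP.
    by move=> k h; have /= := xk k I; rewrite -!mE// => -[|].
  have mb s : measurable_fun [set: X] (fun x =>
      J mu (fun y => \1_(ball x s) y * \1_(ball (point : X) (n%:R + 8)) y)).
    by apply: measurable_ball_integral => // x; exact: ind_ge0.
  apply: measurableI; last first.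
    apply: bigcapT_measurable => k; apply: measurableU; first apply: measurableC.
      by apply: measurable_le_fun => //; exact: measurable_funM.
    apply: measurable_le_fun; last exact: measurable_funM.
    exact: measurable_ball_integral.
  apply: measurableI; last exact: measurableC.
  apply: measurableI; first exact: mball.
  apply: measurableC; apply: measurable_le_fun => //; exact: ig_meas ui.
have Zb : Z n `<=` ball point n%:R by move=> x [].
have Zm := EFin_m mud mZ Zb.
suff m0 : m mu (Z n) <= 0.
  exists (Z n); split => //; rewrite -Zm; congr _%:E; apply/eqP.
  by rewrite eq_le m0 m_ge0.
apply/ler_addgt0Pr => e e0; rewrite add0r.
have [U [oU ZU Ue]] := measurable_outer_regular (mball (point : X) n%:R)
  (mu_ball_lty mud _ _) mZ e0.
pose U' := U `&` ball (point : X) n%:R.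
have oU' : open U' by apply: openI => //; exact: ball_openm.
have mU' := open_borel oU'.
have U'i : ig mu (\1_U' : X -> R) by apply: (ig_ind mud mU') => x [_ ?]; eassumption.
have Zi := ig_ind mud mZ Zb.
have U'm : m mu U' <= m mu (Z n) + e.
  rewrite -lee_fin EFinD (EFin_m mud mU' (@subIsetr _ _ _)) Zm.
  apply: (@le_trans _ _ (mu (Z n `|` (U `\` Z n) `&` ball (point : X) n%:R))).
    apply: le_measure; rewrite ?inE//.
      apply: measurableU => //; apply: measurableI; last exact: mball.
      by apply: measurableD => //; exact: open_borel.
    by move=> x [xU xn]; have [?|?] := pselect (Z n x); [left|right].
  apply: (@le_trans _ _ (mu (Z n) + mu ((U `\` Z n) `&` ball (point : X) n%:R))%E).
    apply: measureU2 => //; apply: measurableI; last exact: mball.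
    by apply: measurableD => //; exact: open_borel.
  by rewrite leeD2l// ltW.
(* With [hi] and outer regularity this gives 4ab m(Z) <= ab (m(Z) + e), hence 3 m(Z) <= e: the
   factor 4 only has to exceed 1. *)
have lo : 4 * b * a * m mu (Z n) <= J mu (fun x => \1_(Z n) x * u x).
  rewrite -(J_ind mu mZ) -JZ//; apply: J_le; [exact: igZ|exact: ig_restr|move=> x].
  have [xZ|xZ] := pselect (Z n x); last by rewrite indF// mulr0 mul0r.
  by rewrite indT// mulr1 mul1r ltW//; have [] := xZ.
have hi : J mu (fun x => \1_(Z n) x * u x) <= J mu (fun x => a * b * \1_U' x).
  apply: (vitali Xd).
  - exact: ig_restr.
  - exact: igZ.
  - by move=> x; rewrite mulr_ge0// ind_ge0.
  - by move=> x; rewrite !mulr_ge0 ?ind_ge0// ltW.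
  move=> x xZ0; have xZ : Z n x.
    by apply: contrapT => xZ; move: xZ0; rewrite indF// mul0r eqxx.
  have [nx ux xN xk] := xZ.
  have [e1 e10 xe1] := openP_metric oU' (conj (ZU x xZ) nx).
  have xd : forall k0, exists k, (k0 <= k)%N /\
      m mu (ball x (64 * sc k)) <= b * m mu (ball x (sc k)).
    by apply: contrapT => h; apply: xN; exact: N0P.
  (* The doubling factor is 64 because two enlargements by 8 are needed: the ball of radius [sc k]
     must contain the triple of the one of radius [sc k.+1], and be doubling itself for the failure
     of the mean at scale [k] to apply. *)
  have [k [k1 dk]] := xd (Num.truncn e1^-1).+1.
  have ske : sc k <= e1.
    rewrite -[leRHS]invrK lef_pV2 ?posrE ?invr_gt0 ?exprn_gt0//.
    rewrite (le_trans (ltW (truncnS_gt _)))// -natrX ler_nat.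
    by rewrite (leq_trans k1)// ltnW// ltn_expl.
  case: k k1 dk ske => [|k] // _ dk ske.
  have s8 : 64 * sc k.+1 = 8 * sc k by have := scS k; lra.
  exists (sc k.+1) => //.
  have d1 : m mu (ball x (8 * sc k)) <= b * m mu (ball x (sc k)).
    rewrite -s8 (le_trans dk)// ler_wpM2l ?(ltW bp)//; apply: (m_ball_le mud).
    by apply: le_ball; rewrite -(scS k) ler_peMl// ?ler1n// ltW.
  apply: (@le_trans _ _ (J mu (fun y => \1_(ball x (sc k)) y * u y))).
    apply: J_le; [by do 2 (apply: ig_restr => //; try exact: mball)|
      by apply: ig_restr => //; exact: mball|move=> y].
    rewrite mulrA ler_wpM2r//; apply: (@le_trans _ _ (\1_(ball x (3 * sc k.+1)) y)).
      by rewrite ler_piMr ?ind_le1 ?ind_ge0.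
    by apply: ind_sub; apply: le_ball; rewrite -(scS k) ler_wpM2r ?ler_nat// ltW.
  apply: (le_trans (xk k d1)).
  have -> : J mu (fun y => \1_(ball x (sc k.+1)) y * (a * b * \1_U' y)) =
      a * (b * m mu (ball x (sc k.+1))).
    rewrite mulrA -J_ind_ball -JZ; last exact: ig_ind_ball mud _ _.
    apply: eq_J => y; have [xy|xy] := pselect (ball x (sc k.+1) y); last first.
      by rewrite indF// mul0r mulr0.
    by rewrite !indT//; [ring|apply: xe1; exact: le_ball xy].
  rewrite ler_wpM2l ?(ltW a0)// (le_trans _ dk)//; apply: (m_ball_le mud).
  by apply: le_ball; rewrite s8 ler_peMl ?ler1n// ltW.
have {}hi : 4 * b * a * m mu (Z n) <= a * b * (m mu (Z n) + e).
  apply: (le_trans lo); apply: (le_trans hi).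
  rewrite JZ// (J_ind mu mU') ler_wpM2l// mulr_ge0// ltW//.
have ab : 0 < a * b by rewrite mulr_gt0.
have : 4 * m mu (Z n) <= m mu (Z n) + e.
  rewrite -(ler_pM2l ab); apply: le_trans hi.
  by rewrite le_eqVlt; apply/orP; left; apply/eqP; ring.
by have := m_ge0 mu (Z n); lra.
Qed.

End Doubling.

(** * Exponential decay *)

Section Stopping.
Context (R : realType) (d : measure_display) (X : metricBorelType R d).
Context (mu : {measure set X -> \bar R}) (lam : X -> R -> R).
Hypothesis mud : upper_doubling mu lam.
Implicit Types (x y z : X) (r s b : R).

Let lam_gt0 x r : 0 < r -> 0 < lam x r.
Proof. by case: mud => h _ _ _ _; exact: h. Qed.

Let lam_nd x r s : 0 < r -> r <= s -> lam x r <= lam x s.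
Proof. by case: mud => _ h _ _ _; exact: h. Qed.

Definition doubling_ball b x r := m mu (ball x (8 * r)) <= b * m mu (ball x r).

Variables (L b : R).
Hypotheses (L0 : 0 < L) (bL : 2 * L <= b).
Hypothesis lamL : forall x r, 0 < r -> lam x (8 * r) <= L * lam x r.

Let b0 : 0 < b. Proof. by have := L0; have := bL; lra. Qed.

(** The first shell is bounded by its measure times the largest value of the integrand. *)
Lemma kann_step x s r' : 0 < s ->
  J mu (kann lam x s r') <= m mu (ball x (8 * s)) / lam x s + J mu (kann lam x (8 * s) r').
Proof.
move=> s0; have s8 : 0 < 8 * s by rewrite mulr_gt0.
have E : J mu (fun y => (lam x s)^-1 * \1_(ball x (8 * s)) y) =
    m mu (ball x (8 * s)) / lam x s.
  by rewrite JZ ?J_ind_ball 1?mulrC//; exact: (ig_ind_ball mud).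
rewrite -E -JD; [|by apply: igZ; exact: (ig_ind_ball mud)|exact: (ig_kann mud)].
apply: J_le; [exact: (ig_kann mud)| |move=> y].
  by apply: igD; [apply: igZ; exact: (ig_ind_ball mud)|exact: (ig_kann mud)].
have li : 0 <= (lam x s)^-1 by rewrite invr_ge0 ltW// lam_gt0.
have [xy|xy] := ltP (mdist x y) (8 * s).
  rewrite (@indT _ _ (ball x (8 * s)) y) ?in_ballE// mulr1.
  apply: (@le_trans _ _ (lam x s)^-1); last by rewrite lerDl (kann_ge0 mud).
  rewrite /kann; have [/= /andP[sy sy']|h] := pselect ([set y | s <= mdist y x <= r'] y).
    rewrite indT ?mul1r; last by apply/andP.
    by rewrite lef_pV2 ?posrE ?lam_gt0 ?(lt_le_trans s0)// lam_nd.
  by rewrite indF// mul0r.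
rewrite indF ?mulr0 ?add0r; last by rewrite in_ballE; apply/negP; rewrite -leNgt.
have [/andP[p q]|h] := pselect ([set y | s <= mdist y x <= r'] y); last first.
  by rewrite {1}/kann (indF h) mul0r (kann_ge0 mud).
rewrite /kann !indT//; apply/andP => //; split => //.
by rewrite metric_sym.
Qed.

(* Between consecutive doubling balls the measure grows faster than lam, so
   that the annuli contribute a geometric series. *)
Lemma kann_nondoubling i x s : 0 < s ->
  (forall j, (0 < j < i)%N -> ~ doubling_ball b x (8 ^+ j * s)) ->
  ((0 < i)%N -> m mu (ball x (8 * s)) <= 2^-1 ^+ i.-1 * lam x (8 * s)) /\
  J mu (kann lam x s (8 ^+ i * s)) <= L * (3 - 2 * 2^-1 ^+ i).
Proof.
elim: i s => [|i IH] s s0 nd.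
  split => //; rewrite expr0 mul1r mulr1 (le_trans (kann_step _ _ s0))//.
  have -> : J mu (kann lam x (8 * s) s) = 0.
    rewrite -[RHS](J0 mu); apply: eq_J => y; rewrite /kann indF ?mul0r//=.
    by move=> /andP[p /(le_trans p)]; have := s0; lra.
  rewrite addr0 (_ : 3 - 2 = 1); last by ring.
  rewrite mulr1 ler_pdivrMr ?lam_gt0// (le_trans _ (lamL _ s0))//.
  by apply: (m_ball_lam mud); rewrite mulr_gt0.
have s8 : 0 < 8 * s by rewrite mulr_gt0.
have [|IH1 IH2] := IH (8 * s) s8.
  by move=> j /andP[j0 ji]; rewrite mulrA -exprSr; apply: nd; exact: ji.
(* The induction moves from the largest ball inwards: passing to a nondoubling ball divides the
   measure by more than [b >= 2 * L], whereas [lam] loses at most the factor [L]. *)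
have m8 : m mu (ball x (8 * s)) <= 2^-1 ^+ i * lam x (8 * s).
  case: i IH nd IH1 IH2 => [|i] _ nd IH1 _.
    by rewrite expr0 mul1r; exact: (m_ball_lam mud).
  have := nd 1%N isT; rewrite expr1 /doubling_ball => /negP; rewrite -ltNge => h.
  have := IH1 isT => /= h1; rewrite -(ler_pM2l b0) (le_trans (ltW h))//.
  apply: (le_trans h1); apply: (@le_trans _ _ (2^-1 ^+ i * (L * lam x (8 * s)))).
    by rewrite ler_wpM2l ?exprn_ge0// lamL.
  have -> : b * (2^-1 ^+ i.+1 * lam x (8 * s)) = 2^-1 ^+ i * (b / 2 * lam x (8 * s)).
    by rewrite exprS; ring.
  rewrite ler_wpM2l ?exprn_ge0// ler_wpM2r ?(ltW (lam_gt0 x s8))//.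
  by have := bL; lra.
split => //; rewrite (le_trans (kann_step _ _ s0))// exprSr -mulrA.
have m8' : m mu (ball x (8 * s)) / lam x s <= L * 2^-1 ^+ i.
  rewrite ler_pdivrMr ?lam_gt0// (le_trans m8)// (mulrC L) -mulrA ler_wpM2l ?exprn_ge0//.
  exact: lamL.
(* [3 - 2 * 2^-1 ^+ i] is 1 for [i = 0] and increases by [2^-1 ^+ i] at each step, the contribution
   of the new shell. *)
rewrite (le_trans (lerD m8' IH2))// exprS.
by rewrite le_eqVlt; apply/orP; left; apply/eqP; field.
Qed.

(** Without a doubling ball, [kann_nondoubling] would bound 2^i mu(8B) by one value of [lam] for
    every [i], against the positivity of the measure. *)
Lemma next_doubling x r : 0 < r -> 0 < m mu (ball x r) -> exists i,
  [/\ (0 < i)%N, doubling_ball b x (8 ^+ i * r) &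
    forall j, (0 < j < i)%N -> ~ doubling_ball b x (8 ^+ j * r)].
Proof.
move=> r0 mr; pose P i := (0 < i)%N && `[<doubling_ball b x (8 ^+ i * r)>].
have [exP|noP] := pselect (exists i, P i).
  case: (ex_minnP exP) => i /andP[i0 /asboolP di] imin; exists i; split => // j /andP[j0 ji] dj.
  have /imin : P j by rewrite /P j0; apply/asboolP.
  by rewrite leqNgt ji.
exfalso; pose l := m mu (ball x (8 * r)).
have l0 : 0 < l.
  apply: (lt_le_trans mr); apply: (m_ball_le mud); apply: le_ball.
  by rewrite ler_peMl ?ler1n// ltW.
have r8 : 0 < 8 * r by rewrite mulr_gt0.
have grow i : 2 ^+ i * l <= lam x (8 * r).
  have [|h _] := @kann_nondoubling i.+1 x r r0.
    by move=> j /andP[j0 _] dj; apply: noP; exists j; rewrite /P j0; apply/asboolP.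
  by have := h isT; rewrite /= exprVn -ler_pdivrMl ?invr_gt0 ?exprn_gt0// invrK.
have := grow (Num.truncn (lam x (8 * r) / l)).+1; rewrite -ler_pdivlMr// leNgt => /negP; apply.
by rewrite (lt_trans (truncnS_gt _))// -natrX ltr_nat ltn_expl.
Qed.

(* The last doubling ball with a large mean, followed by the next doubling
   ball, whose mean is small. *)
Lemma stopping (u : X -> R) (a : R) x r0 s : ig mu u -> (forall y, 0 <= u y) -> 0 < a ->
  0 < r0 -> doubling_ball b x r0 ->
  a * m mu (ball x r0) < J mu (fun y => \1_(ball x r0) y * u y) ->
  J mu u <= a * m mu (ball x s) ->
  exists r i, [/\ 0 < r, 0 < m mu (ball x r), doubling_ball b x r &
    a * m mu (ball x r) < J mu (fun y => \1_(ball x r) y * u y)] /\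
    [/\ (0 < i)%N, doubling_ball b x (8 ^+ i * r),
     J mu (fun y => \1_(ball x (8 ^+ i * r)) y * u y) <= a * m mu (ball x (8 ^+ i * r)) &
     J mu (kann lam x r (8 ^+ i * r)) <= 3 * L].
Proof.
move=> ui u0 a0 r00 dr ar us.
pose Q r := doubling_ball b x r /\
  a * m mu (ball x r) < J mu (fun y => \1_(ball x r) y * u y).
pose P n := `[<Q (8 ^+ n * r0)>].
have exP : exists n, P n by exists 0%N; apply/asboolP; rewrite expr0 mul1r.
(* A ball of radius at least [s] has a small mean, as the total integral is at most
   [a * m mu (ball x s)]; this bounds the search for the last large mean. *)
have bP n : P n -> (n <= Num.truncn (s / r0))%N.
  move=> /asboolP[_ h]; rewrite leqNgt; apply/negP => n1; move: h; apply/negP; rewrite -leNgt.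
  apply: (@le_trans _ _ (J mu u)).
    apply: J_le => // [|y]; first by apply: ig_restr => //; exact: mball.
    by rewrite ler_piMl// ind_le1.
  rewrite (le_trans us)// ler_wpM2l ?(ltW a0)//; apply: (m_ball_le mud); apply: le_ball.
  rewrite -ler_pdivrMr// (le_trans (ltW (truncnS_gt _)))// -natrX ler_nat.
  by rewrite (leq_trans n1)// ltnW// ltn_expl.
case: (ex_maxnP exP bP) => n /asboolP[dn an] nmax.
pose r := 8 ^+ n * r0; have rp : 0 < r by rewrite mulr_gt0// exprn_gt0.
have mr : 0 < m mu (ball x r).
  rewrite lt_neqAle m_ge0 andbT eq_sym; apply/eqP => mr0.
  move: an; rewrite -/r mr0 mulr0 => /lt_eqF/negP; apply; apply/eqP.
  have i1 := ig_ind_ball mud x r.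
  have := J_eq0_ae i1 (fun y => ind_ge0 _ y); rewrite J_ind_ball => /(_ mr0) h.
  rewrite -[LHS](J0 mu); apply: eq_J_ae; first exact: ig0.
    by apply: ig_restr => //; exact: mball.
  by apply: filterS h => y ->; rewrite mul0r.
have [i [i0 di ndi]] := next_doubling rp mr.
exists r, i; split; split => //.
(* A large mean on the next doubling ball would contradict the maximality of [n], since [i > 0]. *)
- rewrite leNgt; apply/negP => h.
  have /nmax : P (i + n)%N by apply/asboolP; rewrite exprD -mulrA.
  by rewrite -[X in (_ <= X)%N]add0n leq_add2r leqNgt i0.
- have [_ h] := kann_nondoubling rp ndi.
  by rewrite (le_trans h)// mulrC ler_wpM2r ?(ltW L0)// gerBl mulr_ge0 ?exprn_ge0.
Qed.

End Stopping.

Lemma lt_sqr_succ (R : realDomainType) (w v : R) : 0 < w -> w + 1 <= v -> w < v ^+ 2.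
Proof. by move=> w0 wv; nra. Qed.

Lemma large_near_part (R : realDomainType) (t v M1 M2 u w z : R) : 0 <= v ->
  t + (M1 + M2 + (v + 1)) < `|u + w| -> `|w - z| <= M2 -> `|z| <= M1 -> t < `|u|.
Proof.
move=> v0 h1 h2 h3; have h4 := ler_normD u w.
have h5 : `|w| <= `|w - z| + `|z| by rewrite -[in leLHS](subrK z w) ler_normD.
by lra.
Qed.

Section Decay.
Context (R : realType) (d : measure_display) (X : metricBorelType R d).
Context (mu : {measure set X -> \bar R}) (lam : X -> R -> R).
Hypotheses (mud : upper_doubling mu lam) (Xd : geometrically_doubling X).
Implicit Types (x y z : X) (r s t : R) (f g h : X -> R).
Variables (K : X -> X -> R) (T : (X -> R) -> X -> R) (C0 C c delta : R).
Hypothesis TK : CZO mu lam T K C0 C c delta.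

Definition level t g : set X := [set x | t < `|g x|].

Lemma measurable_level t g : measurable_fun [set: X] g -> measurable (level t g).
Proof.
move=> mg; have -> : level t g = ~` [set x | `|g x| <= t].
  by apply/seteqP; split => x /=; rewrite /level /= ltNge => /negP.
by apply: measurableC; exact: measurable_le_cst.
Qed.

Lemma level_chebyshev t h : 0 < t -> bb h ->
  ig mu (\1_(level t (T h)) : X -> R) /\
  J mu (\1_(level t (T h)) : X -> R) <= C0 * t ^- 2 * J mu (fun x => h x ^+ 2).
Proof.
move=> t0 bh; have mT := cz_meas TK bh; have iT := cz_ig TK bh.
have iZ := igZ (t ^- 2) iT.
have bnd x : \1_(level t (T h)) x <= t ^- 2 * T h x ^+ 2.
  have [/= tx|tx] := pselect (level t (T h) x).
    rewrite indT// mulrC ler_pdivlMr ?exprn_gt0// mul1r -[leRHS]real_normK ?num_real//.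
    by rewrite lerXn2r ?nnegrE ?(ltW t0)// ltW.
  by rewrite indF// mulr_ge0 ?sqr_ge0// invr_ge0 exprn_ge0// ltW.
have iE : ig mu (\1_(level t (T h)) : X -> R).
  apply: ig_le iZ => [|x]; first by apply: measurable_indic; exact: measurable_level.
  by rewrite ger0_norm ?ind_ge0.
split => //; apply: (le_trans (J_le iE iZ bnd)); rewrite JZ// mulrAC mulrC.
by rewrite ler_wpM2r ?(cz_L2 TK bh)// invr_ge0 exprn_ge0// ltW.
Qed.

Definition decay t phi := forall h, bb h -> (forall x, `|h x| <= 1) ->
  J mu (\1_(level t (T h)) : X -> R) <= phi * J mu (fun x => h x ^+ 2).

(** On the next doubling ball P the mean of |Th|^2 is at most [a] and the mean oscillation at most
    [D3 * b], so its centre value is bounded. Going back to the triple of the first ball costs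
    [D2 * (1 + 3 * |L|)], since no doubling ball lies in between. *)
Lemma bounded_center (L b a : R) : 0 < b -> 0 < a -> exists M : R, 0 < M /\
  forall h, bb h -> (forall x, `|h x| <= 1) -> forall x r i, 0 < r ->
  0 < m mu (ball x r) -> (0 < i)%N -> doubling_ball mu b x (8 ^+ i * r) ->
  J mu (fun y => \1_(ball x (8 ^+ i * r)) y * T h y ^+ 2) <= a * m mu (ball x (8 ^+ i * r)) ->
  J mu (kann lam x r (8 ^+ i * r)) <= 3 * L ->
  `|center_value mu K 2 h x (3 * r)| <= M.
Proof.
move=> b0 a0.
have a2 : 1 < 2 :> R by rewrite ltr1n.
have [D2 [D20 D2P]] := rbmo_chain mud TK a2.
have [D3 [D30 D3P]] := rbmo_mean mud TK a2.
exists (D2 * (1 + 3 * `|L|) + (a + 1 + D3 * b)); split.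
  have p1 := mulr_gt0 D30 b0; have p2 : 0 <= D2 * (1 + 3 * `|L|).
    by rewrite mulr_ge0 ?(ltW D20)// addr_ge0// mulr_ge0.
  by lra.
move=> h bh h1 x r i r0 mr i0 di ai ki.
set rP := 8 ^+ i * r in di ai ki *.
have i8 : 8 <= 8 ^+ i :> R by rewrite -[leLHS]expr1 ler_weXn2l// ler1n.
have r8 : 8 * r <= rP by rewrite ler_wpM2r// ltW.
have rP0 : 0 < rP by apply: lt_le_trans r8; rewrite mulr_gt0.
have r30 : 0 < 3 * r by rewrite mulr_gt0.
have sP : ball x (3 * r) `<=` ball x rP by apply: le_ball; lra.
have mP : 0 < m mu (ball x rP).
  by apply: (lt_le_trans mr); apply: (m_ball_le mud); apply: le_ball; lra.
have ck := D2P h bh h1 x (3 * r) x rP r30 rP0 sP.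
have k3 : J mu (kann lam x (3 * r) rP) <= 3 * `|L|.
  apply: (@le_trans _ _ (3 * L)); last by rewrite ler_wpM2l// ler_norm.
  apply: le_trans ki; apply: J_le; [exact: ig_kann|exact: ig_kann|move=> y].
  have [/andP[p q]|nh] := pselect ([set y | 3 * r <= mdist y x <= rP] y).
    rewrite /kann !indT//; apply/andP; split => //; rewrite (le_trans _ p)//; lra.
  by rewrite {1}/kann (indF nh) mul0r (kann_ge0 mud).
have [iO O] := D3P h bh h1 x rP rP0.
set cP := center_value mu K 2 h x rP in ck iO O.
have mT := cz_meas TK bh; have iT := cz_ig TK bh.
have iP := ig_ind_ball mud x rP.
have iT2 : ig mu (fun y => \1_(ball x rP) y * T h y ^+ 2).
  by apply: ig_restr => //; exact: mball.
have cPb : `|cP| <= a + 1 + D3 * b.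
  rewrite -(ler_pM2r mP).
  have -> : `|cP| * m mu (ball x rP) = J mu (fun y => `|cP| * \1_(ball x rP) y).
    by rewrite JZ// J_ind_ball.
  apply: (@le_trans _ _ (J mu (fun y => \1_(ball x rP) y * T h y ^+ 2 + \1_(ball x rP) y +
      \1_(ball x rP) y * `|T h y - cP|))).
    apply: J_le; [exact: igZ|by apply: igD => //; exact: igD|move=> y].
    have [xy|xy] := pselect (ball x rP y); last by rewrite indF// mulr0 !mul0r !addr0.
    rewrite indT// !mul1r mulr1.
    have h2 : `|T h y| <= T h y ^+ 2 + 1.
      rewrite -[_ ^+ 2]real_normK ?num_real//; set w := `|_|; nra.
    have : `|cP| <= `|T h y| + `|T h y - cP|.
      by rewrite distrC -[in leLHS](subrK (T h y) cP) addrC ler_normD.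
    by move: h2; lra.
  rewrite JD ?JD ?J_ind_ball//; last exact: igD.
  rewrite mulrDl mulrDl mul1r; apply: lerD; first by rewrite lerD2r.
  rewrite (le_trans O)// -mulrA ler_wpM2l ?(ltW D30)// (le_trans _ di)//.
  by apply: (m_ball_le mud); apply: le_ball; lra.
have : `|center_value mu K 2 h x (3 * r)| <=
    `|center_value mu K 2 h x (3 * r) - cP| + `|cP|.
  by rewrite -[in leLHS](subrK cP (center_value _ _ _ _ _ _)) ler_normD.
move=> /le_trans; apply; apply: lerD => //.
by rewrite (le_trans ck)// ler_wpM2l ?(ltW D20)// lerD2l.
Qed.

(** Raising the level by [M] confines the level set to triples of balls on which |Th|^2 has a mean
    above [a]. There the near part of [h] must exceed [t], and the hypothesis at level [t] applies
    to that near part. *)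
Lemma decay_step : exists M : R, 0 < M /\ forall t phi, 0 < t -> 0 <= phi ->
  decay t phi -> decay (t + M) (phi / 4).
Proof.
have C00 := cz_C0 TK.
have [L [L0 LP]] := lam_scale mud 8.
have lamL x r : 0 < r -> lam x (8 * r) <= L * lam x r by move=> r0; exact: LP.
have [b0 [b00 b0P]] := differentiation mud Xd.
pose b := b0 + 2 * L + 1.
have bb0 : b0 <= b by rewrite /b; lra.
have bL : 2 * L <= b by rewrite /b; lra.
have b1 : 1 <= b by rewrite /b; lra.
have bp : 0 < b by lra.
(* The factor [b] is lost by the doubling ball, [C0] by the L^2 bound on [u]; what remains of
   [phi * b / a * C0] is [phi / 4]. *)
pose a := 4 * b * C0; have a0 : 0 < a by rewrite !mulr_gt0.
have aC : C0 <= a by rewrite /a ler_peMl ?(ltW C00)//; lra.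
have [M1 [M10 M1P]] := bounded_center L bp a0.
have a2 : 1 < 2 :> R by rewrite ltr1n.
have [D1 [D10 D1P]] := far_oscillation mud TK a2.
(* [M1 + D1] absorbs the far part of [T h] on the triple ball; the last term makes |Th|^2 exceed
   [4 * b * a] on the level set, as [differentiation] demands. *)
pose M := M1 + D1 + (4 * b * a + 1).
have ba0 : 0 < 4 * b * a by rewrite !mulr_gt0.
exists M; split; first by rewrite /M; lra.
move=> t phi t0 phi0 dec h bh h1.
have mT := cz_meas TK bh; have iT := cz_ig TK bh; have T2 := cz_L2 TK bh.
pose u x := T h x ^+ 2.
have u0 x : 0 <= u x by exact: sqr_ge0.
have [N1 [mN1 N10 N1P]] := b0P b bb0 u a iT u0 a0.
have tM0 : 0 < t + M by rewrite /M; lra.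
have [iE _] := level_chebyshev tM0 bh.
have mE : measurable (level (t + M) (T h)) by exact: measurable_level.
have bh2 : ig mu (fun x => h x ^+ 2) by exact: (bb_L2 mud bh).
pose E := level (t + M) (T h) `\` N1.
have mE' : measurable E by exact: measurableD.
have iE' : ig mu (\1_E : X -> R).
  apply: ig_le iE => [|x]; first exact: measurable_indic.
  by rewrite ger0_norm ?ind_ge0// ind_sub// => y [].
have -> : J mu (\1_(level (t + M) (T h)) : X -> R) = J mu (\1_E : X -> R).
  apply: eq_J_ae => //; exists N1; split => // x /= h2; apply: contrapT => xN; apply: h2.
  have [xE|xE] := pselect (level (t + M) (T h) x).
    by rewrite !indT//; split.
  by rewrite !indF// => -[].
have [rho [M0 [rho0 _ hM]]] := bbP bh.
have hb x : h x ^+ 2 <= \1_(ball point rho) x.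
  have [px|px] := pselect (ball point rho x).
    by rewrite indT// -real_normK ?num_real// expr_le1.
  by have := hM x; rewrite indF// mulr0 normr_le0 => /eqP ->; rewrite expr0n.
have Ju x : J mu u <= a * m mu (ball x (mdist x point + rho)).
  apply: (le_trans T2); apply: (@le_trans _ _ (C0 * m mu (ball point rho))).
    rewrite ler_wpM2l ?(ltW C00)// -J_ind_ball; apply: J_le => //.
    exact: (ig_ind_ball mud).
  apply: ler_pM => //; [exact: ltW|exact: m_ge0|].
  by apply: (m_ball_le mud); apply: sub_ball.
apply: (@le_trans _ _ (J mu (fun x => phi * b / a * u x))); last first.
  rewrite JZ//; apply: (@le_trans _ _ (phi * b / a * (C0 * J mu (fun x => h x ^+ 2)))).
    by rewrite ler_wpM2l// divr_ge0 ?mulr_ge0// ltW.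
  rewrite le_eqVlt; apply/orP; left; apply/eqP; rewrite /a; field.
  by rewrite !gt_eqF.
(* The covering lemma compares the indicator of the level set with the density [phi * b / a * u]. *)
apply: (vitali Xd) => //.
- exact: igZ.
- by move=> x; rewrite mulr_ge0// divr_ge0 ?mulr_ge0// ltW.
move=> x xE0; have [xE xN] : E x.
  by apply: contrapT => xE; move: xE0; rewrite indF// eqxx.
have ux : 4 * b * a < u x.
  have M1' : 4 * b * a + 1 <= `|T h x| by move: xE; rewrite /level /= /M; lra.
  rewrite /u -real_normK ?num_real//; exact: lt_sqr_succ ba0 M1'.
have [k [dk ak]] : exists k, m mu (ball x (8 * (8 ^+ k)^-1)) <= b * m mu (ball x (8 ^+ k)^-1) /\
    a * m mu (ball x (8 ^+ k)^-1) < J mu (fun y => \1_(ball x (8 ^+ k)^-1) y * u y).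
  by apply: contrapT => nk; apply: xN; apply: N1P => /(_ ux).
have sk0 : 0 < (8 ^+ k)^-1 :> R by rewrite invr_gt0 exprn_gt0.
have [r [i [[r0 mr dr ar] [i0 di ai ki]]]] :=
  stopping mud L0 bL lamL iT u0 a0 sk0 dk ak (Ju x).
have cM := M1P h bh h1 x r i r0 mr i0 di ai ki.
exists r => //.
have r30 : 0 < 3 * r by rewrite mulr_gt0.
(* The near part for the triple ball. Its support, of radius 6r, lies in the ball of radius 8r,
   whose measure the doubling property bounds. *)
pose n y := \1_(ball x (2 * (3 * r))) y * h y.
have bn : bb n by apply: bb_ind => //; exact: mball.
have n1 y : `|n y| <= 1.
  by rewrite normrM ger0_norm ?ind_ge0// mulr_ile1 ?ind_ge0 ?ind_le1.
have [iL _] := level_chebyshev t0 bn.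
apply: (@le_trans _ _ (J mu (\1_(level t (T n)) : X -> R))).
  apply: J_le_ae => //; first by apply: ig_restr => //; exact: mball.
  have := near_far TK 2 x bh r30; apply: filterS => y ny.
  have [xy|xy] := pselect (ball x (3 * r) y); last by rewrite indF// mul0r ind_ge0.
  have [yE|yE] := pselect (E y); last by rewrite (indF yE) mulr0 ind_ge0.
  have [_ fy] := D1P h bh h1 x (3 * r) y r30 xy.
  rewrite (indT xy) (indT yE) mulr1 indT//.
  have {}ny := ny (le_ball (_ : 3 * r <= 2 * (3 * r)) xy).
  move: yE => [+ _]; rewrite /level /= ny; last by rewrite ler_peMl ?ler1n// ltW.
  set Fy := J mu _ in fy *; rewrite -/n => tM.
  exact: (large_near_part (ltW ba0) tM fy cM).
apply: (le_trans (dec n bn n1)).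
apply: (@le_trans _ _ (phi * (b * m mu (ball x r)))).
  rewrite ler_wpM2l// (le_trans _ dr)// -J_ind_ball; apply: J_le.
  - exact: (bb_L2 mud bn).
  - exact: (ig_ind_ball mud).
  - move=> y; have [xy|xy] := pselect (ball x (8 * r) y).
      by rewrite indT// -real_normK ?num_real// expr_le1.
    rewrite /n indF ?mul0r ?expr0n ?ind_ge0// => h2; apply: xy; apply: le_ball h2.
    by rewrite mulrA -natrM ler_wpM2r ?ler_nat// ltW.
have -> : J mu (fun y => \1_(ball x r) y * (phi * b / a * u y)) =
    phi * b / a * J mu (fun y => \1_(ball x r) y * u y).
  rewrite -JZ; first by apply: eq_J => y; ring.
  by apply: ig_restr => //; exact: mball.
apply: (@le_trans _ _ (phi * b / a * (a * m mu (ball x r)))).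
  by rewrite le_eqVlt; apply/orP; left; apply/eqP; field; rewrite gt_eqF.
by rewrite ler_wpM2l ?(ltW ar)// divr_ge0 ?mulr_ge0// ltW.
Qed.

End Decay.

Lemma bin_le_exp2 (n k : nat) : ('C(n, k) <= 2 ^ n)%N.
Proof.
elim: n k => [|n IH] [|k]; rewrite ?bin0 ?expn_gt0//.
by rewrite binS expnS mul2n -addnn leq_add.
Qed.

(** The power is at most the falling factorial of [n + N] of length [N], which is [N!] times a
    binomial coefficient. *)
Lemma poly_le_exp2 (N n : nat) : (n.+1 ^ N <= N`! * 2 ^ N * 2 ^ n)%N.
Proof.
apply: (@leq_trans ((n + N) ^_ N)).
  elim: N => [//|N IH]; rewrite expnS addnS ffactSS leq_mul//.
  by rewrite ltnS leq_addr.
by rewrite -bin_ffact mulnC -mulnA leq_mul2l -expnD addnC bin_le_exp2 orbT.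
Qed.

Lemma geometric_sum (R : realFieldType) (q : R) n : 0 <= q -> q < 1 ->
  \sum_(i < n) q ^+ i <= (1 - q)^-1.
Proof.
move=> q0 q1; have q1' : 0 < 1 - q by rewrite subr_gt0.
rewrite -[leRHS]mul1r ler_pdivlMr// mulrC -opprB mulNr -subrX1 opprB gerBl.
by rewrite exprn_ge0.
Qed.

(** * Integer moments of T f *)

Section Moments.
Context (R : realType) (d : measure_display) (X : metricBorelType R d).
Context (mu : {measure set X -> \bar R}) (lam : X -> R -> R).
Hypotheses (mud : upper_doubling mu lam) (Xd : geometrically_doubling X).
Implicit Types (x y z : X) (r s t : R) (f g h : X -> R).
Variables (K : X -> X -> R) (T : (X -> R) -> X -> R) (C0 C c delta : R).
Hypothesis TK : CZO mu lam T K C0 C c delta.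

Lemma exponential_decay : exists M : R, 0 < M /\
  forall n : nat, decay mu T (1 + n%:R * M) (C0 * 4^-1 ^+ n).
Proof.
have [M [M0 MP]] := decay_step mud Xd TK; exists M; split => //; elim => [|n IH].
  rewrite mul0r addr0 expr0 mulr1 => h bh h1.
  by have [_] := level_chebyshev TK ltr01 bh; rewrite expr1n invr1 mulr1.
rewrite -natr1 mulrDl mul1r addrA exprSr mulrA; apply: MP => //.
- by rewrite ltr_pwDl// mulr_ge0// ltW.
- by rewrite mulr_ge0 ?exprn_ge0// ltW// (cz_C0 TK).
Qed.

(** Summation over the levels [1 + n * M]: below level 1 the power is at most |Tf|^2, and between
    levels [n] and [n + 1] it is at most [a n]. As [a n <= A * 2 ^+ n] and the level sets decay like
    4^-n, a geometric series of ratio 1/2 remains. *)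
Lemma moment_bound1 (N : nat) : exists B : R, 0 < B /\ forall f, bb f ->
  (forall x, `|f x| <= 1) -> ig mu (fun x => `|T f x| ^+ N.+2) /\
  J mu (fun x => `|T f x| ^+ N.+2) <= B * J mu (fun x => f x ^+ 2).
Proof.
have C00 := cz_C0 TK.
have [M [M0 MP]] := exponential_decay.
pose a (n : nat) : R := (1 + n.+1%:R * M) ^+ N.+2.
pose A : R := (1 + M) ^+ N.+2 * ((N.+2)`! * 2 ^ N.+2)%:R.
have a0 n : 0 <= a n by rewrite exprn_ge0// addr_ge0// mulr_ge0// ltW.
have aA n : a n <= A * 2 ^+ n.
  apply: (@le_trans _ _ (((1 + M) * n.+1%:R) ^+ N.+2)).
    rewrite lerXn2r ?nnegrE//; [|by rewrite mulr_ge0// addr_ge0// ltW|].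
      by rewrite addr_ge0// mulr_ge0// ltW.
    by rewrite mulrDl mul1r mulrC lerD2r ler1n.
  rewrite exprMn /A -mulrA ler_wpM2l ?exprn_ge0 ?addr_ge0 ?(ltW M0)//.
  by rewrite -!natrX -natrM ler_nat poly_le_exp2.
have A0 : 0 <= A by rewrite mulr_ge0// exprn_ge0// addr_ge0// ltW.
exists (C0 * (1 + 2 * A)); split.
  by rewrite mulr_gt0// ltr_pwDl// mulr_ge0.
move=> f bf f1; have mT := cz_meas TK bf; have iT := cz_ig TK bf.
have fT n := MP n f bf f1.
have lp (n : nat) : 0 < 1 + n%:R * M by rewrite ltr_pwDl// mulr_ge0// ltW.
have il n := (level_chebyshev TK (lp n) bf).1.
have mF : measurable_fun [set: X] (fun x => `|T f x| ^+ N.+2).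
  by apply: measurable_funX; exact: measurableT_comp.
have mS n : measurable [set x | `|T f x| <= 1 + n%:R * M] by exact: measurable_le_cst.
pose G n x := T f x ^+ 2 + \sum_(i < n) a i * \1_(level (1 + i%:R * M) (T f)) x.
have Gi n : ig mu (G n).
  by apply: igD => //; apply: ig_sum => i _; exact: igZ.
have FG n x : `|\1_[set x | `|T f x| <= 1 + n%:R * M] x * `|T f x| ^+ N.+2| <= G n x.
  have s0 k : 0 <= \sum_(i < k) a i * \1_(level (1 + i%:R * M) (T f)) x.
    by apply: sumr_ge0 => i _; rewrite mulr_ge0 ?ind_ge0.
  rewrite ger0_norm; last by apply: mulr_ge0; [exact: ind_ge0|exact: exprn_ge0].
  have [/= h|h] := pselect ([set x | `|T f x| <= 1 + n%:R * M] x); last first.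
    by rewrite indF// mul0r addr_ge0 ?sqr_ge0.
  rewrite indT// mul1r /G; elim: n h => [|n IH] h.
    rewrite mul0r addr0 in h; rewrite big_ord0 addr0 -(real_normK (num_real (T f x))).
    by rewrite ler_wiXn2l.
  have [/IH|h2] := leP `|T f x| (1 + n%:R * M).
    rewrite big_ord_recr /= addrA => /le_trans; apply.
    by rewrite lerDl mulr_ge0 ?ind_ge0.
  rewrite big_ord_recr /= (@indT _ _ (level _ _))// mulr1.
  apply: (@le_trans _ _ (a n)); last by
    rewrite addrA lerDr; apply: addr_ge0; [exact: sqr_ge0|exact: s0].
  by rewrite /a lerXn2r ?nnegrE// addr_ge0// mulr_ge0// ltW.
have f20 : 0 <= J mu (fun x => f x ^+ 2) by apply: J_ge0 => x; exact: sqr_ge0.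
have JG n : J mu (G n) <= C0 * (1 + 2 * A) * J mu (fun x => f x ^+ 2).
  rewrite /G JD//; last by apply: ig_sum => i _; exact: igZ.
  rewrite J_sum; last by move=> i _; exact: igZ.
  rewrite mulrDr mulr1 mulrDl; apply: lerD; first exact: cz_L2 TK _ bf.
  apply: (@le_trans _ _ (\sum_(i < n) A * C0 * J mu (fun x => f x ^+ 2) * 2^-1 ^+ i)).
    apply: ler_sum => i _; rewrite JZ//.
    apply: (@le_trans _ _ (A * 2 ^+ i * (C0 * 4^-1 ^+ i * J mu (fun x => f x ^+ 2)))).
      by apply: ler_pM => //; apply: J_ge0 => x; exact: ind_ge0.
    rewrite le_eqVlt; apply/orP; left; apply/eqP.
    have -> : 4^-1 ^+ i = 2^-1 ^+ i * 2^-1 ^+ i :> R.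
      by rewrite -exprMn -invfM -natrM.
    rewrite exprVn; field; exact: expf_neq0.
  rewrite -mulr_sumr mulrC.
  have h2 : \sum_(i < n) 2^-1 ^+ i <= 2 :> R.
    apply: (le_trans (@geometric_sum R 2^-1 n _ _)); rewrite ?invf_lt1 ?ltr1n//.
    by rewrite (_ : 1 - 2^-1 = 2^-1 :> R) ?invrK//; field.
  apply: (@le_trans _ _ (2 * (A * C0 * J mu (fun x => f x ^+ 2)))).
    by rewrite ler_wpM2r// mulr_ge0// mulr_ge0// ltW.
  by rewrite le_eqVlt; apply/orP; left; apply/eqP; ring.
have iF n : ig mu (fun x => \1_[set x | `|T f x| <= 1 + n%:R * M] x * `|T f x| ^+ N.+2).
  apply: ig_le (Gi n) => //; apply: measurable_funM => //; exact: measurable_indic.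
apply: (ig_fatou iF) => //.
- move=> n; apply: le_trans (JG n); apply: J_le => // x.
  by apply: le_trans (FG n x); exact: ler_norm.
- move=> x; apply: (@cvg_from _ _ _ (Num.truncn (`|T f x| / M)).+1) => n hn.
  rewrite indT ?mul1r//= ler_wpDl// -ler_pdivrMr// (le_trans (ltW (truncnS_gt _)))//.
  by rewrite ler_nat.
Qed.

Lemma moment_bound (N : nat) : exists B : R, 0 < B /\ forall f s, bb f -> 0 < s ->
  (forall x, `|f x| <= s) -> ig mu (fun x => `|T f x| ^+ N.+2) /\
  J mu (fun x => `|T f x| ^+ N.+2) <= B * s ^+ N * J mu (fun x => f x ^+ 2).
Proof.
have [B [B0 BP]] := moment_bound1 N; exists B; split => // f s bf s0 fs.
pose h x := s^-1 * f x.
have bh : bb h by exact: bbZ.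
have h1 x : `|h x| <= 1.
  by rewrite normrM gtr0_norm ?invr_gt0// ler_pdivrMl ?mulr1.
have [ih Jh] := BP h bh h1.
have E : {ae mu, forall x, `|T f x| ^+ N.+2 = s ^+ N.+2 * `|T h x| ^+ N.+2}.
  have -> : f = (fun x => s * h x).
    by apply/funext => x; rewrite mulrA divff ?mul1r// gt_eqF.
  apply: filterS (cz_scale TK s bh) => x ->.
  by rewrite normrM exprMn gtr0_norm.
have ifN : ig mu (fun x => `|T f x| ^+ N.+2).
  apply: ig_le_ae (igZ (s ^+ N.+2) ih).
    by apply: measurable_funX; apply: measurableT_comp => //; exact: cz_meas TK _ bf.
  by apply: filterS E => x ->; rewrite ger0_norm// mulr_ge0 ?exprn_ge0// ltW.
split => //; rewrite (eq_J_ae ifN (igZ (s ^+ N.+2) ih) E) JZ//.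
apply: (@le_trans _ _ (s ^+ N.+2 * (B * J mu (fun x => h x ^+ 2)))).
  by rewrite ler_wpM2l ?exprn_ge0 ?(ltW s0).
have -> : J mu (fun x => h x ^+ 2) = s ^- 2 * J mu (fun x => f x ^+ 2).
  rewrite -JZ; last exact: (bb_L2 mud bf).
  by apply: eq_J => x; rewrite exprMn exprVn.
by rewrite le_eqVlt !exprS; apply/orP; left; apply/eqP; field; rewrite gt_eqF.
Qed.

End Moments.

(** * Boundedness on L^p *)

Section RealInequalities.
Context (R : realType).
Implicit Types (p q e v xi a rho : R).

Lemma powRD_gt0 v p q : 0 < v -> v `^ (p + q) = v `^ p * v `^ q.
Proof. by move=> v0; apply: powRD; rewrite (gt_eqF v0) implybT. Qed.

(** The exponents conjugate to 2 and N+2 are 2 and 1 + 1/(N+1), and [q] lies strictly between them;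
    [e] is its distance to the nearer one. Exponent 2 is used for [v <= 1], exponent N+2 for
    [v > 1]. *)
Lemma young_pair p q (N : nat) : 2 < p -> p < N.+2%:R -> (p - 1) * (q - 1) = 1 ->
  exists e, 0 < e /\ forall xi v, 0 <= xi -> 0 <= v ->
  xi * v <= xi ^+ 2 + xi ^+ N.+2 + v `^ q * Num.min (v `^ e) (v `^ (- e)).
Proof.
move=> p2 pN pq; have p1 : 0 < p - 1 by lra.
have qE : q = 1 + (p - 1)^-1.
  apply: (mulfI (lt0r_neq0 p1)); rewrite mulrDr divff ?gt_eqF//.
  by move: pq; lra.
have N1 : 0 < N.+1%:R :> R by [].
have pN1 : p - 1 < N.+1%:R by move: pN; rewrite -natr1; lra.
have e2 : 0 < 2 - q by rewrite qE; have : (p - 1)^-1 < 1; [rewrite invf_lt1//|]; lra.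
have e1 : 0 < q - (1 + N.+1%:R^-1).
  by rewrite qE opprD addrACA subrr add0r subr_gt0 ltf_pV2 ?posrE.
exists (Num.min (2 - q) (q - (1 + N.+1%:R^-1))); set e := Num.min _ _.
have e0 : 0 < e by rewrite lt_min e2 e1.
split => // xi v xi0 v0; have [->|vn0] := eqVneq v 0.
  by rewrite mulr0 powR0 ?mul0r ?addr0 ?addr_ge0 ?exprn_ge0// qE gt_eqF// addr_gt0// invr_gt0.
have vp : 0 < v by rewrite lt_neqAle eq_sym vn0.
have x2 : 0 <= xi ^+ N.+2 by exact: exprn_ge0.
have [v1|v1] := leP v 1.
  rewrite min_l; last first.
    by rewrite ger_powR ?vp//; lra.
  rewrite -powRD_gt0//; apply: (@le_trans _ _ (xi ^+ 2 + v ^+ 2)); first by nra.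
  rewrite -addrA lerD2l; apply: (@le_trans _ _ (v `^ (q + e))); last by rewrite lerDr.
  by rewrite -powR_mulrn// ger_powR ?vp// -lerBrDl ge_min lexx.
have v1' := ltW v1.
rewrite min_r; last by rewrite ler_powR//; lra.
rewrite -powRD_gt0//; set w := v `^ (N.+1%:R^-1).
have w0 : 0 <= w by exact: powR_ge0.
have wN : w ^+ N.+1 = v by rewrite -powR_mulrn// -powRrM mulVf ?powRr1.
have [xw|xw] := leP w xi.
  have h : v <= xi ^+ N.+1 by rewrite -wN lerXn2r ?nnegrE.
  apply: (@le_trans _ _ (xi ^+ N.+2)); first by rewrite exprS ler_wpM2l.
  by rewrite -addrA addrCA lerDl addr_ge0 ?sqr_ge0 ?powR_ge0.
apply: (@le_trans _ _ (v `^ (q - e))); last by rewrite lerDr addr_ge0 ?sqr_ge0.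
apply: (@le_trans _ _ (w * v)); first by rewrite ler_wpM2r// ltW.
rewrite mulrC -{1}(powRr1 v0) /w -powRD_gt0//; apply: ler_powR => //.
by rewrite lerBrDr -lerBrDl ge_min lexx orbT.
Qed.

(** The inequality at [xi = x / l] and [v = y * l]^ (1 - p)[, multiplied by]l [^ p]: the choice for
    which the product gives back [x * y] and [v]^ q[gives]y [^ q]. *)
Lemma weighted_young p q e (N : nat) : 0 < p -> 0 < q -> (p - 1) * (q - 1) = 1 ->
  (forall xi v, 0 <= xi -> 0 <= v ->
    xi * v <= xi ^+ 2 + xi ^+ N.+2 + v `^ q * Num.min (v `^ e) (v `^ (- e))) ->
  forall l x y : R, 0 < l -> 0 <= x -> 0 <= y ->
  x * y <= l `^ p * (l ^- 2 * x ^+ 2 + l ^- N.+2 * x ^+ N.+2) +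
    y `^ q * Num.min (y `^ e * l `^ ((1 - p) * e)) (y `^ e * l `^ ((1 - p) * e))^-1.
Proof.
move=> p0 q0 pq young l x y l0 x0 y0; have ln := lt0r_neq0 l0.
have l0' := ltW l0.
pose v := y * l `^ (1 - p).
have lp : l `^ p * l `^ (1 - p) = l.
  by rewrite -powRD_gt0// addrC subrK powRr1.
have E1 : x * y = l `^ p * (x / l * v).
  have aux (P Q w : R) : P * Q = l -> w * l * y = P * (w * (y * Q)) by move=> <-; ring.
  by rewrite /v -(aux _ _ _ lp) mulfVK.
have vE : v `^ e = y `^ e * l `^ ((1 - p) * e).
  by rewrite /v powRM ?powR_ge0// -powRrM.
have vq : l `^ p * v `^ q = y `^ q.
  rewrite /v powRM ?powR_ge0// -powRrM.
  have -> : (1 - p) * q = - p by move: pq; lra.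
  by rewrite powRN mulrCA mulfV ?mulr1// gt_eqF// powR_gt0.
rewrite E1 -vE -powRN -vq -(mulrA _ (v `^ q)) -mulrDr ler_wpM2l ?powR_ge0//.
apply: le_trans (young _ v _ _) _; rewrite /v ?mulr_ge0 ?powR_ge0 ?invr_ge0//.
by rewrite lerD2r !exprMn !exprVn (mulrC (_ ^- 2)) (mulrC (_ ^- N.+2)).
Qed.

Lemma powR_exprn (b s : R) (i : nat) : 0 <= b -> (b ^+ i) `^ s = (b `^ s) ^+ i.
Proof.
by move=> b0; rewrite -(powR_mulrn i (powR_ge0 b s)) -(powR_mulrn i b0) -!powRrM mulrC.
Qed.

(** On the part of [f] of height above [l], this turns the L^2 integral of the moment bound into
    part of the L^p integral. *)
Lemma powR_ge_square p l t : 2 < p -> 0 < l -> l < t -> l `^ p * l ^- 2 * t ^+ 2 <= t `^ p.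
Proof.
move=> p2 l0 lt0; rewrite -mulrA -exprVn -exprMn; set w := l^-1 * t.
have w1 : 1 <= w by rewrite /w mulrC ler_pdivlMr// mul1r ltW.
have w0 : 0 <= w by lra.
have -> : t = l * w by rewrite /w mulVKf// gt_eqF.
rewrite powRM ?(ltW l0)// ler_wpM2l ?powR_ge0//.
by rewrite -powR_mulrn// ler_powR// ltW.
Qed.

Lemma piece_constant (N : nat) (b0 b1 k l j : R) : l != 0 ->
  (b0 + b1 * 2 ^+ N) * (k * l ^- 2 * j) =
  k * (l ^- 2 * (b0 * j) + l ^- N.+2 * (b1 * (2 * l) ^+ N * j)).
Proof.
move=> ln.
have E (w z x : R) : w != 0 -> z != 0 -> (w * z)^-1 * (x * w) = x / z.
  by move=> w0 z0; field; rewrite ?w0 ?z0.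
have {}E : l ^- N.+2 * (2 * l) ^+ N = 2 ^+ N * l ^- 2.
  have -> : (2 * l) ^+ N = 2 ^+ N * l ^+ N by rewrite exprMn.
  have -> : l ^+ N.+2 = l ^+ N * l ^+ 2 by rewrite -exprD addn2.
  by apply: E; rewrite expf_neq0.
by rewrite (mulrA (l ^- N.+2)) (mulrCA _ b1) E; ring.
Qed.

(** The terms increase geometrically while [a * rho ^+ i] is above 1 and decrease afterwards; the
    bound does not depend on [a]. *)
Lemma geometric_min_sum a rho n : 0 <= a -> 0 < rho -> rho < 1 ->
  \sum_(i < n) Num.min (a * rho ^+ i) (a * rho ^+ i)^-1 <= 2 / (1 - rho).
Proof.
move=> a0 r0 r1; have r1' : 0 < 1 - rho by lra.
(* A bounded primitive for telescoping: [S] takes its values in [0,2], and its drop from [v] to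
   [rho * v] is at least [(1 - rho) * min v v^-1]. *)
pose S v := if v <= 1 then v else 2 - v^-1.
have S2 v : 0 <= v -> 0 <= S v <= 2.
  move=> v0; rewrite /S; case: ifPn => [v1|]; first by lra.
  rewrite -ltNge => v1; have vp : 0 < v by lra.
  have ip : 0 < v^-1 by rewrite invr_gt0.
  have i1 : v^-1 < 1 by rewrite invf_lt1.
  by lra.
have step v : 0 <= v -> (1 - rho) * Num.min v v^-1 <= S v - S (rho * v).
  move=> v0; rewrite /S; case: ifPn => [v1|].
    rewrite ifT; last by nra.
    apply: (@le_trans _ _ ((1 - rho) * v)); last by lra.
    by rewrite ler_wpM2l ?(ltW r1')// ge_min lexx.
  rewrite -ltNge => v1; have vp : 0 < v by lra.
  apply: (@le_trans _ _ ((1 - rho) * v^-1)).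
    by rewrite ler_wpM2l ?(ltW r1')// ge_min lexx orbT.
  rewrite ler_pdivrMr//; case: ifPn => [rv|].
    by rewrite mulrBl mulrBl mulVf ?gt_eqF//; nra.
  have -> : (2 - v^-1 - (2 - (rho * v)^-1)) * v = rho^-1 - 1.
    by field; rewrite !gt_eqF.
  have : 1 <= rho^-1 by rewrite invf_ge1// ltW.
  have : rho^-1 * rho = 1 by rewrite mulVf ?gt_eqF.
  nra.
have v0 i : 0 <= a * rho ^+ i by rewrite mulr_ge0// exprn_ge0// ltW.
rewrite ler_pdivlMr// mulrC mulr_sumr.
apply: (@le_trans _ _ (\sum_(i < n) (S (a * rho ^+ i) - S (a * rho ^+ i.+1)))).
  apply: ler_sum => i _.
  have -> : a * rho ^+ i.+1 = rho * (a * rho ^+ i) by rewrite exprS mulrCA.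
  exact: step.
rewrite -(big_mkord xpredT (fun i => S (a * rho ^+ i) - S (a * rho ^+ i.+1))).
rewrite (telescope_sumr_eq (fun i => - S (a * rho ^+ i)))//; last first.
  by move=> i _; rewrite opprK addrC.
by have := S2 _ (v0 n); have := S2 _ (v0 0%N); lra.
Qed.

End RealInequalities.

(** * The bilinear form on dyadic pieces *)

Section Interpolation.
Context (R : realType) (d : measure_display) (X : metricBorelType R d).
Context (mu : {measure set X -> \bar R}) (lam : X -> R -> R).
Hypotheses (mud : upper_doubling mu lam) (Xd : geometrically_doubling X).
Implicit Types (x y z : X) (r s t : R) (f g h : X -> R).

Lemma bb_powR f p : 0 < p -> bb f -> bb (fun x => `|f x| `^ p).
Proof.
move=> p0 [mf [z [r [M hM]]]]; split; first exact: measurable_powR_abs.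
exists z, r, (`|M| `^ p) => x; rewrite ger0_norm ?powR_ge0//.
have [zx|zx] := pselect (ball z r x).
  rewrite indT// mulr1 ge0_ler_powR ?nnegrE// ?(ltW p0)//.
  by rewrite (le_trans (hM x))// indT// mulr1 ler_norm.
have := hM x; rewrite indF// !mulr0 normr_le0 => /eqP ->.
by rewrite normr0 powR0// gt_eqF.
Qed.

Lemma norm_indB (A B : set X) x : `|\1_A x - \1_B x| <= 1 :> R.
Proof.
have := ind_ge0 (R := R) A x; have := ind_le1 (R := R) A x.
have := ind_ge0 (R := R) B x; have := ind_le1 (R := R) B x.
by rewrite ler_norml; lra.
Qed.

Lemma dyadic_piece f s : bb f -> bb (fun x => (\1_(level s f) x - \1_(level (2 * s) f) x) * f x).
Proof.
move=> bf; have mf := bb_meas bf.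
apply: bbMl => //.
  by apply: measurable_funB; apply: measurable_indic; exact: measurable_level.
by exists 1 => x; exact: norm_indB.
Qed.

Lemma dyadic_range f s x : 0 < s ->
  \1_(level s f) x - \1_(level (2 * s) f) x =
  if s < `|f x| <= 2 * s then 1 else 0 :> R.
Proof.
move=> s0; have [h1|h1] := ltP s `|f x|; last first.
  rewrite !indF ?subrr//= /level /=; apply/negP; rewrite -leNgt//; lra.
rewrite (indT (A := level s f))//; have [h2|h2] := leP `|f x| (2 * s).
  by rewrite indF ?subr0// /level /=; apply/negP; rewrite -leNgt.
by rewrite indT// subrr.
Qed.

Variables (K K' : X -> X -> R) (T T' : (X -> R) -> X -> R) (C0 C c delta : R).
Hypothesis TK : CZO mu lam T K C0 C c delta.
Hypothesis TK' : CZO mu lam T' K' C0 C c delta.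
Hypothesis TT' : forall f h, bb f -> bb h ->
  J mu (fun x => T f x * h x) = pr mu (T' h) f.

Lemma CZO_loc (S : (X -> R) -> X -> R) (k : X -> X -> R) f : CZO mu lam S k C0 C c delta ->
  bb f -> loc mu (S f).
Proof. by move=> Sk bf; exact: (cz_loc mud Sk bf). Qed.

(* On the dyadic piece of size s, Young's inequality is used with the exponent
   2 or N + 2, whichever is better, leaving a summable loss. *)
Lemma form_bound_large p q : 2 < p -> (p - 1) * (q - 1) = 1 -> exists A : R, 0 < A /\
  forall f g, bb f -> bb g -> `|pr mu (T' g) f| <=
    A * (J mu (fun x => `|f x| `^ p) + J mu (fun x => `|g x| `^ q)).
Proof.
move=> p2 pq; have p1 : 0 < p - 1 by lra.
have q0 : 0 < q by have : 0 < q - 1; [rewrite -(pmulr_rgt0 _ p1) pq|lra].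
have p0 : 0 < p by lra.
pose N := Num.truncn p.
have pN : p < N.+2%:R by rewrite (lt_trans (truncnS_gt _))// ltr_nat.
have [e [e0 eP]] := young_pair p2 pN pq.
have [B [B0 BP]] := moment_bound mud Xd TK N.
have C00 := cz_C0 TK.
(* The ratio of the weights in [weighted_young] when the height [l] is doubled. *)
pose rho := 2 `^ ((1 - p) * e).
have r0 : 0 < rho by rewrite powR_gt0.
have r1 : rho < 1.
  have pe : 0 < (p - 1) * e by rewrite mulr_gt0.
  rewrite /rho -opprB mulNr powRN invf_lt1 ?powR_gt0//.
  have := @gt0_ltr_powR R _ pe 1 2; rewrite !nnegrE powR1; apply => //.
  by rewrite ltr1n.
pose c1 := 2 / (1 - rho); pose c2 := C0 + B * 2 ^+ N.
have c10 : 0 < c1 by rewrite divr_gt0// subr_gt0.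
have c20 : 0 < c2 by rewrite addr_gt0// mulr_gt0// exprn_gt0.
exists (c1 + c2); split; first exact: addr_gt0.
move=> f g bf bg.
have mf := bb_meas bf; have mg := bb_meas bg.
have ip := bb_ig mud (bb_powR p0 bf); have iq := bb_ig mud (bb_powR q0 bg).
have J0p : 0 <= J mu (fun x => `|f x| `^ p) by apply: J_ge0 => x; exact: powR_ge0.
have J0q : 0 <= J mu (fun x => `|g x| `^ q) by apply: J_ge0 => x; exact: powR_ge0.
(* Only heights between 2^-n and 2^n are kept, which makes the decomposition finite; the bound is
   uniform in [n] and dominated convergence removes the restriction. *)
suff bound n : `|J mu (fun x => T' g x *
    ((\1_(level (2 ^- n) f) x - \1_(level (2 ^+ n) f) x) * f x))| <=
    c2 * J mu (fun x => `|f x| `^ p) + c1 * J mu (fun x => `|g x| `^ q).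
  have iTf := loc_le (CZO_loc TK' bg) bf.
  have [|||||_ _ cv] := @J_dct _ _ _ mu (fun n x => T' g x *
    ((\1_(level (2 ^- n) f) x - \1_(level (2 ^+ n) f) x) * f x))
    (fun x => T' g x * f x) (fun x => `|T' g x * f x|) => //.
  - move=> n; apply: measurable_funM; first exact: (cz_meas TK' bg).
    apply: measurable_funM => //; apply: measurable_funB; apply: measurable_indic;
      exact: measurable_level.
  - exact: ig_meas iTf.
  - exact: ig_abs.
  - move=> n; apply: aeW => x; rewrite !normrM ler_wpM2l// ler_piMl//.
    exact: norm_indB.
  - apply: aeW => x; have [->|fx] := eqVneq (f x) 0.
      by apply: (@cvg_from _ _ _ 0%N) => n _; rewrite !mulr0.
    have fx0 : 0 < `|f x| by rewrite normr_gt0.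
    apply: (@cvg_from _ _ _ (maxn (Num.truncn `|f x|^-1).+1 (Num.truncn `|f x|).+1)) => n.
    rewrite geq_max => /andP[n1 n2].
    rewrite indT; last first.
      rewrite /level /= -[ltRHS]invrK ltf_pV2 ?posrE ?exprn_gt0 ?invr_gt0//.
      by rewrite (lt_trans (truncnS_gt _))// -natrX ltr_nat (leq_ltn_trans n1)// ltn_expl.
    rewrite indF ?subr0 ?mul1r// /level /=; apply/negP; rewrite -leNgt.
    by rewrite (le_trans (ltW (truncnS_gt _)))// -natrX ler_nat (leq_trans n2)// ltnW// ltn_expl.
  have cvn : `|J mu (fun x => T' g x *
      ((\1_(level (2 ^- n) f) x - \1_(level (2 ^+ n) f) x) * f x))| @[n --> \oo] -->
      `|J mu (fun x => T' g x * f x)| by exact: cvg_norm.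
  apply: (@le_trans _ _ (c2 * J mu (fun x => `|f x| `^ p) + c1 * J mu (fun x => `|g x| `^ q))).
    apply: (ler_cvg_to cvn (cvg_cst _)); apply: nearW => n; exact: bound.
  rewrite mulrDr; apply: lerD; apply: ler_wpM2r; [exact: J0p| |exact: J0q|].
    by rewrite lerDr ltW.
  by rewrite lerDl ltW.
pose l (i : nat) : R := 2 ^- n * 2 ^+ i.
have l0 i : 0 < l i by rewrite mulr_gt0 ?invr_gt0 ?exprn_gt0.
have lp i : l i `^ ((1 - p) * e) = (2 ^- n) `^ ((1 - p) * e) * rho ^+ i.
  by rewrite /l powRM ?invr_ge0 ?exprn_ge0// powR_exprn.
have lS i : l i.+1 = 2 * l i by rewrite /l exprS mulrCA.
pose u (i : nat) x := (\1_(level (l i) f) x - \1_(level (2 * l i) f) x) * f x.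
have bu i : bb (u i) by exact: dyadic_piece.
have uE x : (\1_(level (2 ^- n) f) x - \1_(level (2 ^+ n) f) x) * f x =
    \sum_(i < n + n) u i x.
  rewrite -mulr_suml; congr (_ * _).
  rewrite -(big_mkord xpredT (fun i => \1_(level (l i) f) x - \1_(level (2 * l i) f) x)).
  rewrite (telescope_sumr_eq (fun i => - \1_(level (l i) f) x))//; last first.
    by move=> i _; rewrite opprK addrC lS.
  by rewrite opprK addrC /l expr0 mulr1 exprD mulKf ?expf_neq0.
have Tl := CZO_loc TK'.
have lT i := CZO_loc TK (bu i).
have iTg i : ig mu (fun x => T (u i) x * g x) by exact: loc_le (lT i) bg.
have -> : J mu (fun x => T' g x *
    ((\1_(level (2 ^- n) f) x - \1_(level (2 ^+ n) f) x) * f x)) =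
    \sum_(i < n + n) J mu (fun x => T (u i) x * g x).
  transitivity (\sum_(i < n + n) pr mu (T' g) (u i)); last first.
    by apply: eq_bigr => i _; rewrite TT'.
  rewrite /pr -J_sum; last by move=> i _; exact: loc_le (Tl _ bg) (bu i).
  by apply: eq_J => x; rewrite uE mulr_sumr.
have ub i x : `|u i x| <= 2 * l i.
  rewrite /u normrM dyadic_range//.
  case: ifP => [/andP[_ h]|_]; first by rewrite normr1 mul1r.
  by rewrite normr0 mul0r mulr_ge0// ltW.
pose W i x := l i `^ p * (l i ^- 2 * T (u i) x ^+ 2 + l i ^- N.+2 * `|T (u i) x| ^+ N.+2).
have iW2 i := cz_ig TK (bu i).
have [iWN JWN] : (forall i, ig mu (fun x => `|T (u i) x| ^+ N.+2)) /\ forall i,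
    J mu (fun x => `|T (u i) x| ^+ N.+2) <= B * (2 * l i) ^+ N * J mu (fun x => u i x ^+ 2).
  by split => i; have [] := BP _ (2 * l i) (bu i) (mulr_gt0 (ltr0n R 2) (l0 i)) (ub i).
have iW i : ig mu (W i) by apply: igZ; apply: igD; exact: igZ.
(* The part of |f|^p carried by piece [i]. It dominates [W i] in integral, and these parts add up to
   at most |f|^p. *)
pose D i x := (\1_(level (l i) f) x - \1_(level (2 * l i) f) x) * `|f x| `^ p.
have bD i : bb (D i).
  have bfp := bb_powR p0 bf; apply: bbMl => //.
    by apply: measurable_funB; apply: measurable_indic; exact: measurable_level.
  by exists 1 => x; rewrite dyadic_range//; case: ifP; rewrite ?normr1 ?normr0.
have iD i := bb_ig mud (bD i).
have JW i : J mu (W i) <= c2 * J mu (D i).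
  have h : l i `^ p * l i ^- 2 * J mu (fun x => u i x ^+ 2) <= J mu (D i).
    rewrite -JZ; last exact: (bb_L2 mud (bu i)).
    apply: J_le => // [|x]; first by apply: igZ; exact: (bb_L2 mud (bu i)).
    rewrite /u /D dyadic_range//; case: ifP => [/andP[h1 _]|_]; last first.
      by rewrite !mul0r expr0n mulr0.
    by rewrite !mul1r -(real_normK (num_real (f x))) powR_ge_square.
  rewrite /W JZ; last by apply: igD; exact: igZ.
  rewrite JD; [|exact: igZ|exact: igZ]; rewrite JZ// JZ//.
  apply: le_trans (ler_wpM2l (ltW c20) h).
  rewrite (piece_constant N C0 B _ _ (lt0r_neq0 (l0 i))).
  rewrite ler_wpM2l ?powR_ge0//; apply: lerD.
    by rewrite ler_wpM2l ?invr_ge0 ?exprn_ge0 ?(ltW (l0 i))//; exact: (cz_L2 TK (bu i)).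
  by rewrite ler_wpM2l ?invr_ge0 ?exprn_ge0 ?(ltW (l0 i)).
have pt i x : `|T (u i) x * g x| <= W i x + `|g x| `^ q *
    Num.min ((`|g x| `^ e * (2 ^- n) `^ ((1 - p) * e)) * rho ^+ i)
            ((`|g x| `^ e * (2 ^- n) `^ ((1 - p) * e)) * rho ^+ i)^-1.
  have := weighted_young p0 q0 pq eP (l0 i) (normr_ge0 (T (u i) x)) (normr_ge0 (g x)).
  by rewrite normrM (lp i) mulrA real_normK ?num_real.
apply: (@le_trans _ _ (\sum_(i < n + n) J mu (fun x => `|T (u i) x * g x|))).
  apply: le_trans (ler_norm_sum _ _ _) _; apply: ler_sum => i _; exact: J_norm.
rewrite -J_sum; last by move=> i _; exact: ig_abs.
apply: (@le_trans _ _ (J mu (fun x => \sum_(i < n + n) W i x + c1 * `|g x| `^ q))).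
  apply: J_le; [by apply: ig_sum => i _; exact: ig_abs| |move=> x].
    by apply: igD; [exact: ig_sum|exact: igZ].
  apply: (@le_trans _ _ (\sum_(i < n + n) (W i x + `|g x| `^ q *
    Num.min ((`|g x| `^ e * (2 ^- n) `^ ((1 - p) * e)) * rho ^+ i)
            ((`|g x| `^ e * (2 ^- n) `^ ((1 - p) * e)) * rho ^+ i)^-1))).
    by apply: ler_sum => i _; exact: pt.
  rewrite big_split /= lerD2l -mulr_sumr mulrC ler_wpM2r ?powR_ge0//.
  by apply: geometric_min_sum => //; rewrite mulr_ge0 ?powR_ge0.
rewrite JD; [|exact: ig_sum|exact: igZ].
rewrite JZ// lerD2r J_sum//.
apply: (@le_trans _ _ (\sum_(i < n + n) c2 * J mu (D i))); first by apply: ler_sum.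
rewrite -mulr_sumr; apply: ler_wpM2l; [exact: ltW c20|rewrite -J_sum; last by move=> i _; exact: iD].
apply: J_le; [by apply: ig_sum => i _; exact: iD|exact: ip|move=> x].
rewrite -mulr_suml ler_piMl ?powR_ge0//.
rewrite -(big_mkord xpredT (fun i => \1_(level (l i) f) x - \1_(level (2 * l i) f) x)).
rewrite (telescope_sumr_eq (fun i => - \1_(level (l i) f) x))//; last first.
  by move=> i _; rewrite opprK addrC lS.
Qed.

End Interpolation.

(** * Duality and extension to L^p *)

Section Duality.
Context (R : realType) (d : measure_display) (X : metricBorelType R d).
Context (mu : {measure set X -> \bar R}) (lam : X -> R -> R).
Hypotheses (mud : upper_doubling mu lam) (Xd : geometrically_doubling X).
Implicit Types (x y z : X) (r s t : R) (f g h : X -> R).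

Lemma conj_sym (p q : R) : (p - 1) * (q - 1) = 1 -> (q - 1) * (p - 1) = 1.
Proof. by rewrite mulrC. Qed.

Lemma conj_gt1 (p q : R) : 1 < p -> (p - 1) * (q - 1) = 1 -> 1 < q.
Proof.
move=> p1 pq; have p10 : 0 < p - 1 by lra.
have : 0 < q - 1 by rewrite -(pmulr_rgt0 _ p10) pq.
by lra.
Qed.

Lemma young_le (p q a b : R) : 1 < p -> (p - 1) * (q - 1) = 1 -> 0 <= a -> 0 <= b ->
  a * b <= a `^ p + b `^ q.
Proof.
move=> p1 pq a0 b0; have q1 := conj_gt1 p1 pq.
have p0 : 0 < p by lra.
have q0 : 0 < q by lra.
have e : p^-1 + q^-1 = 1.
  have E : p * q = p + q by move: pq; lra.
  have -> : p^-1 + q^-1 = (p + q) / (p * q) by field; rewrite !gt_eqF.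
  by rewrite E divff// gt_eqF// addr_gt0.
apply: (le_trans (conjugate_powR a0 b0 p0 q0 e)); apply: lerD.
  by rewrite ler_pdivrMr// ler_peMr ?powR_ge0// ltW.
by rewrite ler_pdivrMr// ler_peMr ?powR_ge0// ltW.
Qed.

Lemma powR_small (q a b : R) : 1 < q -> b <= 1 -> `|a| <= b -> `|(`|a| `^ q)| <= `|a|.
Proof.
move=> q1 b1 ab; rewrite ger0_norm ?powR_ge0//.
have [->|a0] := eqVneq a 0; first by rewrite normr0 powR0// gt_eqF//; lra.
by apply: ge1r_powR; [rewrite normr_gt0 a0 (le_trans ab)|exact: ltW].
Qed.

Lemma half_absorb (a u v e : R) : 0 < a -> 2 * a * v <= e -> 2 * a * (u + 1) = e ->
  a * (u + v) <= e.
Proof. by move=> a0 h1 h2; lra. Qed.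

(* A function is tested against (a small multiple of) the function that is
   extremal in Hoelder's inequality. *)
Lemma dual_bound (p q a : R) : 1 < p -> (p - 1) * (q - 1) = 1 -> 0 < a ->
  exists b : R, 0 < b /\ forall g (M : R), 0 <= M -> loc mu g ->
  (forall h, bb h -> `|pr mu g h| <= a * (M + J mu (fun x => `|h x| `^ q))) ->
  ig mu (fun x => `|g x| `^ p) /\ J mu (fun x => `|g x| `^ p) <= b * M.
Proof.
move=> p1 pq a0; have q1 := conj_gt1 p1 pq.
have p10 : 0 < p - 1 by lra.
have p0 : 0 < p by lra.
have q0 : 0 < q by lra.
pose s := (2 * a) `^ (- (p - 1)).
have a20 : 0 < 2 * a by rewrite mulr_gt0.
have s0 : 0 < s by rewrite powR_gt0.
have sq : a * s `^ q = s / 2.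
  have -> : s `^ q = s * s `^ (q - 1).
    by rewrite -{2}(powRr1 (ltW s0)) -powRD_gt0// addrC subrK.
  by rewrite /s -powRrM mulNr pq powR_inv1 ?(ltW a20)//; field; rewrite gt_eqF.
exists (2 * a / s); split; first by rewrite divr_gt0.
move=> g M M0 [mg lg] gM.
pose w n x := `|cut n g x| `^ (p - 1).
have bw n : bb (w n) by apply: bb_powR => //; exact: cut_bb.
pose h n x := s * Num.sg (g x) * w n x.
have msg : measurable_fun [set: X] (fun x => Num.sg (g x)).
  by apply: measurableT_comp => //; exact: measurable_sg.
have bh n : bb (h n).
  apply: bbMl => //; first exact: measurable_funM.
  exists s => x; rewrite normrM gtr0_norm// -[leRHS]mulr1 ler_wpM2l ?(ltW s0)//.
  by case: sgrP; rewrite ?normr0 ?normrN ?normr1.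
have bc n : ig mu (fun x => `|cut n g x| `^ p).
  by apply: (bb_ig mud); apply: bb_powR => //; exact: cut_bb.
have cutE n x : cut n g x = g x \/ cut n g x = 0.
  rewrite /cut; have [e|e] := pselect ((ball point n%:R `&` [set x | `|g x| <= n%:R]) x).
    by left; rewrite indT// mul1r.
  by right; rewrite indF// mul0r.
have gh n x : g x * h n x = s * `|cut n g x| `^ p.
  rewrite /h /w; have [->|->] := cutE n x; last first.
    by rewrite normr0 !powR0 ?mulr0// gt_eqF.
  have [->|g0] := eqVneq (g x) 0; first by rewrite normr0 !powR0 ?mulr0 ?mul0r// gt_eqF.
  have -> : g x * (s * Num.sg (g x) * `|g x| `^ (p - 1)) =
    s * (Num.sg (g x) * g x * `|g x| `^ (p - 1)) by ring.
  congr (_ * _); rewrite -normrEsg -{1}(powRr1 (normr_ge0 (g x))) -powRD_gt0 ?normr_gt0//.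
  by congr (_ `^ _); ring.
have hq n x : `|h n x| `^ q = s `^ q * `|cut n g x| `^ p.
  rewrite /h /w; have [e|e] := eqVneq (cut n g x) 0.
    by rewrite e normr0 !powR0 ?mulr0 ?normr0 ?powR0// gt_eqF.
  have [cE|cE] := cutE n x; last by rewrite cE eqxx in e.
  rewrite !normrM gtr0_norm// [`|_ `^ _|]ger0_norm ?powR_ge0//.
  rewrite normr_sg -cE e mulr1 powRM ?powR_ge0 ?(ltW s0)// -powRrM.
  by congr (_ * _ `^ _); move: pq; lra.
have bnd n : J mu (fun x => `|cut n g x| `^ p) <= 2 * a / s * M.
  have := gM _ (bh n); rewrite /pr.
  have -> : J mu (fun x => g x * h n x) = s * J mu (fun x => `|cut n g x| `^ p).
    by rewrite -JZ//; apply: eq_J => x; exact: gh.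
  have -> : J mu (fun x => `|h n x| `^ q) = s `^ q * J mu (fun x => `|cut n g x| `^ p).
    by rewrite -JZ//; apply: eq_J => x; exact: hq.
  set I := J mu _.
  have I0 : 0 <= I by apply: J_ge0 => x; exact: powR_ge0.
  rewrite ger0_norm ?mulr_ge0 ?(ltW s0)// mulrDr mulrA sq => H.
  rewrite -(ler_pM2l s0); have -> : s * (2 * a / s * M) = 2 * (a * M).
    by field; rewrite gt_eqF.
  lra.
apply: ig_fatou bc _ bnd _ _.
- by move=> n x; exact: powR_ge0.
- exact: measurable_powR_abs.
- by move=> x; have [k h'] := cut_id g x; apply: (cvg_from (N := k)) => n /h' ->.
Qed.

Variables (K K' : X -> X -> R) (T T' : (X -> R) -> X -> R) (C0 C c delta : R).
Hypothesis TK : CZO mu lam T K C0 C c delta.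
Hypothesis TK' : CZO mu lam T' K' C0 C c delta.
Hypothesis TT' : forall f h, bb f -> bb h ->
  J mu (fun x => T f x * h x) = pr mu (T' h) f.

Lemma form_bound p q : 1 < p -> (p - 1) * (q - 1) = 1 -> exists A : R, 0 < A /\
  forall f g, bb f -> bb g -> `|pr mu (T' g) f| <=
    A * (J mu (fun x => `|f x| `^ p) + J mu (fun x => `|g x| `^ q)).
Proof.
move=> p1 pq; have q1 := conj_gt1 p1 pq; have C00 := cz_C0 TK'.
have [p2|p2|p2] := ltgtP p 2; last 1 first.
- have q2 : q = 2 by move: pq; rewrite p2; lra.
  exists (1 + C0); split; first by rewrite addr_gt0.
  move=> f g bf bg; rewrite p2 q2.
  have E h : J mu (fun x => `|h x| `^ 2) = J mu (fun x => h x ^+ 2).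
    by apply: eq_J => x; exact: powR2.
  rewrite !E; have if2 := bb_L2 mud bf; have ig2 := bb_L2 mud bg.
  have iT := cz_ig TK' bg; have := cz_L2 TK' bg.
  set u := J mu (fun x => f x ^+ 2); set v := J mu (fun x => g x ^+ 2).
  have u0 : 0 <= u by apply: J_ge0 => x; exact: sqr_ge0.
  have v0 : 0 <= v by apply: J_ge0 => x; exact: sqr_ge0.
  move=> Tv; apply: (@le_trans _ _ (J mu (fun x => T' g x ^+ 2 + f x ^+ 2))).
    apply: J_norm_le; [|exact: igD|move=> x].
      by apply: ig_mul2 => //; [exact: (cz_meas TK' bg)|exact: bb_meas].
    by rewrite normrM -(real_normK (num_real (T' g x))) -(real_normK (num_real (f x))); nra.
  rewrite JD// -/u; nra.
- have q2 : 2 < q.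
    by move: pq; nra.
  have TT : forall f h, bb f -> bb h -> J mu (fun x => T' f x * h x) = pr mu (T h) f.
    by move=> f h bf bh; rewrite -[LHS]/(pr mu (T' f) h) -TT'.
  have [A [A0 AP]] := form_bound_large mud Xd TK' TK TT q2 (conj_sym pq).
  exists A; split; first exact: A0.
  move=> f g bf bg; rewrite -(TT' bf bg) [X in _ <= A * X]addrC.
  exact: (AP g f bg bf).
- exact: (form_bound_large mud Xd TK TK' TT' p2 pq).
Qed.

Hypothesis T2 : forall f, Lp mu 2%:E f -> Lp mu 2%:E (T f).
Hypothesis TT2 : forall f h, Lp mu 2%:E f -> bb h ->
  J mu (fun x => T f x * h x) = pr mu f (T' h).

(** For [f] in L^p the pairing is a genuine integral, since [T' h] lies in L^q; no clipping is
    involved. *)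
Definition Lpspec f g := loc mu g /\ forall h, bb h -> pr mu f (T' h) = pr mu g h.

Lemma Lp_bounded_extension p : 1 < p ->
  exists S, extends_L2 mu T (Lp mu p%:E) S /\ Lp_bounded mu p%:E S.
Proof.
move=> p1; have p0 : 0 < p by lra.
pose q := 1 + (p - 1)^-1; have p10 : 0 < p - 1 by lra.
have pq : (p - 1) * (q - 1) = 1 by rewrite /q addrAC subrr add0r divff// gt_eqF.
have q1 := conj_gt1 p1 pq; have q0 : 0 < q by lra.
have [A [A0 AP]] := form_bound p1 pq.
(* [dual_bound] is used twice: here to place [T' h] in L^q, later to place [S f] in L^p. *)
have [A1 [A10 A1P]] := dual_bound q1 (conj_sym pq) A0.
have Tq h : bb h -> ig mu (fun x => `|T' h x| `^ q) /\
    J mu (fun x => `|T' h x| `^ q) <= A1 * J mu (fun x => `|h x| `^ q).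
  move=> bh; apply: A1P; first by apply: J_ge0 => x; exact: powR_ge0.
    exact: (CZO_loc mud TK').
  by move=> f bf; rewrite [X in _ <= A * X]addrC AP.
pose A2 := 1 + A1; have A20 : 0 < A2 by rewrite addr_gt0.
have prT f h : Lp mu p%:E f -> bb h -> ig mu (fun x => f x * T' h x) /\
    `|pr mu f (T' h)| <= A2 * (J mu (fun x => `|f x| `^ p) + J mu (fun x => `|h x| `^ q)).
  move=> /(LpP _ _ p0)[mf fi] bh; have [iT JT] := Tq h bh.
  have mT := cz_meas TK' bh.
  have le x : `|f x * T' h x| <= `|f x| `^ p + `|T' h x| `^ q.
    by rewrite normrM young_le.
  have ii := igD fi iT.
  have i1 : ig mu (fun x => f x * T' h x) by apply: ig_le ii => //; exact: measurable_funM.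
  split => //; apply: (le_trans (J_norm_le i1 ii le)); rewrite JD// mulrDr.
  have f0 : 0 <= J mu (fun x => `|f x| `^ p) by apply: J_ge0 => x; exact: powR_ge0.
  have h0 : 0 <= J mu (fun x => `|h x| `^ q) by apply: J_ge0 => x; exact: powR_ge0.
  apply: lerD; first by apply: ler_peMl; [exact: f0|rewrite lerDl ltW].
  by apply: (le_trans JT); apply: ler_wpM2r; [exact: h0|rewrite lerDr].
have ex f : Lp mu p%:E f -> exists g, Lpspec f g.
  move=> Lf.
  have [||g [lg gP]] := @riesz _ _ _ _ _ mud (fun h => pr mu f (T' h)).
  - move=> k h1 h2 b1 b2; have b3 := bbD k b1 b2.
    have [i1 _] := prT f _ Lf b1; have [i2 _] := prT f _ Lf b2; have [i3 _] := prT f _ Lf b3.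
    rewrite /pr -JZ// -JD//; last exact: igZ.
    apply: eq_J_ae => //; first by apply: igD => //; exact: igZ.
    by apply: filterS (cz_lin TK' k b1 b2) => x ->; ring.
  - move=> z r h_ mh h1 h0.
    have F0 : 0 <= J mu (fun x => `|f x| `^ p) by apply: J_ge0 => x; exact: powR_ge0.
    set F := J mu _ in F0.
    have bh n : bb (h_ n) by exact: ind_dom_bb (mh n) (h1 n).
    have u0 : J mu (fun x => `|h_ n x| `^ q) @[n --> \oo] --> (0 : R).
      have [|||||_ _] := @J_dct _ _ _ mu (fun n x => `|h_ n x| `^ q) (fun=> 0)
        (\1_(ball z r)) => //.
      - by move=> n; exact: measurable_powR_abs.
      - exact: (ig_ind_ball mud).
      - by move=> n; apply: aeW => x; exact: le_trans (powR_small q1 (ind_le1 _ _) (h1 n x)) (h1 n x).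
      - apply: filterS h0 => x hx; apply: (cvg0_le (v := fun n => `|h_ n x|)) => [n|].
          exact: (powR_small q1 (ind_le1 _ _) (h1 n x)).
        by rewrite -(normr0 R); exact: cvg_norm.
      by rewrite J0.
    apply/cvgrPdist_le => e e0.
    (* The bound of [prT] is a sum and does not tend to 0 with [h_ n]. It is applied to [s * h_ n]
       and divided by [s]: the term in [F] becomes at most [e / 2], and the other one is small for
       large [n]. *)
    pose s := 2 * A2 * (F + 1) / e.
    have s0 : 0 < s by rewrite divr_gt0// !mulr_gt0// ltr_pwDr.
    pose dl := s * e / (2 * A2 * s `^ q).
    have sq0 : 0 < s `^ q by exact: powR_gt0.
    have dl0 : 0 < dl by apply: divr_gt0; [exact: mulr_gt0|rewrite mulr_gt0// mulr_gt0].
    move/cvgrPdist_lt : u0 => /(_ _ dl0); apply: filterS => n.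
    rewrite sub0r normrN => hn; rewrite sub0r normrN.
    have [i1 _] := prT f _ Lf (bh n).
    have [i2] := prT f _ Lf (bbZ s (bh n)).
    have -> : pr mu f (T' (fun x => s * h_ n x)) = s * pr mu f (T' (h_ n)).
      rewrite /pr -JZ//; apply: eq_J_ae => //; first exact: igZ.
      by apply: filterS (cz_scale TK' s (bh n)) => x ->; ring.
    have -> : J mu (fun x => `|s * h_ n x| `^ q) = s `^ q * J mu (fun x => `|h_ n x| `^ q).
      rewrite -JZ; last by apply: (bb_ig mud); exact: bb_powR.
      by apply: eq_J => x; rewrite normrM gtr0_norm// powRM// ltW.
    rewrite normrM gtr0_norm// -/F => H.
    rewrite -(ler_pM2l s0) (le_trans H)//.
    have h2 : 2 * A2 * s `^ q * J mu (fun x => `|h_ n x| `^ q) <= s * e.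
      rewrite mulrC -ler_pdivlMr ?mulr_gt0//; apply: ltW.
      by rewrite (le_lt_trans (ler_norm _)).
    have h3 : 2 * A2 * (F + 1) = s * e by rewrite /s divfK// gt_eqF.
    by apply: half_absorb A20 _ h3; rewrite mulrA.
  by exists g; split => // h bh; rewrite gP.
have uniq f g1 g2 : Lpspec f g1 -> Lpspec f g2 -> {ae mu, forall x, g1 x = g2 x}.
  move=> [l1 s1] [l2 s2]; apply: loc_inj => // h bh.
  by rewrite -s1// s2.
have [S SP] : exists S, forall f, Lp mu p%:E f -> Lpspec f (S f).
  have /choice[S SP] : forall f, exists g, Lp mu p%:E f -> Lpspec f g.
    move=> f; have [/ex[g ?]|n] := pselect (Lp mu p%:E f); first by exists g.
    by exists (fun=> 0).
  by exists S.
exists S; split; first split.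
- move=> a f g Lf Lg.
  have Lfg : Lp mu p%:E (fun x => a * f x + g x).
    have p1' : (1 <= p%:E)%E by rewrite lee_fin ltW.
    exact: (Lfun_submod_closed mu p1').2 a f g Lf Lg.
  have [lf sf] := SP f Lf; have [lg sg] := SP g Lg.
  have spec : Lpspec (fun x => a * f x + g x) (fun x => a * S f x + S g x).
    split; first exact: locD.
    move=> h bh; rewrite [RHS]prDl// -sf// -sg//.
    have [i1 _] := prT f h Lf bh; have [i2 _] := prT g h Lg bh.
    rewrite /pr -JZ// -JD//; last exact: igZ.
    by apply: eq_J => x; ring.
  by apply: filterS (uniq _ _ _ (SP _ Lfg) spec) => x.
- move=> f Lf f2; have /L2P[mTf Tf2] := T2 f2.
  have spec : Lpspec f (T f).
    split; first exact: (L2_loc mud).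
    by move=> h bh; rewrite -TT2.
  by apply: filterS (uniq _ _ _ (SP _ Lf) spec) => x.
have [A3 [A30 A3P]] := dual_bound p1 pq A20.
exists (A3 `^ p^-1) => f Lf; have [lS sS] := SP f Lf.
have f0 : 0 <= J mu (fun x => `|f x| `^ p) by apply: J_ge0 => x; exact: powR_ge0.
have [iS JS] : ig mu (fun x => `|S f x| `^ p) /\
    J mu (fun x => `|S f x| `^ p) <= A3 * J mu (fun x => `|f x| `^ p).
  apply: A3P => // h bh; rewrite -sS//; exact: (prT f h Lf bh).2.
have /(LpP _ _ p0)[mf fi] := Lf.
split; first by apply/LpP => //; split => //; case: lS.
rewrite (Lnorm_J iS) (Lnorm_J fi) -EFinM lee_fin -powRM ?(ltW A30)//.
apply: ge0_ler_powR; [by rewrite invr_ge0 ltW| | |exact: JS]; rewrite nnegrE.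
  by apply: J_ge0 => x; exact: powR_ge0.
by apply: mulr_ge0; [exact: ltW A30|exact: f0].
Qed.

End Duality.

Theorem theorem7p3 (R : realType) (d : measure_display)
    (X : metricBorelType R d) (mu : {measure set X -> \bar R})
    (lam : X -> R -> R) (K : X -> X -> R) (T : (X -> R) -> X -> R) (rho : R)
    (X_doubling : geometrically_doubling X)
    (mu_doubling : upper_doubling mu lam)
    (T_CZO : CZ_operator mu lam K T)
    (T_L2 : Lp_bounded mu 2%:E T)
    (rho_gt1 : 1 < rho) :
  (exists S, extends_L2 mu T (H1at mu lam rho) S /\
     bounded_from mu (H1at mu lam rho) (H1at_norm mu lam rho) 1%E S) /\
  (forall p : R, 1 < p ->
     exists S, extends_L2 mu T (Lp mu p%:E) S /\ Lp_bounded mu p%:E S).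
Proof.
have [K' [C0 [C [c [delta [TK Tlin T2]]]]]] :=
  CZ_operatorP mu_doubling X_doubling T_CZO T_L2.
have [T' [TK' TT']] := adjoint_exists mu_doubling X_doubling TK.
have TT2 f h (f2 : Lp mu 2%:E f) (bh : bb h) :=
  adjoint_L2_pairing mu_doubling Tlin T2 TK' TT' f2 bh.
have T2' f (f2 : Lp mu 2%:E f) := (T2 f f2).1.
split=> [|p p1].
  have [D [D0 DP]] := osc_bound mu_doubling TK' rho_gt1.
  exact: (H1_bounded mu_doubling TK' T2' TT2 rho_gt1 D0 DP).
exact: (Lp_bounded_extension mu_doubling X_doubling TK TK' TT' T2' TT2 p1).
Qed.
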